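(* Let $Z\subset\mathbb{R}^n$ be an asymmetric $L_2$-zonoid. Then $$|Z\oplus_2 -Z|\le 2^n|Z|.$$ Equality holds if and only if $Z$ is contained in a hyperplane or $Z$ is the $L_2$-sum of $n$ segments each having the origin as an endpoint.
   Context: $|\cdot|$ denotes Lebesgue measure on $\mathbb{R}^n$. The support function of a compact convex set $K$ is $h_K(x)=\sup_{k\in K}\langle x,k\rangle$. For compact convex sets $K,L\subset\mathbb{R}^n$ containing the origin, the $L_2$-sum $K\oplus_2L$ is the compact convex set with $h_{K\oplus_2L}=(h_K^2+h_L^2)^{1/2}$; $-Z=\{-z:z\in Z\}$, and $Z\oplus_2-Z$ means $Z\oplus_2(-Z)$. An asymmetric $L_2$-zonotope is an $L_2$-sum of finitely many segments containing the origin; an asymmetric $L_2$-zonoid is a Hausdorff limit of asymmetric $L_2$-zonotopes. Equivalently, $Z$ is an asymmetric $L_2$-zonoid if and only if there is a positive (finite Borel) measure $\mu$ on the unit sphere $\mathbb{S}^{n-1}$ with $h_Z(x)=\left(\int_{\mathbb{S}^{n-1}}\langle x,u\rangle_+^2\,d\mu(u)\right)^{1/2}$ for all $x$, where $a_+=\max(a,0)$. *)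

(* Defs.v *)
From mathcomp Require Import all_boot all_order all_algebra.
From mathcomp Require Import all_classical all_reals all_analysis.

Set Implicit Arguments.
Unset Strict Implicit.
Unset Printing Implicit Defensive.

Import Order.TTheory GRing.Theory Num.Theory.
Import numFieldNormedType.Exports.

Local Open Scope classical_set_scope.
Local Open Scope ring_scope.

(* Lebesgue measure on n.-tuple R as the n-fold product of the library's
   one-dimensional [lebesgue_measure]; the empty product is the unit mass on
   the one-point space of 0-tuples. *)
Fixpoint lebesgue_tuple (R : realType) (n : nat) :
    set (n.-tuple (measurableTypeR R)) -> \bar R :=
  match n with
  | 0%N => \d_[tuple]
  | m.+1 =>
      pushforward (@lebesgue_measure R \x @lebesgue_tuple R m)%E
        (fun p : measurableTypeR R * m.-tuple (measurableTypeR R) =>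
           [tuple of p.1 :: p.2])
  end.

Definition volume (R : realType) (n : nat) (A : set 'rV[R]_n) : \bar R :=
  lebesgue_tuple [set t : n.-tuple (measurableTypeR R) |
                  A (\row_(i < n) (tnth t i : R))].

Section ConvexGeometry.
Variables (R : realType) (n : nat).
Implicit Types (x y a b : 'rV[R]_n) (K L M Z : set 'rV[R]_n).

Definition dotp x y : R := \sum_(i < n) x 0 i * y 0 i.

(* The library norm on row vectors is the sup norm. *)
Definition enorm x : R := Num.sqrt (dotp x x).

Definition convex_body K := [/\ K !=set0, compact K & convex_set K].

Definition support_fun K x : R := sup [set dotp x k | k in K].

Definition is_l2sum K L M :=
  convex_body M /\
  forall x, support_fun M x =
    Num.sqrt (support_fun K x ^+ 2 + support_fun L x ^+ 2).

(* "The" set such that [is_l2sum K L M]; the default value set0 is not reached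
   when K and L are compact convex sets containing the origin. *)
Definition l2sum K L : set 'rV[R]_n := xget set0 [set M | is_l2sum K L M].

Definition reflection K : set 'rV[R]_n := [set - x | x in K].

Definition segment a b : set 'rV[R]_n :=
  [set (1 - t) *: a + t *: b | t in `[0, 1]%classic].

(* {0} is the neutral element of [l2sum]. *)
Definition l2sum_seq (m : nat) (K : 'I_m -> set 'rV[R]_n) : set 'rV[R]_n :=
  \big[l2sum/[set 0]]_(i < m) K i.

Definition asymmetric_l2_zonotope Z :=
  exists (m : nat) (a b : 'I_m -> 'rV[R]_n),
    (forall i, segment (a i) (b i) 0) /\
    Z = l2sum_seq (fun i => segment (a i) (b i)).

Definition hausdorff_dist K L : R :=
  inf [set e : R | [/\ 0 <= e,
    forall x, K x -> exists2 y, L y & enorm (x - y) <= e &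
    forall y, L y -> exists2 x, K x & enorm (x - y) <= e]].

Definition asymmetric_l2_zonoid Z :=
  convex_body Z /\
  exists K : nat -> set 'rV[R]_n,
    (forall j, asymmetric_l2_zonotope (K j)) /\
    hausdorff_dist (K j) Z @[j --> \oo] --> (0 : R).

Definition hyperplane (H : set 'rV[R]_n) :=
  exists (v : 'rV[R]_n) (c : R), v != 0 /\ H = [set x | dotp x v = c].

End ConvexGeometry.

(* Main.v *)
Require Import Defs.
From HB Require Import structures.
From mathcomp Require Import all_boot all_order all_algebra.
From mathcomp Require Import all_classical all_reals all_analysis measurable_realfun.
From mathcomp Require Import ring lra.

Set Implicit Arguments.
Unset Strict Implicit.
Unset Printing Implicit Defensive.

Import Order.TTheory GRing.Theory Num.Theory.
Import numFieldNormedType.Exports.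

Local Open Scope classical_set_scope.
Local Open Scope ring_scope.

(** Write h for support functions, <.,.> for the inner product, B for the unit
    ball and a_+ for the positive part. A zonotope K that is the L_2-sum of the
    segments [0, u_i] satisfies h_K(x)^2 = \sum_i <x, u_i>_+^2. Adding the square
    of h_K(-x) removes the positive parts: K (+)_2 -K has squared support
    function <x A, x> with A = \sum_i u_i^T u_i. Factoring A = C C^T
    ([gram_factor]), it is the ellipsoid B C^T, of volume |det C| |B|
    ([ellipsoid_volume]). So the inequality for K reads
    |K| >= |det C| |B| / 2^n. If C is invertible, the linear map sending u_i to
    v_i = u_i (C^-1)^T reduces this to |K| >= |B| / 2^n when the v_i form a
    decomposition of the identity, \sum_i v_i^T v_i = 1. If C is singular, both
    bodies lie in a hyperplane.

    Lower bound. Averaging the indicators of the dilates of K against a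
    Gaussian density ([Lint_radial]) turns |K| into an integral of
    F = exp(-|y|_K^2) up to a constant, where |.|_K is the gauge of K, and duality
    gives F(\sum_i f_i v_i) >= exp(-\sum_i f_i^2) for f_i >= 0
    ([radial_fun_frame]). Following Barthe, let S transport the
    Gaussian measure of the line to twice that of the half-line and put
    T(w) = \sum_i |v_i| S(<w, d_i>) v_i with d_i = v_i / |v_i|. This map is
    injective, and its Jacobian det (\sum_i S'(<w, d_i>) v_i^T v_i) is at least
    \prod_i S'(<w, d_i>)^(|v_i|^2) by Ball's determinant inequality
    ([frame_det_ge]). The change of variables y = T(w) and the equation
    exp(-S^2) S' = exp(-t^2) / 2 bound the integral of F below by 2^-n times the
    Gaussian integral ([Lint_jac_le], [jac_ge]).

    Equality. A zonoid Z is only a limit of zonotopes K_j, so the equality cases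
    need a deficit that survives the limit. Because log S' is strictly
    monotone near 0, strict convexity in Ball's inequality adds to the lower bound
    a fixed multiple of
    \sum_i \sum_l <v_i, v_l>^2 |d_i - d_l|^2 ([frame_integral_ge],
    [zonotope_volume_ge]). The volume is upper semicontinuous ([volume_usc]) and
    the matrices A_j converge ([limit_moment]), which yields the inequality for
    Z; if it is an equality then the deficit of K_j tends to 0. A decomposition
    of the identity with small deficit contains n almost orthonormal directions
    ([greedy_frame]) that almost determine h_K ([frame_approx]). By
    compactness the frames so obtained from the K_j accumulate at n vectors whose
    segments have L_2-sum Z ([limit_frame]). Conversely, the L_2-sum of n
    segments [0, v_i] is the linear image of the positive part of the unit ball,
    whose volume is |B| / 2^n ([segments_equality]). *)

(** * Lebesgue measure on row vectors *)

Section MeasureTransport.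
Context d d' (T : measurableType d) (T' : measurableType d') (R : realType).
Variables (m : {sigma_finite_measure set T -> \bar R}) (f : T -> T') (g : T' -> T).
Hypotheses (mf : measurable_fun setT f) (mg : measurable_fun setT g)
  (fK : cancel f g).

(** The proofs among the arguments let the measure structures declared below be
    inferred from the term. *)
Definition transport (_ : measurable_fun setT f) (_ : measurable_fun setT g)
  (_ : cancel f g) := pushforward m f.
Local Notation tm := (transport mf mg fK).

Let tm0 : tm set0 = 0%E.
Proof. by rewrite /transport /pushforward preimage_set0 measure0. Qed.

Let tm_ge0 A : (0 <= tm A)%E.
Proof. exact: measure_ge0. Qed.

Let mpre A : measurable A -> measurable (f @^-1` A).
Proof. by move=> mA; rewrite -[X in measurable X]setTI; exact: mf. Qed.

Let tm_sigma_additive : semi_sigma_additive tm.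
Proof.
move=> F mF tF mUF; rewrite /transport /pushforward preimage_bigcup.
apply: measure_semi_sigma_additive.
- by move=> n; exact: mpre.
- apply/trivIsetP => /= i j _ _ ij; rewrite -preimage_setI.
  by move/trivIsetP : tF => /(_ _ _ _ _ ij) ->//; rewrite preimage_set0.
- by rewrite -preimage_bigcup; exact: mpre.
Qed.

HB.instance Definition _ := isMeasure.Build _ _ _ tm tm0 tm_ge0 tm_sigma_additive.

Let tm_sigma_finite : sigma_finite setT tm.
Proof.
have [F FT Ffin] := sigma_finiteT m.
exists (fun n => g @^-1` F n).
  apply/seteqP; split => // x _; have : [set: T] (g x) by [].
  by rewrite FT => -[k _ Fk]; exists k.
move=> i; have [mFi Fi] := Ffin i; split.
  by rewrite -[X in measurable X]setTI; exact: mg.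
rewrite /transport /pushforward -comp_preimage.
by rewrite (_ : g \o f = id) //; apply/funext => x /=; rewrite fK.
Qed.

HB.instance Definition _ := Measure_isSigmaFinite.Build _ _ _ tm tm_sigma_finite.

Lemma integral_transport (h : T' -> \bar R) :
  measurable_fun setT h -> (forall y, 0 <= h y)%E ->
  (\int[tm]_y h y = \int[m]_x h (f x))%E.
Proof.
by move=> mh h0; rewrite ge0_integral_pushforward.
Qed.
End MeasureTransport.

Section ProductSigmaFinite.
Context d1 d2 (T1 : measurableType d1) (T2 : measurableType d2) (R : realType).
Variables (m1 : {sigma_finite_measure set T1 -> \bar R})
  (m2 : {sigma_finite_measure set T2 -> \bar R}).

(** An alias of the product measure, to which sigma-finiteness is attached so
    that products can be iterated. *)
Definition prodm := (m1 \x m2)%E.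

HB.instance Definition _ := Measure.on prodm.

Let prodm_sigma_finite : sigma_finite setT prodm.
Proof.
by case: (lebesgue_integral_fubini.measure_function_Measure_isSigmaFinite__to__measure_function_isSigmaFinite m1 m2).
Qed.

HB.instance Definition _ := Measure_isSigmaFinite.Build _ _ _ prodm
  prodm_sigma_finite.
End ProductSigmaFinite.

Section Lebesgue.
Variable R : realType.
Local Notation RT := (measurableTypeR R).

Definition tcons (n : nat) (p : RT * n.-tuple RT) : n.+1.-tuple RT :=
  [tuple of p.1 :: p.2].
Definition tuncons (n : nat) (t : n.+1.-tuple RT) : RT * n.-tuple RT :=
  (thead t, [tuple of behead t]).

Lemma measurable_tcons n : measurable_fun setT (@tcons n).
Proof. exact: measurable_cons. Qed.

Lemma measurable_tuncons n : measurable_fun setT (@tuncons n).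
Proof.
apply: measurable_fun_pair; first exact: measurable_tnth.
exact: measurable_behead.
Qed.

Lemma tconsK n : cancel (@tcons n) (@tuncons n).
Proof. by move=> [x t]; rewrite /tuncons/=; congr pair; apply/val_inj. Qed.

(** [lebesgue_tuple] together with its structure of sigma-finite measure, which
    Tonelli's theorem requires at each step of the recursion. *)
Fixpoint leb (n : nat) : {sigma_finite_measure set (n.-tuple RT) -> \bar R} :=
  match n with
  | 0%N => \d_[tuple]
  | m.+1 => transport (prodm (@lebesgue_measure R) (leb m)) (@measurable_tcons m)
             (@measurable_tuncons m) (@tconsK m)
  end.

Lemma leb_tuple n : leb n = @lebesgue_tuple R n :> (set _ -> _).
Proof.
elim: n => //= n IH.
rewrite /transport/=/prodm.
by rewrite [leb n : set _ -> _]IH.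
Qed.

(** Both sides are measures that agree on half-open intervals. *)
Lemma lebesgue_affine (a b : R) (A : set RT) : 0 < a -> measurable A ->
  lebesgue_measure A = (a%:E * lebesgue_measure [set x : RT | A (a * x + b)%R])%E.
Proof.
move=> a0 mA.
pose f : RT -> RT := fun x => a * x + b.
have mf : measurable_fun setT f.
  by apply: measurable_funD => //; apply: measurable_funM.
pose g : RT -> RT := fun x => a^-1 * (x - b).
have mg : measurable_fun setT g.
  by apply: measurable_funM => //; apply: measurable_funB.
have fK : cancel f g by move=> x; rewrite /f /g addrK mulKf// gt_eqF.
pose m := mscale (NngNum (ltW a0)) (transport (@lebesgue_measure R) mf mg fK).
rewrite -[RHS]/(m A); apply: lebesgue_measure_unique => //.
move=> _ [[x y] _ <-] /=.
rewrite /m /mscale /= /transport /pushforward /=.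
have -> : f @^-1` `]x, y]%classic = `](x - b) / a, (y - b) / a]%classic.
  apply/seteqP; split => z /=; rewrite !in_itv/= /f ltr_pdivrMr// ler_pdivlMr// ltrBlDr lerBrDr mulrC //.
rewrite !lebesgue_measure_itv /= !lte_fin ltr_pM2r ?invr_gt0// ltrD2r.
case: ifP => _; last by rewrite mule0.
rewrite -!EFinB -EFinM -mulrBl mulrCA divff ?gt_eqF// mulr1; congr EFin; ring.
Qed.

Lemma lebesgue_affine_neq0 (a b : R) (A : set RT) : a != 0 -> measurable A ->
  lebesgue_measure A =
  (`|a|%:E * lebesgue_measure [set x : RT | A (a * x + b)%R])%E.
Proof.
rewrite neq_lt => /orP[a0|a0] mA; last by rewrite gtr0_norm//; exact: lebesgue_affine.
have na0 : 0 < - a by rewrite oppr_gt0.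
rewrite (lebesgue_affine b na0 mA) ltr0_norm//; congr (_ * _)%E.
have mg : measurable_fun setT (fun x : RT => a * x + b : RT).
  by apply: measurable_funD => //; apply: measurable_funM.
rewrite -(@lebesgue_measureN _ [set x : RT | A (a * x + b)%R]); last first.
  by rewrite -[X in measurable X]setTI; exact: mg.
congr (lebesgue_measure _); apply/seteqP.
by split => x /=; rewrite mulrN mulNr.
Qed.

Lemma integral_affine1 (a b : R) (f : RT -> \bar R) : a != 0 ->
  measurable_fun setT f -> (forall x, 0 <= f x)%E ->
  (\int[@lebesgue_measure R]_x f x =
  `|a|%:E * \int[@lebesgue_measure R]_x f (a * x + b)%R)%E.
Proof.
move=> a0 mf f0.
pose p : RT -> RT := fun x => a * x + b.
have mp : measurable_fun setT p.
  by apply: measurable_funD => //; apply: measurable_funM.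
pose q : RT -> RT := fun x => a^-1 * (x - b).
have mq : measurable_fun setT q.
  by apply: measurable_funM => //; apply: measurable_funB.
have pK : cancel p q by move=> x; rewrite /p /q addrK mulKf.
pose m := mscale (NngNum (normr_ge0 a)) (transport (@lebesgue_measure R) mp mq pK).
transitivity (\int[m]_x f x)%E.
  apply: eq_measure_integral => A mA _; exact: lebesgue_affine_neq0.
by rewrite ge0_integral_mscale//= integral_transport.
Qed.

Definition row_of n (t : n.-tuple RT) : 'rV[R]_n := \row_i tnth t i.
Definition of_row n (v : 'rV[R]_n) : n.-tuple RT := [tuple (v 0 i : RT) | i < n].

Lemma of_rowK n : cancel (@of_row n) (@row_of n).
Proof. by move=> v; apply/rowP => i; rewrite mxE tnth_mktuple. Qed.

(** Row vectors carry no sigma-algebra of their own: measurability and integrals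
    are read on tuples through [row_of]. *)
Definition rmfun d (T : measurableType d) n (f : 'rV[R]_n -> T) :=
  measurable_fun setT (f \o @row_of n).

Definition rmset n (A : set 'rV[R]_n) := measurable (@row_of n @^-1` A).

Definition Lint n (f : 'rV[R]_n -> \bar R) := (\int[leb n]_t f (row_of t))%E.

Lemma volumeE n (A : set 'rV[R]_n) : volume A = leb n (@row_of n @^-1` A).
Proof. by rewrite leb_tuple. Qed.

Lemma rmfun_coord n (i : 'I_n) : rmfun (fun v => v 0 i : RT).
Proof.
rewrite /rmfun (_ : _ \o _ = fun t => tnth t i); first exact: measurable_tnth.
by apply/funext => t /=; rewrite mxE.
Qed.

Lemma measurable_affine n p (M : 'M[R]_(n, p)) (b : 'rV[R]_p) :
  measurable_fun setT (fun t : n.-tuple RT => of_row (row_of t *m M + b)).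
Proof.
apply/measurable_fun_tnthP => i /=.
rewrite (_ : _ \o _ = fun t : n.-tuple RT => \sum_k (tnth t k * M k i) + b 0 i); last first.
  apply/funext => t /=; rewrite tnth_mktuple !mxE.
  by congr (_ + _); apply: eq_bigr => k _; rewrite mxE.
apply: measurable_funD => //; apply: measurable_sum => k.
by apply: measurable_funM => //; exact: measurable_tnth.
Qed.

Lemma rmfun_affine d (T : measurableType d) n p (f : 'rV[R]_p -> T) (M : 'M[R]_(n, p)) b :
  rmfun f -> rmfun (fun v => f (v *m M + b)).
Proof.
move=> mf; have := measurableT_comp mf (measurable_affine M b).
by rewrite /rmfun; congr measurable_fun; apply/funext => t /=; rewrite of_rowK.
Qed.

Lemma row_of_tcons n (x : RT) (t : n.-tuple RT) :
  row_of (tcons (x, t)) = row_mx (x%:M : 'rV_1) (row_of t) :> 'rV[R]_(1 + n).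
Proof.
apply/rowP => i; rewrite [LHS]mxE.
case: (split_ordP i) => j ->.
  rewrite row_mxEl !mxE (ord1 j) eqxx mulr1n.
  by rewrite (_ : lshift n 0 = ord0) //; apply/val_inj.
rewrite row_mxEr mxE (_ : rshift 1 j = lift ord0 j); last by apply/val_inj.
by rewrite tnthS; congr tnth; apply/val_inj.
Qed.

End Lebesgue.

Section LinearChange.
Variable R : realType.
Local Notation RT := (measurableTypeR R).

Lemma rmfun_section n (f : 'rV[R]_(1 + n) -> \bar R) (x : R) :
  rmfun f -> rmfun (fun v : 'rV_n => f (row_mx x%:M v)).
Proof.
move=> mf; rewrite /rmfun.
rewrite (_ : _ \o _ = (f \o @row_of R _) \o (fun t => tcons (x : RT, t))); last first.
  by apply/funext => t /=; rewrite row_of_tcons.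
apply: measurableT_comp => //; apply: measurableT_comp; first exact: measurable_tcons.
exact: measurable_fun_pair.
Qed.

Lemma measurable_uncurry n (f : 'rV[R]_(1 + n) -> \bar R) : rmfun f ->
  measurable_fun setT
   (fun p : RT * n.-tuple RT => f (row_mx (p.1 : R)%:M (row_of p.2))).
Proof.
move=> mf; rewrite (_ : (fun _ => _) = (f \o @row_of R _) \o @tcons R n); last first.
  by apply/funext => -[x t] /=; rewrite row_of_tcons.
apply: measurableT_comp => //; exact: measurable_tcons.
Qed.

Section cons.
Variables (n : nat) (f : 'rV[R]_(1 + n) -> \bar R).
Hypotheses (mf : rmfun f) (f0 : forall v, (0 <= f v)%E).

Lemma Lint_prod : Lint f = (\int[@lebesgue_measure R \x leb R n]_p
   f (row_mx (p.1 : R)%:M (row_of p.2)))%E.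
Proof.
rewrite /Lint integral_transport//=.
by apply: eq_integral => -[x t] _; rewrite row_of_tcons.
Qed.

Lemma Lint_cons : Lint f =
  (\int[@lebesgue_measure R]_x Lint (fun v => f (row_mx (x : R)%:M v)))%E.
Proof. by rewrite Lint_prod fubini_tonelli1//; exact: measurable_uncurry. Qed.

Lemma Lint_cons_swap : Lint f =
  Lint (fun v => \int[@lebesgue_measure R]_x f (row_mx (x : R)%:M v))%E.
Proof.
rewrite Lint_prod fubini_tonelli1//; last exact: measurable_uncurry.
by rewrite (@fubini_tonelli _ _ _ _ _ (@lebesgue_measure R) (leb R n) _ (measurable_uncurry mf) (fun p => f0 _)).
Qed.

Lemma rmfun_int : rmfun (fun v => \int[@lebesgue_measure R]_x f (row_mx (x : R)%:M v))%E.
Proof. by apply: (@measurable_fun_fubini_tonelli_G _ _ _ _ _ (@lebesgue_measure R) _ (measurable_uncurry mf) (fun p => f0 _)). Qed.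

Lemma measurable_Lint :
  measurable_fun (setT : set RT) (fun x : RT => Lint (fun v => f (row_mx (x : R)%:M v))).
Proof. by apply: (@measurable_fun_fubini_tonelli_F _ _ _ _ _ (leb R n) _ (measurable_uncurry mf) (fun p => f0 _)). Qed.

Lemma measurable_line (v : 'rV[R]_n) :
  measurable_fun (setT : set RT) (fun x : RT => f (row_mx (x : R)%:M v)).
Proof.
have := measurableT_comp (measurable_uncurry mf)
  (@measurable_pair2 _ _ (measurableTypeR R) _ (of_row v)).
by rewrite /comp/= of_rowK.
Qed.
End cons.

(** The change of variables formula for one affine map. It is stable under
    composition, so elementary factors suffice. *)
Definition affine_change n (M : 'M[R]_n) (b : 'rV[R]_n) := forall f, rmfun f ->
  (forall v, 0 <= f v)%E ->
  Lint f = (`|\det M|%:E * Lint (fun v => f (v *m M + b)%R))%E.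

Lemma affine_change_comp n (M N : 'M[R]_n) b c :
  affine_change M b -> affine_change N c -> affine_change (M *m N) (b *m N + c).
Proof.
move=> gM gN f mf f0; rewrite (gN _ mf f0) gM; last by move=> v; exact: f0.
  rewrite muleA -EFinM -normrM det_mulmx [\det N * _]mulrC.
  by under [in RHS]eq_fun do rewrite mulmxA addrA -mulmxDl.
exact: rmfun_affine.
Qed.

Lemma Lint_ge0 n (f : 'rV[R]_n -> \bar R) : (forall v, 0 <= f v)%E -> (0 <= Lint f)%E.
Proof. by move=> f0; apply: integral_ge0 => t _. Qed.

Lemma Lint_scale n (k : R) (f : 'rV[R]_n -> \bar R) : 0 <= k -> rmfun f ->
  (forall v, 0 <= f v)%E -> Lint (fun v => k%:E * f v)%E = (k%:E * Lint f)%E.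
Proof. by move=> k0 mf f0; rewrite /Lint ge0_integralZl_EFin. Qed.

Lemma affine_change_diag n a (D : 'M[R]_n) (c : R) (b : 'rV_n) : a != 0 -> affine_change D b ->
  @affine_change (1 + n) (block_mx a%:M 0 0 D) (row_mx c%:M b).
Proof.
move=> a0 gD f mf f0.
rewrite Lint_cons// (@integral_affine1 _ a c)//; last 2 first.
- exact: measurable_Lint.
- by move=> x; exact: Lint_ge0.
rewrite det_ublock det_scalar1 normrM EFinM -muleA; congr (_ * _)%E.
rewrite Lint_cons//; last first.
  exact: (@rmfun_affine _ _ _ _ _ f (block_mx a%:M 0 0 D) (row_mx c%:M b)).
rewrite -ge0_integralZl_EFin//; last 2 first.
- by move=> x _; exact: Lint_ge0.
- apply: (@measurable_Lint n (fun v => f (v *m block_mx a%:M 0 0 D + row_mx c%:M b))) => [|v].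
    2: exact: f0.
  exact: (@rmfun_affine _ _ _ _ _ f (block_mx a%:M 0 0 D) (row_mx c%:M b)).
apply: eq_integral => x _.
rewrite (gD (fun v => f (row_mx (a * x + c)%:M v)))//; last exact: rmfun_section.
congr (_ * _)%E; congr Lint; apply/funext => v; congr f.
rewrite mul_row_block !mulmx0 addr0 add0r add_row_mx; congr row_mx.
by rewrite -scalar_mxM -raddfD/= mulrC.
Qed.

(** With the first coordinate fixed, this shear translates the others: Tonelli's
    theorem reduces it to translation invariance. *)
Lemma affine_change_shear_r n (u : 'rV[R]_n) :
  (forall b, affine_change (1%:M : 'M[R]_n) b) ->
  @affine_change (1 + n) (block_mx 1%:M u 0 1%:M) 0.
Proof.
move=> gn f mf f0; rewrite det_ublock !det1 mulr1 normr1 mul1e.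
have mf' := @rmfun_affine _ _ _ _ _ f (block_mx 1%:M u 0 1%:M) 0 mf.
rewrite (Lint_cons mf f0) (Lint_cons mf' (fun v => f0 _)); apply: eq_integral => x _.
rewrite (gn ((x : R) *: u) (fun v => f (row_mx (x : R)%:M v)))//; last exact: rmfun_section.
rewrite det1 normr1 mul1e; congr Lint; apply/funext => v; congr f.
by rewrite mul_row_block !mulmx0 addr0 !mulmx1 mul_scalar_mx addr0 addrC.
Qed.

Lemma affine_change_shear_l n (u : 'cV[R]_n) :
  @affine_change (1 + n) (block_mx 1%:M 0 u 1%:M) 0.
Proof.
move=> f mf f0; rewrite det_lblock !det1 mulr1 normr1 mul1e.
have mf' := @rmfun_affine _ _ _ _ _ f (block_mx 1%:M 0 u 1%:M) 0 mf.
rewrite (Lint_cons_swap mf f0) (Lint_cons_swap mf' (fun v => f0 _)); congr Lint; apply/funext => v.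
rewrite (@integral_affine1 _ 1 ((v *m u) 0 0))//; last exact: measurable_line.
rewrite normr1 mul1e; apply: eq_integral => x _; congr f.
rewrite mul_row_block !mulmx0 add0r !mulmx1 addr0; congr row_mx.
by apply/rowP => i; rewrite !mxE !ord1 /= !mulr1n mul1r.
Qed.

(** By induction on n: once the top left entry is nonzero, the matrix is a
    product of two shears and a block diagonal matrix; another shear makes that
    entry nonzero when it vanishes. *)
Lemma affine_change_unit n (M : 'M[R]_n) b : M \in unitmx -> affine_change M b.
Proof.
elim: n M b => [|n IH] M b Mu.
  move=> f mf f0; rewrite det_mx00 normr1 mul1e; congr Lint; apply/funext => v.
  by congr f; apply/rowP; case.
have g1 (c : 'rV_n) : affine_change 1%:M c by apply: IH; exact: unitmx1.
have main (N : 'M[R]_(1 + n)) c : N \in unitmx -> ulsubmx N 0 0 != 0 -> affine_change N c.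
  move=> Nu a0; set a := ulsubmx N 0 0 in a0.
  pose S := drsubmx N - a^-1 *: (dlsubmx N *m ursubmx N).
  pose L := block_mx 1%:M 0 (a^-1 *: dlsubmx N) 1%:M : 'M[R]_(1 + n).
  pose D := block_mx a%:M 0 0 S : 'M[R]_(1 + n).
  pose U := block_mx 1%:M (a^-1 *: ursubmx N) 0 1%:M : 'M[R]_(1 + n).
  have NE : N = L *m D *m U.
    rewrite /L /D /U !mulmx_block !(mulmx0, mulmx1, mul0mx, mul1mx, addr0, add0r).
    rewrite -[LHS]submxK; congr block_mx.
    - by apply/matrixP => i j; rewrite !ord1 [RHS]mxE eqxx mulr1n.
    - by rewrite mul_scalar_mx scalerA divff// scale1r.
    - by rewrite mul_mx_scalar scalerA divff// scale1r.
    - by rewrite mul_mx_scalar scalerA divff// scale1r /S -scalemxAr addrC subrK.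
  have Su : S \in unitmx.
    move: Nu; rewrite NE !unitmxE !det_mulmx /L /D /U !det_ublock !det_lblock !det1.
    by rewrite !mul1r !mulr1 unitrM => /andP[].
  have gD : affine_change D (c *m invmx U).
    rewrite -[c *m _](@hsubmxK _ _ 1 n).
    rewrite [lsubmx _](_ : _ = (lsubmx (c *m invmx U : 'rV_(1+n)) 0 0)%:M); last first.
      by apply/rowP => i; rewrite !ord1 [RHS]mxE eqxx mulr1n.
    by apply: affine_change_diag => //; exact: IH.
  have := affine_change_comp (affine_change_comp (@affine_change_shear_l n (a^-1 *: dlsubmx N)) gD)
    (@affine_change_shear_r n (a^-1 *: ursubmx N) g1).
  rewrite -/L -/U -NE mul0mx add0r mulmxKV ?addr0//.
  by rewrite unitmxE det_ublock !det1 mulr1 unitr1.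
move: (M : 'M[R]_(1 + n)) Mu => {}M Mu.
have [a0|] := eqVneq (ulsubmx M 0 0) 0; last exact: main.
have [i ni0] : exists i, dlsubmx M i 0 != 0.
  apply/existsP; rewrite -[X in is_true X]negbK negb_exists; apply/negP => /forallP H.
  have ul0 : ulsubmx M = 0%:M.
    by apply/matrixP => i j; rewrite !ord1 a0 [RHS]mxE mul0rn.
  have dl0 : dlsubmx M = 0.
    apply/matrixP => i j; rewrite [RHS]mxE [j]ord1; apply/eqP.
    by have := H i; rewrite negbK.
  have detM : \det M = 0.
    rewrite -[M]submxK dl0 ul0 (@det_ublock _ 1 n) det_scalar1 mul0r //.
  move: Mu; rewrite unitmxE [X in X \is a _]detM.
  by rewrite unitr0.
pose u := ((dlsubmx M i 0)^-1 *: delta_mx 0 i) : 'rV[R]_n.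
pose N := (block_mx 1%:M u 0 1%:M : 'M[R]_(1 + n)) *m (M : 'M[R]_(1 + n)).
have ME : M = (block_mx 1%:M (- u) 0 1%:M : 'M[R]_(1 + n)) *m N.
  rewrite /N mulmxA mulmx_block !(mulmx0, mulmx1, mul0mx, mul1mx, addr0, add0r).
  by rewrite subrr -scalar_mx_block mul1mx.
rewrite ME -[b]add0r -(mul0mx _ N).
apply: affine_change_comp; first exact: affine_change_shear_r.
apply: main.
  by rewrite unitmx_mul Mu andbT unitmxE det_ublock !det1 mulr1 unitr1.
rewrite /N -{1}[M]submxK mulmx_block block_mxKul mul1mx.
rewrite mxE a0 add0r /u -scalemxAl mxE -rowE [row _ _ _ _]mxE mulVf ?oner_eq0//.
Qed.

End LinearChange.

Section Borel.
Variables (R : realType) (n : nat).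
Local Notation RT := (measurableTypeR R).
Implicit Types A : set 'rV[R]_n.

Lemma rmset_preimage d (T : measurableType d) (f : 'rV[R]_n -> T) (B : set T) :
  rmfun f -> measurable B -> rmset (f @^-1` B).
Proof. by move=> mf mB; rewrite /rmset -comp_preimage -[X in measurable X]setTI; exact: mf. Qed.

Lemma rmset_ball (x : 'rV[R]_n) e : 0 < e -> rmset (ball x e).
Proof.
move=> e0.
rewrite (_ : ball x e = \bigcap_(i in [set: 'I_n]) [set v : 'rV_n | ball (x 0 i) e (v 0 i)]); last first.
  apply/seteqP; split => [v [_ xv] i _|v xv]; first exact: xv.
  by split => // i j; rewrite (ord1 i); exact: xv.
rewrite /rmset preimage_bigcap; apply: fin_bigcap_measurable; first exact: finite_finset.
move=> i _; apply: (@rmset_preimage _ _ (fun v => v 0 i : RT) (ball (x 0 i) e)).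
  exact: rmfun_coord.
exact: measurable_ball.
Qed.

(** An open set is the union of the balls of rational centre and radius 1/(k+1)
    that it contains, and there are countably many of them. *)
Lemma rmset_open A : open A -> rmset A.
Proof.
move=> oA.
pose rq (q : 'rV[rat]_n) : 'rV[R]_n := map_mx ratr q.
pose C (p : 'rV[rat]_n * nat) : set 'rV[R]_n :=
  if `[< ball (rq p.1) p.2.+1%:R^-1 `<=` A >] then ball (rq p.1) p.2.+1%:R^-1 else set0.
have -> : A = \bigcup_p C p.
  apply/seteqP; split => [x Ax|x [p _]]; last first.
    by rewrite /C; case: ifP => // /asboolP; apply.
  have /nbhs_ballP[e /= e0 xe] : nbhs x A by exact: open_nbhs_nbhs.
  pose k := Num.trunc (2 / e); have k0 : 0 < k.+1%:R^-1 :> R by [].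
  have k2 : k.+1%:R^-1 < e / 2.
    by rewrite -[e / 2]invrK ltf_pV2 ?posrE ?invr_gt0 ?divr_gt0// invf_div; exact: truncnS_gt.
  have /choice[q qP] : forall i, exists q : rat, ball (x 0 i) k.+1%:R^-1 (ratr q).
    move=> i; have : x 0 i - k.+1%:R^-1 < x 0 i + k.+1%:R^-1 by rewrite ltrD2l gtrN.
    move=> /rat_in_itvoo[q]; rewrite in_itv/= => /andP[q1 q2].
    by exists q; rewrite -ball_normE /= distrC ltr_distl q2 andbT.
  exists (\row_i q i, k) => //; rewrite /C /=.
  have bx : ball (rq (\row_i q i)) k.+1%:R^-1 x.
    by split=> // i j; rewrite (ord1 i) !mxE; apply: ball_sym.
  rewrite asboolT// => z qz; apply: xe.
  have := ball_triangle (ball_sym bx) qz; apply: le_ball.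
  by rewrite (splitr e) lerD// ltW.
rewrite /rmset preimage_bigcup; apply: (@countable_bigcupT_measurable _ _ _ (fun p => _ @^-1` C p)).
  exact: countableP.
move=> p; rewrite /C; case: ifP => _; last by rewrite preimage_set0.
by have := (@rmset_ball (rq p.1) p.2.+1%:R^-1); apply; rewrite invr_gt0 ltr0n.
Qed.

Lemma rmset_closed A : closed A -> rmset A.
Proof.
move=> cA; rewrite -[A]setCK /rmset preimage_setC; apply: measurableC.
exact: (rmset_open (closed_openC cA)).
Qed.

Lemma rmfun_continuous (f : 'rV[R]_n -> R) : continuous f -> rmfun (f : _ -> RT).
Proof.
move=> cf; apply: (measurability (@RGenOpens.G R)); first exact: RGenOpens.measurableE.
move=> _ [_ [a [b ->]] <-]; rewrite setTI.
have : open (f @^-1` `]a, b[%classic).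
  by apply: open_comp => [x _|]; [exact: cf|exact: interval_open].
by move=> /rmset_open.
Qed.

Lemma rmfun_EFin (f : 'rV[R]_n -> R) : rmfun (f : _ -> RT) -> rmfun (fun v => (f v)%:E).
Proof. by move=> mf; exact/measurable_EFinP. Qed.

Lemma rmfun_indic A : rmset A -> rmfun (\1_A : _ -> RT).
Proof.
move=> mA; rewrite /rmfun (_ : _ \o _ = \1_(@row_of R n @^-1` A)).
  exact: measurable_indic.
by apply/funext => t /=; rewrite !indicE.
Qed.

Lemma volume_Lint A : rmset A -> volume A = Lint (fun v => (\1_A v)%:E).
Proof.
move=> mA; rewrite volumeE /Lint.
have := integral_indic (leb R n) measurableT mA; rewrite setIT => <-.
by apply: eq_integral => t _; rewrite !indicE.
Qed.

Lemma volume_ge0 A : (0 <= volume A)%E.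
Proof. by rewrite volumeE measure_ge0. Qed.

Lemma Lint_eq (f g : 'rV[R]_n -> \bar R) : (forall v, f v = g v) -> Lint f = Lint g.
Proof. by move=> fg; congr Lint; apply/funext. Qed.

Lemma Lint_le (f g : 'rV[R]_n -> \bar R) : rmfun f -> rmfun g ->
  (forall v, 0 <= f v)%E -> (forall v, f v <= g v)%E -> (Lint f <= Lint g)%E.
Proof.
move=> mf mg f0 fg; apply: ge0_le_integral => // t _; exact: le_trans (f0 _) (fg _).
Qed.

Lemma Lint_add (f g : 'rV[R]_n -> \bar R) : rmfun f -> rmfun g ->
  (forall v, 0 <= f v)%E -> (forall v, 0 <= g v)%E ->
  Lint (fun v => f v + g v)%E = (Lint f + Lint g)%E.
Proof. by move=> mf mg f0 g0; rewrite /Lint ge0_integralD. Qed.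

Lemma Lint_sum (I : Type) (s : seq I) (f : I -> 'rV[R]_n -> \bar R) :
  (forall i, rmfun (f i)) ->  (forall i v, 0 <= f i v)%E ->
  Lint (fun v => \sum_(i <- s) f i v)%E = (\sum_(i <- s) Lint (f i))%E.
Proof. by move=> mf f0; rewrite /Lint (ge0_integral_sum _ _ (f := fun i t => f i (row_of t))). Qed.

Lemma rmset_linear (M : 'M[R]_n) A : M \in unitmx -> rmset A ->
  rmset [set v *m M | v in A].
Proof.
move=> Mu mA; rewrite (_ : [set _ | _ in _] = (fun v => v *m invmx M + 0) @^-1` A).
  have := measurable_affine (invmx M) (0 : 'rV_n).
  move=> /(_ measurableT _ mA); rewrite setTI /rmset; congr measurable.
  by apply/seteqP; split => t /=; rewrite of_rowK.
apply/seteqP; split => [_ [v Av <-]|v] /=; rewrite addr0 ?mulmxK//.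
by move=> Av; exists (v *m invmx M); rewrite ?mulmxKV.
Qed.

Lemma volume_linear (M : 'M[R]_n) A : M \in unitmx -> rmset A ->
  volume [set v *m M | v in A] = (`|\det M|%:E * volume A)%E.
Proof.
move=> Mu mA; rewrite !volume_Lint//; last exact: rmset_linear.
rewrite (affine_change_unit 0 Mu)//; last 1 first.
- by apply: rmfun_EFin; apply: rmfun_indic; exact: rmset_linear.
congr (_ * _)%E; apply: Lint_eq => v; rewrite addr0; congr EFin.
rewrite !indicE; congr (_%:R); congr (nat_of_bool _).
apply/idP/idP; last by rewrite !inE => Av; exists v.
by rewrite !inE => -[w Aw wv]; rewrite -[v](mulmxK Mu) -wv mulmxK.
Qed.

End Borel.

(** * Gaussian integrals and radial averages *)

Section LayerCake.
Variables (R : realType).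
Local Notation RT := (measurableTypeR R).

Lemma rmfun_prod n (h : R -> R) : measurable_fun setT h ->
  rmfun (fun v : 'rV[R]_n => \prod_i h (v 0 i) : RT).
Proof.
move=> mh; rewrite /rmfun /comp /=.
apply: (@measurable_prod _ _ _ _ _ _ (fun i t => h (row_of t 0 i))) => i _.
apply: (measurableT_comp mh); exact: rmfun_coord.
Qed.

Lemma Lint_tensor n (h : R -> R) c : measurable_fun setT h -> (forall x, 0 <= h x) ->
  (\int[@lebesgue_measure R]_x (h x)%:E = c%:E)%E ->
  Lint (fun v : 'rV[R]_n => (\prod_i h (v 0 i))%:E) = (c ^+ n)%:E.
Proof.
move=> mh h0 hc; have c0 : 0 <= c.
  by rewrite -lee_fin -hc; apply: integral_ge0 => x _; rewrite lee_fin.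
elim: n => [|n IH].
  rewrite /Lint /= integral_dirac//=.
    by rewrite big_ord0 diracT mul1e.
  exact: (rmfun_EFin (@rmfun_prod 0 h mh)).
rewrite (@Lint_cons _ n)//; last 2 first.
- by apply: rmfun_EFin; exact: rmfun_prod.
- by move=> v; rewrite lee_fin prodr_ge0.
rewrite exprS EFinM -hc -ge0_integralZr//; last 3 first.
- by apply/measurable_EFinP.
- by move=> x _; rewrite lee_fin.
- by rewrite lee_fin exprn_ge0.
apply: eq_integral => x _.
rewrite -IH -Lint_scale//; last 2 first.
- by apply: rmfun_EFin; exact: rmfun_prod.
- by move=> v; rewrite lee_fin prodr_ge0.
apply: Lint_eq => v; rewrite -EFinM; congr EFin.
rewrite (@big_split_ord _ _ _ 1 n) big_ord1 /=.
congr (h _ * _); last by apply: eq_bigr => i _; congr h; exact: row_mxEr.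
by apply: etrans (row_mxEl _ _ _ _) _; rewrite mxE eqxx mulr1n.
Qed.

Definition gaussian n (v : 'rV[R]_n) : R := expR (- dotp v v).

Lemma gaussianE n (v : 'rV[R]_n) : gaussian v = \prod_i gauss_fun (v 0 i).
Proof.
rewrite /gaussian /dotp /gauss_fun -expR_sum sumrN.
by congr (expR (- _)); apply: eq_bigr => i _; rewrite expr2.
Qed.

Lemma rmfun_gaussian n : rmfun (@gaussian n : _ -> RT).
Proof.
rewrite (_ : @gaussian n = fun v => \prod_i gauss_fun (v 0 i)); last first.
  by apply/funext => v; rewrite gaussianE.
by apply: rmfun_prod; exact: measurable_gauss_fun.
Qed.

Lemma gaussian_ge0 n (v : 'rV[R]_n) : 0 <= gaussian v.
Proof. exact: expR_ge0. Qed.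

Lemma Lint_gaussian n : Lint (fun v : 'rV[R]_n => (gaussian v)%:E) = ((Num.sqrt pi) ^+ n)%:E.
Proof.
under Lint_eq do rewrite gaussianE.
apply: Lint_tensor; [exact: measurable_gauss_fun|exact: gauss_fun_ge0|exact: integralT_gauss].
Qed.

(** The density on the positive half-line whose tail beyond a is expR (- a ^+
    2). *)
Definition radial (r : R) : R := if 0 < r then 2 * r * expR (- r ^+ 2) else 0.

Lemma radial_ge0 r : 0 <= radial r.
Proof.
by rewrite /radial; case: ifP => // r0; rewrite !mulr_ge0 ?expR_ge0 ?(ltW r0).
Qed.

Lemma measurable_radial : measurable_fun setT (radial : RT -> RT).
Proof.
apply: measurable_fun_ifT => //.
- by apply: measurable_fun_ltr.
- apply: measurable_funM; first by apply: measurable_funM.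
  by apply: measurableT_comp => //; apply: measurableT_comp => //; exact: measurable_funX.
Qed.

Lemma radial_tail (a : R) : 0 <= a ->
  (\int[@lebesgue_measure R]_(r in `[a, +oo[) (radial r)%:E = (expR (- a ^+ 2))%:E)%E.
Proof.
move=> a0.
have dE (x : R) : is_derive x 1 (fun r => - expR (- r ^+ 2)) (2 * x * expR (- x ^+ 2)).
  by apply: is_derive_eq; rewrite /GRing.scale/=; ring.
have cE : continuous (fun r : R => - expR (- r ^+ 2)).
  by move=> x; apply: differentiable_continuous; apply/derivable1_diffP; case: (dE x).
transitivity (\int[@lebesgue_measure R]_(r in `[a, +oo[) (2 * r * expR (- r ^+ 2))%:E)%E.
  apply: eq_integral => x; rewrite inE/= in_itv/= andbT => ax; congr EFin.
  rewrite /radial; case: ifPn => // x0.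
  by rewrite (_ : x = 0) ?mulr0 ?mul0r//; apply/eqP; rewrite eq_le leNgt x0 (le_trans a0 ax).
rewrite (@ge0_continuous_FTC2y _ _ (fun r => - expR (- r ^+ 2)) a 0).
- by rewrite -EFinB sub0r opprK.
- by move=> x ax; rewrite !mulr_ge0 ?expR_ge0// (le_trans a0).
- apply: continuous_subspaceT => x; apply: continuousM.
    by apply: continuousM; [exact: cvg_cst|exact: cvg_id].
  exact: continuous_gauss_fun.
- by rewrite -oppr0; apply: cvgN; exact: cvg_gauss_fun.
- by move=> x _; case: (dE x).
- by apply: cvg_at_right_filter; exact: cE.
- by move=> x _; rewrite derive1E; case: (dE x).
Qed.

Variable n : nat.
Implicit Types (Z : set 'rV[R]_n) (y v : 'rV[R]_n).

(** For r > 0 this is r^-1 *: y; written as a power, the factor is plainly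
    measurable in r. *)
Definition dil (r : R) y : 'rV[R]_n := r `^ (-1) *: y.

(** For a star-shaped Z this is expR (- g ^+ 2), with g the gauge of Z at y. *)
Definition radial_fun Z y : \bar R :=
  (\int[@lebesgue_measure R]_r (radial r * \1_Z (dil r y))%:E)%E.

Definition radial_moment : \bar R := (\int[@lebesgue_measure R]_r (radial r * r ^+ n)%:E)%E.

Let f Z (p : 'rV[R]_(1 + n)) : \bar R :=
  (radial (lsubmx p 0 0) * \1_Z (dil (lsubmx p 0 0) (rsubmx p)))%:E.

Let f_ge0 Z p : (0 <= f Z p)%E.
Proof. by rewrite lee_fin mulr_ge0 ?radial_ge0// indicE ler0n. Qed.

Let mf Z : rmset Z -> rmfun (f Z).
Proof.
move=> mZ; apply: rmfun_EFin.
have m0 i : rmfun (fun p : 'rV[R]_(1 + n) => lsubmx p 0 i : RT).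
  under eq_fun do rewrite mxE. exact: rmfun_coord.
rewrite /rmfun /comp/=; apply: measurable_funM.
  by apply: (measurableT_comp measurable_radial); exact: m0.
have mg : measurable_fun setT (fun t : (1 + n).-tuple RT => of_row (dil (lsubmx (row_of t) 0 0) (rsubmx (row_of t)))).
  apply/measurable_fun_tnthP => i.
  rewrite (_ : _ \o _ = fun t : (1 + n).-tuple RT => (lsubmx (row_of t) 0 0 : R) `^ (-1) * row_of t 0 (rshift 1 i)); last first.
    by apply/funext => t; rewrite /= tnth_mktuple /dil !mxE.
  apply: measurable_funM; last exact: rmfun_coord.
  by apply: (measurableT_comp (@measurable_powR R (-1))); exact: m0.
have := measurableT_comp (rmfun_indic mZ) mg.
by congr measurable_fun; apply/funext => t /=; rewrite of_rowK.
Qed.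

Let fE Z (r : R) y : f Z (row_mx r%:M y) = (radial r * \1_Z (dil r y))%:E.
Proof. by rewrite /f row_mxKl row_mxKr mxE eqxx mulr1n. Qed.

Lemma rmfun_radial Z : rmset Z -> rmfun (radial_fun Z).
Proof.
move=> mZ; have := rmfun_int (mf mZ) (@f_ge0 Z).
congr rmfun; apply/funext => y; apply: eq_integral => r _; exact: fE.
Qed.

Lemma measurable_radial_line Z y : rmset Z ->
  measurable_fun (setT : set RT) (fun r : RT => (radial r * \1_Z (dil r y))%:E : \bar R).
Proof.
move=> mZ; have := measurable_line (mf mZ) y.
by congr measurable_fun; apply/funext => r; exact: fE.
Qed.

Lemma radial_fun_ge0 Z y : (0 <= radial_fun Z y)%E.
Proof. by apply: integral_ge0 => r _; rewrite lee_fin mulr_ge0 ?radial_ge0// indicE ler0n. Qed.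

Lemma radial_moment_ge0 : (0 <= radial_moment)%E.
Proof.
apply: integral_ge0 => r _; rewrite lee_fin /radial.
by case: ifP => r0; rewrite ?mul0r// !mulr_ge0 ?expR_ge0 ?exprn_ge0 ?(ltW r0).
Qed.

(** Tonelli's theorem and the homogeneity of the volume under the dilation by r.
    *)
Lemma Lint_radial Z : rmset Z -> Lint (radial_fun Z) = (radial_moment * volume Z)%E.
Proof.
move=> mZ.
transitivity (Lint (fun y => \int[@lebesgue_measure R]_r f Z (row_mx (r : R)%:M y))%E).
  by apply: Lint_eq => y; apply: eq_integral => r _; rewrite fE.
rewrite -(Lint_cons_swap (mf mZ) (@f_ge0 Z)) (Lint_cons (mf mZ) (@f_ge0 Z)).
rewrite /radial_moment -ge0_integralZr ?volume_ge0//; last 2 first.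
- apply/measurable_EFinP; apply: measurable_funM; first exact: measurable_radial.
  exact: measurable_funX.
- move=> r _; rewrite lee_fin /radial.
  by case: ifP => r0; rewrite ?mul0r// !mulr_ge0 ?expR_ge0 ?exprn_ge0 ?(ltW r0).
apply: eq_integral => r _; under Lint_eq do rewrite fE EFinM.
have mI : rmfun (fun y => (\1_Z (dil r y))%:E : \bar R).
  have := rmfun_EFin (rmfun_affine (r `^ (-1))%:M 0 (rmfun_indic mZ)).
  by congr rmfun; apply/funext => y; rewrite addr0 mul_mx_scalar.
rewrite Lint_scale ?radial_ge0//.
rewrite EFinM -muleA; have [r0|r0] := ltP 0 r; last first.
  by rewrite /radial ltNge r0 /= !mul0e.
congr (_ * _)%E; rewrite (volume_Lint mZ).
have ru : (r `^ (-1))%:M \in @unitmx R n.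
  by rewrite unitmxE det_scalar unitrX// unitfE gt_eqF// powR_gt0.
rewrite (affine_change_unit 0 ru (rmfun_EFin (rmfun_indic mZ))); last first.
  by move=> y; rewrite lee_fin indicE ler0n.
rewrite muleA -EFinM det_scalar powR_inv1 ?(ltW r0)// ger0_norm; last first.
  by rewrite exprn_ge0 // invr_ge0 ltW.
rewrite -exprMn divff ?gt_eqF// expr1n mul1e; apply: Lint_eq => y.
by rewrite addr0 mul_mx_scalar /dil powR_inv1// ltW.
Qed.
End LayerCake.

Section BigCvg.
Context (R : realType) (T : Type) (F : set_system T) (FF : Filter F).

Lemma cvg_sumf (I : Type) (s : seq I) (P : pred I) (f : I -> T -> R) (l : I -> R) :
  (forall i, P i -> f i x @[x --> F] --> l i) ->
  \sum_(i <- s | P i) f i x @[x --> F] --> \sum_(i <- s | P i) l i.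
Proof.
move=> fl; elim: s => [|i s IH].
  by under eq_fun do rewrite big_nil; rewrite big_nil; exact: cvg_cst.
under eq_fun do rewrite big_cons; rewrite big_cons; case: ifP => // Pi.
by apply: cvgD => //; exact: fl.
Qed.

Lemma cvg_prodf (I : Type) (s : seq I) (P : pred I) (f : I -> T -> R) (l : I -> R) :
  (forall i, P i -> f i x @[x --> F] --> l i) ->
  \prod_(i <- s | P i) f i x @[x --> F] --> \prod_(i <- s | P i) l i.
Proof.
move=> fl; elim: s => [|i s IH].
  by under eq_fun do rewrite big_nil; rewrite big_nil; exact: cvg_cst.
under eq_fun do rewrite big_cons; rewrite big_cons; case: ifP => // Pi.
by apply: cvgM => //; exact: fl.
Qed.
End BigCvg.

Section Ball.
Variables (R : realType) (n : nat).
Local Notation RT := (measurableTypeR R).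
Implicit Types (Z : set 'rV[R]_n) (x y v : 'rV[R]_n).

Lemma dotpC x y : dotp x y = dotp y x.
Proof. by apply: eq_bigr => i _; rewrite mulrC. Qed.

Lemma dotpZl a x y : dotp (a *: x) y = a * dotp x y.
Proof. by rewrite /dotp mulr_sumr; apply: eq_bigr => i _; rewrite mxE mulrA. Qed.

Lemma dotpZr a x y : dotp x (a *: y) = a * dotp x y.
Proof. by rewrite dotpC dotpZl dotpC. Qed.

Lemma dotpDl x y z : dotp (x + y) z = dotp x z + dotp y z.
Proof. by rewrite /dotp -big_split; apply: eq_bigr => i _; rewrite mxE mulrDl. Qed.

Lemma dotpDr x y z : dotp z (x + y) = dotp z x + dotp z y.
Proof. by rewrite dotpC dotpDl dotpC (dotpC y). Qed.

Lemma dotp0l x : dotp 0 x = 0.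
Proof. by rewrite -(scale0r 0) dotpZl mul0r. Qed.

Lemma dotp0r x : dotp x 0 = 0.
Proof. by rewrite dotpC dotp0l. Qed.

Lemma dotpNl x y : dotp (- x) y = - dotp x y.
Proof. by rewrite -scaleN1r dotpZl mulN1r. Qed.

Lemma dotpNr x y : dotp x (- y) = - dotp x y.
Proof. by rewrite dotpC dotpNl dotpC. Qed.

Lemma dotpBl x y z : dotp (x - y) z = dotp x z - dotp y z.
Proof. by rewrite dotpDl dotpNl. Qed.

Lemma dotpBr x y z : dotp z (x - y) = dotp z x - dotp z y.
Proof. by rewrite dotpDr dotpNr. Qed.

Lemma dotp_suml (I : Type) (s : seq I) (P : pred I) (F : I -> 'rV[R]_n) y :
  dotp (\sum_(i <- s | P i) F i) y = \sum_(i <- s | P i) dotp (F i) y.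
Proof. by apply: (big_morph (fun x => dotp x y)) => [a b|]; rewrite ?dotpDl ?dotp0l. Qed.

Lemma dotp_sumr (I : Type) (s : seq I) (P : pred I) (F : I -> 'rV[R]_n) y :
  dotp y (\sum_(i <- s | P i) F i) = \sum_(i <- s | P i) dotp y (F i).
Proof. by rewrite dotpC dotp_suml; apply: eq_bigr => i _; rewrite dotpC. Qed.

Lemma dotpp_ge0 x : 0 <= dotp x x.
Proof. by apply: sumr_ge0 => i _; rewrite -expr2 sqr_ge0. Qed.

Lemma dotpp_eq0 x : (dotp x x == 0) = (x == 0).
Proof.
apply/idP/eqP => [|->]; last by rewrite dotp0l.
rewrite psumr_eq0 => [/allP H|i _]; last by rewrite -expr2 sqr_ge0.
apply/rowP => i; have := H i (mem_index_enum _).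
by rewrite /= mulf_eq0 orbb mxE => /eqP.
Qed.

Lemma coord_le_dotp x (i : 'I_n) : x 0 i ^+ 2 <= dotp x x.
Proof.
rewrite /dotp (bigD1 i)//= -expr2 lerDl; apply: sumr_ge0 => j _.
by rewrite -expr2 sqr_ge0.
Qed.

Lemma continuous_dotp (f g : 'rV[R]_n -> 'rV[R]_n) :
  (forall i, continuous (fun x => f x 0 i)) -> (forall i, continuous (fun x => g x 0 i)) ->
  continuous (fun x => dotp (f x) (g x)).
Proof.
move=> cf cg x; rewrite /dotp.
apply: (@cvg_sumf R _ (nbhs x) (@nbhs_filter _ x) _ _ _ (fun i x => f x 0 i * g x 0 i)) => i _.
by apply: cvgM; [exact: cf|exact: cg].
Qed.

Lemma continuous_dotpp : continuous (fun x => dotp x x).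
Proof. by apply: (@continuous_dotp id id) => i; exact: coord_continuous. Qed.

Lemma continuous_dotpr y : continuous (fun x => dotp x y).
Proof. by apply: (@continuous_dotp id (cst y)) => i; [exact: coord_continuous|exact: cst_continuous]. Qed.

(** If z belongs to the star-shaped set Z, then the gauge of Z at rho *: z is at
    most rho. *)
Lemma radial_fun_ge Z z (rho : R) : rmset Z ->
  (forall t, 0 <= t <= 1 -> Z (t *: z)) -> 0 <= rho ->
  ((expR (- rho ^+ 2))%:E <= radial_fun Z (rho *: z))%E.
Proof.
move=> mZ Zz r0; rewrite -radial_tail// /radial_fun.
rewrite (eq_integral (fun r : RT => (radial r * \1_Z (dil r (rho *: z)))%:E)); last first.
  move=> r; rewrite inE/= in_itv/= andbT => rhor; congr EFin.
  have [rp|rn] := ltP 0 r; last by rewrite /radial ltNge rn mul0r.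
  rewrite indicE mem_set ?mulr1// /dil powR_inv1 ?(ltW rp)// scalerA; apply: Zz.
  rewrite mulr_ge0 ?invr_ge0 ?(ltW rp)//=.
  by rewrite mulrC ler_pdivrMr// mul1r.
apply: ge0_subset_integral => //.
- by apply: measurable_radial_line.
- by move=> r _; rewrite lee_fin mulr_ge0 ?radial_ge0// indicE ler0n.
Qed.

Definition ball1 : set 'rV[R]_n := [set v | dotp v v <= 1].

(** The gauge of the unit ball cut by the cone P is the Euclidean norm on P and
    infinite elsewhere. *)
Lemma radial_fun_cone (P : set 'rV[R]_n) y :
  (forall r v, 0 < r -> P (r *: v) <-> P v) ->
  radial_fun (ball1 `&` P) y = (gaussian y * \1_P y)%:E.
Proof.
move=> hP; rewrite /radial_fun.
set a := Num.sqrt (dotp y y).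
have a0 : 0 <= a := sqrtr_ge0 _.
have a2 : a ^+ 2 = dotp y y by rewrite sqr_sqrtr// dotpp_ge0.
transitivity (\int[@lebesgue_measure R]_(r in `[a, +oo[) (radial r)%:E * (\1_P y)%:E)%E.
  rewrite -ge0_integralZr//; last 2 first.
  - by apply/measurable_EFinP; apply: measurable_funTS; exact: measurable_radial.
  - by move=> r _; rewrite lee_fin radial_ge0.
  rewrite [RHS]integral_mkcond; apply: eq_integral => r _; rewrite patchE.
  have [rp|rn] := ltP 0 r; last first.
    by rewrite /radial ltNge rn mul0r mul0e; case: ifP.
  have PE : P (dil r y) <-> P y by rewrite /dil powR_inv1 ?(ltW rp)//; apply: hP; rewrite invr_gt0.
  have BE : ball1 (dil r y) <-> a <= r.
    rewrite /ball1 /= /dil powR_inv1 ?(ltW rp)// dotpZl dotpZr -a2 mulrA -expr2 -exprMn.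
    rewrite expr_le1// ?mulr_ge0 ?invr_ge0 ?(ltW rp)//.
    by rewrite mulrC ler_pdivrMr// mul1r.
  rewrite mem_setE in_itv/= andbT; case: ifPn => ar.
    rewrite -EFinM; congr EFin; congr (_ * _); rewrite !indicE; congr (_%:R).
    congr nat_of_bool; apply/idP/idP; rewrite !inE; first by case=> _ /PE.
    by move=> /PE Py; split => //; exact/BE.
  by rewrite indicE memNset ?mulr0// => -[/BE]; rewrite (negbTE ar).
by rewrite radial_tail// a2 -EFinM.
Qed.

Lemma rmset_ball1 : rmset ball1.
Proof.
apply: rmset_closed; rewrite (_ : ball1 = (fun v => dotp v v) @^-1` [set x | x <= 1])//.
by apply: closed_comp => [x _|]; [exact: continuous_dotpp|exact: closed_le].
Qed.

(** The Gaussian integral in polar form. It shows that both factors are positive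
    and finite; their separate values do not matter. *)
Lemma moment_ball1 : (radial_moment R n * volume ball1 = ((Num.sqrt pi) ^+ n)%:E)%E.
Proof.
rewrite -Lint_radial; last exact: rmset_ball1.
rewrite -Lint_gaussian; apply: Lint_eq => y.
by rewrite -[ball1]setIT radial_fun_cone// indicT mulr1.
Qed.

Let spn : 0 < Num.sqrt (pi : R) ^+ n.
Proof. by rewrite exprn_gt0// sqrtr_gt0 pi_gt0. Qed.

Lemma radial_moment_fin : exists2 k, 0 < k & radial_moment R n = k%:E.
Proof.
have := moment_ball1; have := radial_moment_ge0 R n; have := volume_ge0 ball1.
case: (radial_moment R n) => [k| |]; case: (volume ball1) => [v| |]//=; rewrite ?lee_fin.
- move=> v0 k0 [kv]; exists k => //; rewrite lt_neqAle k0 andbT; apply: contraTneq spn => k00.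
  by rewrite -kv -k00 mul0r ltxx.
- move=> _ k0; have [->|kn] := eqVneq k 0; rewrite ?mul0e; first by case=> e; move: spn; rewrite -e ltxx.
  by rewrite gt0_muley// lte_fin lt_neqAle eq_sym kn.
- move=> v0 _; have [->|kn] := eqVneq v 0; rewrite ?mule0; first by case=> e; move: spn; rewrite -e ltxx.
  by rewrite gt0_mulye// lte_fin lt_neqAle eq_sym kn.
Qed.

Lemma volume_ball1_fin : exists2 b, 0 < b & volume ball1 = b%:E.
Proof.
have := moment_ball1; have [k k0 ->] := radial_moment_fin; have := volume_ge0 ball1.
case: (volume ball1) => [v| |]//=; rewrite ?lee_fin.
- move=> v0 [kv]; exists v => //; rewrite lt_neqAle v0 andbT; apply: contraTneq spn => k00.
  by rewrite -kv -k00 mulr0 ltxx.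
- by move=> _; rewrite gt0_muley// lte_fin.
Qed.

Definition orthant : set 'rV[R]_n := [set v | forall i, 0 <= v 0 i].

Lemma rmset_orthant : rmset orthant.
Proof.
rewrite (_ : orthant = \bigcap_(i in [set: 'I_n]) [set v : 'rV_n | 0 <= v 0 i]); last first.
  by apply/seteqP; split => [v h i _|v h i]; apply: h.
rewrite /rmset preimage_bigcap; apply: fin_bigcap_measurable; first exact: finite_finset.
move=> i _; apply: (@rmset_preimage _ _ _ _ (fun v => v 0 i : RT) [set x | 0 <= x]).
  exact: rmfun_coord.
by rewrite -set_itvcy; exact: measurable_itv.
Qed.

(** The Gaussian weight is a product, and a half-line has half of the mass of
    the line. *)
Lemma volume_ball1_orthant :
  volume ball1 = ((2 ^+ n)%:E * volume (ball1 `&` orthant))%E.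
Proof.
have [k k0 kE] := radial_moment_fin.
have mB : rmset (ball1 `&` orthant) by apply: measurableI; [exact: rmset_ball1|exact: rmset_orthant].
suff E : (k%:E * volume (ball1 `&` orthant) = ((Num.sqrt pi / 2) ^+ n)%:E)%E.
  have := moment_ball1; rewrite kE.
  have -> : ((Num.sqrt pi ^+ n)%:E = (2 ^+ n)%:E * (k%:E * volume (ball1 `&` orthant)))%E.
    by rewrite E -EFinM -exprMn; congr (_ ^+ _)%:E; field.
  rewrite muleCA => /(congr1 (mule (k^-1)%:E)); rewrite !muleA -EFinM mulVf ?gt_eqF//.
  by rewrite !mul1e.
rewrite -kE -Lint_radial//.
pose h (x : R) := gauss_fun x * \1_(`[0, +oo[%classic : set R) x.
have mh : measurable_fun setT h.
  by apply: measurable_funM; [exact: measurable_gauss_fun|exact: measurable_indic].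
have h0 (r : R) : 0 <= h r by rewrite mulr_ge0 ?gauss_fun_ge0// indicE ler0n.
have hI : (\int[@lebesgue_measure R]_x (h x)%:E = (Num.sqrt pi / 2)%:E)%E.
  rewrite -integral0y_gauss [RHS]integral_mkcond; apply: eq_integral => x _.
  by rewrite patchE /h indicE; case: ifP => _; rewrite ?mulr1 ?mulr0.
rewrite -(Lint_tensor n mh h0 hI); apply: Lint_eq => y.
rewrite radial_fun_cone; last first.
  move=> r v r0; split => H i; have := H i; rewrite mxE ?pmulr_rge0//.
congr EFin; rewrite gaussianE /h big_split /=; congr (_ * _).
rewrite indicE; have [yo|yo] := boolP (y \in orthant).
  rewrite big1// => i _; rewrite indicE mem_set//=; move: yo; rewrite inE => /(_ i).
  by rewrite in_itv/= andbT.
have : ~ orthant y by move=> h'; move: yo; rewrite mem_set.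
move=> /existsNP[i yi]; rewrite (bigD1 i)//= indicE memNset ?mul0r//=.
by rewrite in_itv/= andbT.
Qed.

End Ball.

(** * Symmetric matrices *)

Section Spectral.
Variable R : realType.

Lemma dotpE n (x y : 'rV[R]_n) : dotp x y = (x *m y^T) 0 0.
Proof. by rewrite mxE; apply: eq_bigr => i _; rewrite mxE. Qed.

Lemma dotp_mulmx n p (x : 'rV[R]_n) (y : 'rV[R]_p) (M : 'M[R]_(n, p)) :
  dotp (x *m M) y = dotp x (y *m M^T).
Proof. by rewrite !dotpE trmx_mul trmxK mulmxA. Qed.

Lemma dotp_scalar n (x y : 'rV[R]_n) : x *m y^T = (dotp x y)%:M.
Proof. by apply/matrixP => i j; rewrite !ord1 dotpE [RHS]mxE eqxx mulr1n. Qed.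

Lemma dotp_delta n (x : 'rV[R]_n) i : dotp x (delta_mx 0 i) = x 0 i.
Proof.
rewrite /dotp (bigD1 i)//= mxE !eqxx mulr1 big1 ?addr0// => j ji.
by rewrite mxE (negbTE ji) andbF mulr0.
Qed.

Lemma dotp_row n p (A : 'M[R]_(n, p)) (B : 'M[R]_(n, p)) i j :
  dotp (row i A) (row j B) = (A *m B^T) i j.
Proof. by rewrite mxE; apply: eq_bigr => k _; rewrite !mxE. Qed.

Lemma orthogonal_dotp n (O : 'M[R]_n) (x y : 'rV[R]_n) : O *m O^T = 1%:M ->
  dotp (x *m O) (y *m O) = dotp x y.
Proof. by move=> OO; rewrite dotp_mulmx -mulmxA OO mulmx1. Qed.

Lemma orthogonal_det n (O : 'M[R]_n) : O *m O^T = 1%:M -> `|\det O| = 1.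
Proof.
move=> /(congr1 determinant); rewrite det_mulmx det_tr det1 -expr2 => d2.
by apply/eqP; rewrite -sqr_norm_eq1 d2.
Qed.

(** The reflection along y - x. *)
Lemma householder n (x y : 'rV[R]_n) : dotp x x = dotp y y ->
  exists2 O : 'M[R]_n, O *m O^T = 1%:M & x *m O = y.
Proof.
move=> xy; have [->|ney] := eqVneq x y.
  by exists 1%:M; rewrite ?trmx1 mulmx1.
have [v vE] : exists v, v = y - x by exists (y - x).
have v0 : dotp v v != 0 by rewrite dotpp_eq0 vE subr_eq0 eq_sym.
have vx : 2 * dotp x v = - dotp v v.
  by rewrite vE !(dotpBl, dotpBr) -xy (dotpC y x); ring.
pose c := 2 / dotp v v.
have cv : c * dotp v v = 2 by rewrite /c divfK.
exists (1%:M - c *: (v^T *m v)).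
  have -> : (1%:M - c *: (v^T *m v))^T = 1%:M - c *: (v^T *m v).
    by apply/matrixP => i j; rewrite !mxE !big_ord1 !mxE eq_sym; congr (_ - _ * _); exact: mulrC.
  rewrite mulmxBl mul1mx mulmxBr mulmx1.
  rewrite -scalemxAl -scalemxAr mulmxA -(mulmxA v^T) dotp_scalar mul_mx_scalar -scalemxAl.
  rewrite !scalerA cv [c * 2]mulr_natr mulr2n scalerDl.
  by rewrite opprB addrC !addrA addrK addrAC subrr add0r.
rewrite mulmxBr mulmx1 -scalemxAr mulmxA dotp_scalar mul_scalar_mx scalerA.
have -> : c * dotp x v = -1.
  apply: (mulIf v0); rewrite mulrAC cv; apply: (mulfI (_ : 2 != 0 :> R)) => //.
  by rewrite vx mulN1r -vx; ring.
by rewrite scaleN1r opprK vE addrC subrK.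
Qed.

Lemma compact_sphere n : compact [set x : 'rV[R]_n | dotp x x = 1].
Proof.
apply: bounded_closed_compact.
  exists 1; split; first exact: num_real.
  move=> M M1 x /= x1; apply: (le_trans _ (ltW M1)).
  rewrite [`|x|]mx_normrE; apply: bigmax_le => // -[i j] _ /=.
  rewrite (ord1 i) -(@ler_pXn2r _ 2) ?nnegrE// expr1n real_normK ?num_real//.
  by rewrite -x1 coord_le_dotp.
rewrite (_ : [set _ | _] = (fun v => dotp v v) @^-1` [set x | x = 1])//.
by apply: closed_comp => [x _|]; [exact: continuous_dotpp|exact: closed_eq].
Qed.

Lemma continuous_mulmx_coord n p (M : 'M[R]_(n, p)) i :
  continuous (fun x : 'rV[R]_n => (x *m M) 0 i).
Proof.
rewrite (_ : (fun x : 'rV[R]_n => (x *m M) 0 i) = (fun x => dotp x (col i M)^T)); last first.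
  by apply/funext => x; rewrite mxE; apply: eq_bigr => j _; rewrite !mxE.
exact: continuous_dotpr.
Qed.

(** A maximum e of the quadratic form f on the unit sphere is an eigenvector for
    the value l = f e: the form l |y|^2 - f y is nonnegative and vanishes at e,
    so that its derivative at e, given by z below, is zero. *)
Lemma eigenvector n (A : 'M[R]_n.+1) : A^T = A ->
  exists (e : 'rV[R]_n.+1) (l : R), dotp e e = 1 /\ e *m A = l *: e.
Proof.
move=> At; pose f (x : 'rV[R]_n.+1) := dotp (x *m A) x.
have cf : continuous f.
  apply: continuous_dotp => i; first exact: continuous_mulmx_coord.
  exact: coord_continuous.
have [e e1 emax] : exists2 e, e \in [set x : 'rV[R]_n.+1 | dotp x x = 1] &
    forall t, t \in [set x : 'rV[R]_n.+1 | dotp x x = 1] -> f t <= f e.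
  apply: EVT_max_rV; [|exact: compact_sphere|exact: continuous_subspaceT].
  by exists (delta_mx 0 0); rewrite /= dotp_delta mxE !eqxx.
move: e1; rewrite inE /= => e1.
exists e, (f e); split=> //; set l := f e.
have fle y : f y <= l * dotp y y.
  have [->|y0] := eqVneq y 0; first by rewrite /f dotp0r dotp0r mulr0.
  have yy : 0 < dotp y y by rewrite lt_neqAle eq_sym dotpp_eq0 y0 dotpp_ge0.
  set a := Num.sqrt (dotp y y).
  have a0 : 0 < a by rewrite sqrtr_gt0.
  have a2 : a ^+ 2 = dotp y y by rewrite sqr_sqrtr// ltW.
  have : f (a^-1 *: y) <= l.
    apply: emax; rewrite inE /= dotpZl dotpZr mulrA -expr2 -a2 exprVn mulVf//.
    by rewrite expf_eq0 /= gt_eqF.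
  rewrite /f -scalemxAl dotpZl dotpZr mulrA -expr2 exprVn a2.
  by rewrite mulrC ler_pdivrMr.
pose b y := l * dotp y y - f y.
have b0 y : 0 <= b y by rewrite subr_ge0.
pose z := l *: e - e *m A.
have bE y t : b (e + t *: y) = 2 * t * dotp z y + t ^+ 2 * b y.
  rewrite /b /f /z mulmxDl -scalemxAl !(dotpDl, dotpDr, dotpBl, dotpZl, dotpZr).
  rewrite (dotp_mulmx y e) At (dotpC y (e *m A)) (dotpC y e) -/(f e) -/l e1 dotpNl; ring.
have /eqP : dotp z z = 0.
  apply/eqP/negPn/negP => zz.
  have zp : 0 < dotp z z by rewrite lt_neqAle eq_sym zz dotpp_ge0.
  have bz := b0 z.
  (* Along this step the linear term of b dominates the quadratic one. *)
  have := b0 (e + (- dotp z z / (b z + 1)) *: z); rewrite bE.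
  have bp : 0 < b z + 1 by rewrite ltr_wpDl.
  rewrite (_ : _ + _ = - (dotp z z ^+ 2 * (b z + 2) / (b z + 1) ^+ 2)); last first.
    by field; rewrite gt_eqF.
  rewrite oppr_ge0 leNgt divr_gt0 ?exprn_gt0// mulr_gt0 ?exprn_gt0//.
  by rewrite ltr_wpDl.
by rewrite dotpp_eq0 subr_eq0 => /eqP <-.
Qed.

(** By induction: in an orthonormal basis that begins with an eigenvector the
    matrix is block diagonal. *)
Lemma spectral n (A : 'M[R]_n) : A^T = A ->
  exists (O : 'M[R]_n) (d : 'rV[R]_n), O *m O^T = 1%:M /\ O *m A *m O^T = diag_mx d.
Proof.
elim: n A => [|n IH] A At.
  by exists 1%:M, 0; split; apply/matrixP => -[].
have [e [l [e1 eA]]] := eigenvector At.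
have [|O OO eO] := @householder _ (delta_mx 0 0) e.
  by rewrite dotp_delta mxE !eqxx e1.
have OtO : O^T *m O = 1%:M by apply: mulmx1C.
pose B : 'M[R]_(1 + n) := O *m A *m O^T.
have Bt : B^T = B by rewrite /B !trmx_mul trmxK At mulmxA.
have B0 : (delta_mx 0 0 : 'rV_(1+n)) *m B = l *: delta_mx 0 0.
  by rewrite /B !mulmxA eO eA -scalemxAl -eO -mulmxA OO mulmx1.
have Bul : ulsubmx B = l%:M.
  apply/matrixP => i j; rewrite !ord1 !mxE eqxx mulr1n.
  have := congr1 (fun M : 'rV_(1+n) => M 0 0) B0; rewrite -rowE !mxE !eqxx mulr1.
  by rewrite (_ : lshift n 0 = 0) => [->//|]; apply/val_inj.
have Bur : ursubmx B = 0.
  apply/matrixP => i j; rewrite !ord1 !mxE.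
  have := congr1 (fun M : 'rV_(1+n) => M 0 (rshift 1 j)) B0.
  rewrite -rowE !mxE (_ : rshift 1 j == 0 = false)// ?andbF mulr0.
  by rewrite (_ : lshift n 0 = 0) => [->//|]; apply/val_inj.
have Bdl : dlsubmx B = 0 by rewrite -[B]Bt -trmx_ursub Bur trmx0.
have [|O' [d [OO' Od']]] := IH (drsubmx B).
  by rewrite trmx_drsub Bt.
pose P : 'M[R]_(1 + n) := block_mx 1%:M 0 0 O'.
have PP : P *m P^T = 1%:M.
  rewrite /P tr_block_mx trmx1 !trmx0 mulmx_block !(mul1mx, mulmx0, mul0mx, addr0, add0r).
  by rewrite OO' -scalar_mx_block.
have PB : P *m B *m P^T = diag_mx (row_mx l%:M d).
  rewrite -[B]submxK Bul Bur Bdl diag_mx_row.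
  rewrite /P tr_block_mx trmx1 !trmx0 !mulmx_block !(mul1mx, mulmx1, mulmx0, mul0mx, addr0, add0r).
  rewrite Od'; congr block_mx.
  by apply/matrixP => i j; rewrite !ord1 !mxE eqxx.
exists (P *m O), (row_mx l%:M d); split.
  by rewrite trmx_mul mulmxA -(mulmxA P) OO mulmx1.
by rewrite -PB /B trmx_mul !mulmxA.
Qed.

Lemma gram_factor n (A : 'M[R]_n) : A^T = A ->
  (forall x, 0 <= dotp (x *m A) x) -> exists C : 'M[R]_n, C *m C^T = A.
Proof.
move=> At A0; have [Q [d [OO OA]]] := spectral At.
have OtO : Q^T *m Q = 1%:M by apply: mulmx1C.
have AE : A = Q^T *m diag_mx d *m Q.
  by rewrite -OA !mulmxA OtO mul1mx -mulmxA OtO mulmx1.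
have d0 i : 0 <= d 0 i.
  have := A0 (row i Q); rewrite -row_mul dotp_row OA mxE eqxx mulr1n.
  by [].
exists (Q^T *m diag_mx (\row_i Num.sqrt (d 0 i))).
rewrite trmx_mul trmxK tr_diag_mx !mulmxA -(mulmxA Q^T) mulmx_diag AE.
congr (_ *m diag_mx _ *m _); apply/rowP => i; rewrite !mxE -expr2 sqr_sqrtr//.
Qed.
End Spectral.

(** * Determinants of weighted isotropic frames *)

Section Jensen.
Variable R : realType.

(** The square of 1 + y / 2 <= expR (y / 2), whose left side is nonnegative on
    this range. *)
Lemma expR_quad (y : R) : -2 <= y -> 1 + y + y ^+ 2 / 4 <= expR y.
Proof.
move=> y2; rewrite [in leRHS](splitr y) expRD -expr2.
have h : 1 + y / 2 <= expR (y / 2) by exact: expR_ge1Dx.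
have h0 : 0 <= 1 + y / 2 by lra.
rewrite (_ : _ + _ = (1 + y / 2) ^+ 2); last by field.
by rewrite ler_pXn2r ?nnegrE ?expR_ge0.
Qed.

Variables (N : nat) (p t : 'I_N -> R).
Hypotheses (p0 : forall i, 0 <= p i) (p1 : \sum_i p i = 1).
Let b := \sum_i p i * t i.

Lemma weighted_var :
  \sum_i \sum_l p i * p l * (t i - t l) ^+ 2 = 2 * \sum_i p i * (t i - b) ^+ 2.
Proof.
transitivity (2 * (\sum_i p i * t i ^+ 2 - b ^+ 2)).
  under eq_bigr => i _.
    under eq_bigr => l _.
      rewrite (_ : _ * _ = p i * t i ^+ 2 * p l + p i * (p l * t l ^+ 2) - 2 * (p i * t i) * (p l * t l)); last by ring.
      over.
    rewrite sumrB big_split /= -!mulr_sumr p1 mulr1.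
    over.
  rewrite sumrB big_split /= -!mulr_suml p1 mul1r -/b -mulr_sumr -/b; ring.
congr (2 * _).
rewrite [RHS](eq_bigr (fun i => p i * t i ^+ 2 - 2 * b * (p i * t i) + p i * b ^+ 2)); last by move=> i _; ring.
by rewrite big_split sumrB /= -mulr_sumr -/b -mulr_suml p1; ring.
Qed.

Lemma jensen_expR : expR b <= \sum_i p i * expR (t i).
Proof.
rewrite -[leLHS]mulr1 -[X in _ * X]addr0.
have -> : \sum_i p i * expR (t i) = expR b * \sum_i p i * expR (t i - b).
  by rewrite mulr_sumr; apply: eq_bigr => i _; rewrite mulrCA -expRD subrKC.
rewrite ler_pM2l ?expR_gt0//.
have -> : 1 + 0 = \sum_i p i * (1 + (t i - b)).
  under [RHS]eq_bigr do rewrite mulrDr mulr1 mulrBr.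
  by rewrite big_split sumrB /= -mulr_suml p1 mul1r subrr.
by apply: ler_sum => i _; rewrite ler_wpM2l// expR_ge1Dx.
Qed.

(** The deviations from the mean b are at least -2, where the exponential lies
    above the parabola of [expR_quad]. *)
Lemma jensen_expR_var : (forall i l, `|t i - t l| <= 2) ->
  expR b * (1 + (\sum_i p i * (t i - b) ^+ 2) / 4) <= \sum_i p i * expR (t i).
Proof.
move=> t2.
have tb i : -2 <= t i - b.
  have -> : t i - b = \sum_l p l * (t i - t l).
    under eq_bigr do rewrite mulrBr.
    by rewrite sumrB -mulr_suml p1 mul1r.
  have -> : -2 = \sum_l p l * (-2) by rewrite -mulr_suml p1 mul1r.
  apply: ler_sum => l _; rewrite ler_wpM2l//.
  by have := t2 i l; rewrite ler_norml => /andP[].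
have -> : \sum_i p i * expR (t i) = expR b * \sum_i p i * expR (t i - b).
  by rewrite mulr_sumr; apply: eq_bigr => i _; rewrite mulrCA -expRD subrKC.
rewrite ler_pM2l ?expR_gt0//.
have -> : 1 + (\sum_i p i * (t i - b) ^+ 2) / 4 =
    \sum_i p i * (1 + (t i - b) + (t i - b) ^+ 2 / 4).
  rewrite [RHS](eq_bigr (fun i => p i + (p i * t i - p i * b) + p i * (t i - b) ^+ 2 / 4)).
    by rewrite big_split big_split sumrB /= -!mulr_suml p1 mul1r -/b subrr addr0.
  by move=> i _; ring.
by apply: ler_sum => i _; rewrite ler_wpM2l// expR_quad.
Qed.
End Jensen.

Section Isotropic.
Variables (R : realType) (n N : nat) (v : 'I_N -> 'rV[R]_n).

(** The decomposition of the identity of John's theorem. *)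
Definition isotropic := \sum_i (v i)^T *m v i = 1%:M.
Hypothesis iso : isotropic.

Lemma isotropic_dotp x y : \sum_i dotp x (v i) * dotp y (v i) = dotp x y.
Proof.
have := congr1 (fun M => (x *m M *m y^T) 0 0) iso; rewrite mulmx1 -[RHS]dotpE => <-.
rewrite mulmx_sumr mulmx_suml summxE; apply: eq_bigr => i _.
by rewrite mulmxA (dotp_scalar x (v i)) mul_scalar_mx -scalemxAl mxE -dotpE (dotpC y).
Qed.

Lemma isotropic_trace : \sum_i dotp (v i) (v i) = n%:R.
Proof.
have := congr1 mxtrace iso; rewrite mxtrace1 raddf_sum /= => <-.
by apply: eq_bigr => i _; rewrite mxtrace_mulC dotp_scalar mxtrace_scalar mulr1n.
Qed.

Lemma frame_operator_sym (s : 'I_N -> R) :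
  (\sum_i s i *: ((v i)^T *m v i))^T = \sum_i s i *: ((v i)^T *m v i).
Proof.
rewrite raddf_sum /=; apply: eq_bigr => i _.
by apply/matrixP => k l; rewrite !mxE !big_ord1 !mxE; congr (_ * _); exact: mulrC.
Qed.

(** The k-th eigenvalue of the weighted frame operator is an average of s for
    the weights p k i ^+ 2, the squared coordinates of the v i on the k-th
    vector of an eigenbasis. *)
Lemma frame_operator_diag (s : 'I_N -> R) :
  exists p : 'I_n -> 'I_N -> R,
  [/\ forall k, \sum_i p k i ^+ 2 = 1,
      forall i l, \sum_k p k i * p k l = dotp (v i) (v l) &
      \det (\sum_i s i *: ((v i)^T *m v i)) = \prod_k \sum_i s i * p k i ^+ 2].
Proof.
have [Q [d [QQ Qd]]] := spectral (frame_operator_sym s).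
have QtQ : Q^T *m Q = 1%:M by apply: mulmx1C.
pose p k i := dotp (row k Q) (v i).
exists p; split.
- move=> k; under eq_bigr do rewrite expr2.
  by rewrite isotropic_dotp dotp_row QQ mxE eqxx.
- move=> i l.
  rewrite -(@orthogonal_dotp _ _ Q^T) ?trmxK// [RHS]/dotp; apply: eq_bigr => k _.
  rewrite /p !(dotpC (row k Q)); congr (_ * _).
    by rewrite !mxE; apply: eq_bigr => j _; rewrite !mxE.
  by rewrite !mxE; apply: eq_bigr => j _; rewrite !mxE.
- have -> : \det (\sum_i s i *: ((v i)^T *m v i)) = \det (diag_mx d).
    rewrite -Qd !det_mulmx det_tr mulrAC -expr2 (_ : (\det Q) ^+ 2 = 1) ?mul1r//.
    by rewrite expr2 -{2}det_tr -det_mulmx QQ det1.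
  rewrite det_diag; apply: eq_bigr => k _.
  have := congr1 (fun M : 'M[R]_n => M k k) Qd; rewrite [RHS]mxE eqxx mulr1n => <-.
  rewrite -dotp_row row_mul mulmx_sumr dotp_suml; apply: eq_bigr => i _.
  rewrite -scalemxAr dotpZl mulmxA dotp_scalar mul_scalar_mx dotpZl /p.
  by rewrite (dotpC (v i)) expr2.
Qed.

(** Ball's determinant inequality for the weights expR (t i): Jensen's
    inequality in each eigenvalue. *)
Lemma frame_det_ge (t : 'I_N -> R) :
  expR (\sum_i dotp (v i) (v i) * t i) <=
  \det (\sum_i expR (t i) *: ((v i)^T *m v i)).
Proof.
have [p [p1 pv ->]] := frame_operator_diag (fun i => expR (t i)).
have -> : \sum_i dotp (v i) (v i) * t i = \sum_k \sum_i p k i ^+ 2 * t i.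
  rewrite exchange_big; apply: eq_bigr => i _; rewrite -pv mulr_suml.
  by apply: eq_bigr => k _; rewrite expr2.
rewrite expR_sum; apply: ler_prod => k _; rewrite expR_ge0 /=.
under [leRHS]eq_bigr do rewrite mulrC.
by apply: jensen_expR => // i; rewrite sqr_ge0.
Qed.

Lemma prod1D_ge (I : Type) (r : seq I) (F : I -> R) : (forall i, 0 <= F i) ->
  1 + \sum_(i <- r) F i <= \prod_(i <- r) (1 + F i).
Proof.
move=> F0; elim: r => [|i r IH]; first by rewrite !big_nil addr0.
rewrite !big_cons; apply: (@le_trans _ _ ((1 + F i) * (1 + \sum_(j <- r) F j))).
  have S0 : 0 <= \sum_(j <- r) F j by apply: sumr_ge0.
  have := F0 i; rewrite mulrDl mul1r mulrDr mulr1 => Fi.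
  have := mulr_ge0 Fi S0; lra.
by rewrite ler_wpM2l// addr_ge0.
Qed.

Lemma sum_sqr_le (F : 'I_n -> R) : (\sum_k F k) ^+ 2 <= n%:R * \sum_k F k ^+ 2.
Proof.
rewrite expr2 mulr_suml.
have -> : \sum_i F i * \sum_k F k = \sum_i \sum_k F i * F k.
  by apply: eq_bigr => i _; rewrite mulr_sumr.
apply: (@le_trans _ _ (\sum_i \sum_k (F i ^+ 2 + F k ^+ 2) / 2)).
  apply: ler_sum => i _; apply: ler_sum => k _.
  have := sqr_ge0 (F i - F k); rewrite sqrrB; lra.
under eq_bigr do rewrite -mulr_suml big_split /= sumr_const card_ord.
rewrite -mulr_suml big_split /= sumr_const card_ord sumrMnl.
by rewrite -(mulr_natl (\sum_i _)) -mulrDr -mulrA mulrDl -splitr.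
Qed.

(** Each eigenvalue contributes the variance of t for its own weights. The sum
    of these variances is bounded below independently of the eigenbasis by the
    Cauchy-Schwarz inequality over the n eigenvalues. *)
Lemma frame_det_ge_var (t : 'I_N -> R) : (forall i l, `|t i - t l| <= 2) ->
  expR (\sum_i dotp (v i) (v i) * t i) *
   (1 + (\sum_i \sum_l dotp (v i) (v l) ^+ 2 * (t i - t l) ^+ 2) / (8 * n%:R)) <=
  \det (\sum_i expR (t i) *: ((v i)^T *m v i)).
Proof.
move=> t2; have [p [p1 pv ->]] := frame_operator_diag (fun i => expR (t i)).
have -> : \sum_i dotp (v i) (v i) * t i = \sum_k \sum_i p k i ^+ 2 * t i.
  rewrite exchange_big; apply: eq_bigr => i _; rewrite -pv mulr_suml.
  by apply: eq_bigr => k _; rewrite expr2.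
pose V k := \sum_i p k i ^+ 2 * (t i - \sum_i p k i ^+ 2 * t i) ^+ 2.
have V0 k : 0 <= V k by apply: sumr_ge0 => i _; rewrite mulr_ge0 ?sqr_ge0.
apply: (@le_trans _ _ (\prod_k (expR (\sum_i p k i ^+ 2 * t i) * (1 + V k / 4)))); last first.
  apply: ler_prod => k _; rewrite mulr_ge0 ?expR_ge0 ?addr_ge0 ?divr_ge0//=.
  under [leRHS]eq_bigr do rewrite mulrC.
  by apply: jensen_expR_var => // i; rewrite sqr_ge0.
rewrite big_split /= -expR_sum ler_pM2l ?expR_gt0//.
apply: le_trans (prod1D_ge _ _); last by move=> k; rewrite divr_ge0.
rewrite lerD2l.
have [n0|n0] := posnP n.
  rewrite [n%:R](_ : _ = 0) ?[in LHS]n0// mulr0 invr0 mulr0; apply: sumr_ge0 => k _; rewrite divr_ge0//.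
rewrite ler_pdivrMr ?mulr_gt0 ?ltr0n//.
have -> : (\sum_k V k / 4) * (8 * n%:R) = n%:R * \sum_k \sum_i \sum_l p k i ^+ 2 * p k l ^+ 2 * (t i - t l) ^+ 2.
  rewrite mulr_sumr mulr_suml; apply: eq_bigr => k _.
  by rewrite (weighted_var t (p1 k)) -/(V k); field.
rewrite [in leRHS]exchange_big mulr_sumr /=.
rewrite [leRHS](eq_bigr (fun i => \sum_l n%:R * \sum_k p k i ^+ 2 * p k l ^+ 2 * (t i - t l) ^+ 2)); last first.
  by move=> i _; rewrite exchange_big mulr_sumr.
apply: ler_sum => i _; apply: ler_sum => l _.
rewrite -mulr_suml mulrA ler_wpM2r ?sqr_ge0// -pv.
apply: le_trans (sum_sqr_le _) _.
by rewrite ler_wpM2l// ler_sum// => k _; rewrite exprMn.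
Qed.
End Isotropic.

(** * Almost orthonormal subframes *)

Lemma eq_ler (R : realType) (x y : R) : x = y -> x <= y.
Proof. by move=> ->. Qed.

Section Directions.
Variables (R : realType) (n : nat).
Implicit Types x y u : 'rV[R]_n.

Lemma dotp_cauchy x y : dotp x y ^+ 2 <= dotp x x * dotp y y.
Proof.
have [->|y0] := eqVneq y 0; first by rewrite !dotp0r expr0n mulr0.
have yy : 0 < dotp y y by rewrite lt_neqAle eq_sym dotpp_eq0 y0 dotpp_ge0.
have := dotpp_ge0 (dotp y y *: x - dotp x y *: y).
rewrite !(dotpBl, dotpBr, dotpZl, dotpZr) (dotpC y x).
rewrite (_ : _ - _ = dotp y y * (dotp x x * dotp y y - dotp x y ^+ 2)); last by ring.
by rewrite pmulr_rge0// subr_ge0.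
Qed.

Lemma enorm_ge0 x : 0 <= enorm x. Proof. exact: sqrtr_ge0. Qed.

Lemma enorm_sqr x : enorm x ^+ 2 = dotp x x.
Proof. by rewrite sqr_sqrtr// dotpp_ge0. Qed.

Lemma enorm_eq0 x : (enorm x == 0) = (x == 0).
Proof. by rewrite -dotpp_eq0 -enorm_sqr expf_eq0. Qed.

Lemma dotp_le_enorm x y : `|dotp x y| <= enorm x * enorm y.
Proof.
rewrite -(@ler_pXn2r _ 2) ?nnegrE ?mulr_ge0 ?enorm_ge0//.
by rewrite real_normK ?num_real// exprMn !enorm_sqr dotp_cauchy.
Qed.

(** At u = 0 this is the vector 0, of norm less than 1. *)
Definition direction u := (enorm u)^-1 *: u.

Lemma directionK u : enorm u *: direction u = u.
Proof.
rewrite /direction scalerA; have [->|u0] := eqVneq u 0; first by rewrite scaler0.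
by rewrite divff ?scale1r// enorm_eq0.
Qed.

Lemma direction_unit u : u != 0 -> dotp (direction u) (direction u) = 1.
Proof.
move=> u0; rewrite dotpZl dotpZr mulrA -expr2 -enorm_sqr exprVn mulVf//.
by rewrite expf_eq0 enorm_eq0.
Qed.

Lemma direction_le1 u : dotp (direction u) (direction u) <= 1.
Proof.
have [->|/direction_unit ->//] := eqVneq u 0.
by rewrite /direction scaler0 dotp0l.
Qed.

Lemma dotp_directionr x u : dotp x u = enorm u * dotp x (direction u).
Proof. by rewrite -dotpZr directionK. Qed.

Definition pos (a : R) := Num.max a 0.

Lemma pos_ge0 a : 0 <= pos a. Proof. by rewrite le_max lexx orbT. Qed.

Lemma posM a b : 0 <= a -> pos (a * b) = a * pos b.
Proof. by move=> a0; rewrite /pos maxr_pMr// mulr0. Qed.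

Lemma pos_le a : pos a <= `|a|.
Proof. by rewrite ge_max normr_ge0 ler_norm. Qed.

Lemma pos_sqrB a b : `|pos a ^+ 2 - pos b ^+ 2| <= `|a - b| * (`|a| + `|b|).
Proof.
rewrite subr_sqr normrM ler_pM// ?normr_ge0//.
  rewrite /pos !maxEle; case: ifPn => h1; case: ifPn => h2; rewrite ler_norml;
  have := ler_norm (a - b); have := ler_norm (- (a - b)); rewrite normrN; lra.
by rewrite ger0_norm ?addr_ge0 ?pos_ge0// lerD ?pos_le.
Qed.
End Directions.

Section Frames.
Variables (R : realType) (n N : nat) (v : 'I_N -> 'rV[R]_n).
Hypothesis iso : isotropic v.
Implicit Types x e : 'rV[R]_n.

Local Notation u l := (direction (v l)).
Local Notation c l := (dotp (v l) (v l)).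
Local Notation sq x := (dotp x x).

Lemma dotp_dir_sqr x l : dotp x (v l) ^+ 2 = c l * dotp x (u l) ^+ 2.
Proof. by rewrite {1}dotp_directionr exprMn enorm_sqr. Qed.

(** For a unit vector e this vanishes if and only if every v l is orthogonal to
    e or positively proportional to e. *)
Definition misfit e := \sum_l dotp e (v l) ^+ 2 * sq (e - u l).

(** This vanishes if and only if the directions of any two nonzero v i, v l are
    equal or orthogonal. *)
Definition total_misfit := \sum_i \sum_l dotp (v i) (v l) ^+ 2 * sq (u i - u l).

Lemma total_misfitE : total_misfit = \sum_i c i * misfit (u i).
Proof.
apply: eq_bigr => i _; rewrite mulr_sumr; apply: eq_bigr => l _.
by rewrite mulrA; congr (_ * _); rewrite dotpC dotp_dir_sqr dotpC mulrC mulrC.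
Qed.

Lemma misfit_ge0 e : 0 <= misfit e.
Proof. by apply: sumr_ge0 => l _; rewrite mulr_ge0 ?sqr_ge0 ?dotpp_ge0. Qed.

Lemma total_misfit_ge0 : 0 <= total_misfit.
Proof. by rewrite total_misfitE sumr_ge0// => i _; rewrite mulr_ge0 ?dotpp_ge0 ?misfit_ge0. Qed.

Lemma iso_sqr e : sq e = 1 -> \sum_l c l * dotp e (u l) ^+ 2 = 1.
Proof.
move=> e1; rewrite -e1 -(isotropic_dotp iso); apply: eq_bigr => l _.
by rewrite -expr2 dotp_dir_sqr.
Qed.

Lemma dotp_unit_le1 e l : sq e = 1 -> dotp e (u l) ^+ 2 <= 1.
Proof.
move=> e1; apply: le_trans (dotp_cauchy _ _) _; rewrite e1 mul1r; exact: direction_le1.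
Qed.

Lemma prod_le1 (I : Type) (s : seq I) (Q : pred I) (F : I -> R) :
  (forall i, Q i -> 0 <= F i <= 1) -> \prod_(i <- s | Q i) F i <= 1.
Proof.
move=> F01; suff : 0 <= \prod_(i <- s | Q i) F i <= 1 by case/andP.
elim/big_ind: _ => // [|x y /andP[x0 x1] /andP[y0 y1]]; first by rewrite ler01 lexx.
by rewrite mulr_ge0// mulr_ile1.
Qed.

Lemma prod1B_ge k (F : nat -> R) : (forall i, (i < k)%N -> 0 <= F i <= 1) ->
  1 - \sum_(i < k) F i <= \prod_(i < k) (1 - F i).
Proof.
elim: k => [|k IH] F01; first by rewrite !big_ord0 subr0.
rewrite !big_ord_recr /=.
have /andP[Fk0 Fk1] := F01 k (ltnSn k).
have IH' := IH (fun i ik => F01 i (ltnW ik)).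
have P1 : \prod_(i < k) (1 - F i) <= 1.
  apply: prod_le1 => i _; have /andP[? ?] := F01 i (ltnW (ltn_ord i)).
  by rewrite subr_ge0; apply/andP; split=> //; rewrite gerBl.
nra.
Qed.

(** Average f over l with the weights W l, which vanish for the directions of
    the e a. Their total is at least 1: the frame has trace n, and each e a
    removes at most 1 from it. The misfit part of the average is at most the
    total misfit; the scalar products are at most the misfits of the e a,
    because 1 - (e a . d)^2 <= |e a - d|^2 for unit vectors. So the smallest f l
    satisfies the bound. *)
Lemma greedy_step k (e : nat -> 'rV[R]_n) : (k < n)%N ->
  (forall a, (a < k)%N -> sq (e a) = 1) ->
  exists2 l, v l != 0 & misfit (u l) + \sum_(a < k) dotp (e a) (u l) ^+ 2 <=
    total_misfit + \sum_(a < k) misfit (e a).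
Proof.
move=> kn e1.
pose r a l := dotp (e a) (u l) ^+ 2.
have r01 a l : (a < k)%N -> 0 <= r a l <= 1.
  by move=> ak; rewrite sqr_ge0 dotp_unit_le1 ?e1.
have q01 (a : 'I_k) l : 0 <= 1 - r a l <= 1.
  have /andP[? ?] := r01 a l (ltn_ord a).
  by rewrite subr_ge0; apply/andP; split=> //; rewrite gerBl.
pose P l := \prod_(a < k) (1 - r a l).
have P0 l : 0 <= P l by apply: prodr_ge0 => a _; have /andP[] := q01 a l.
have P1 l : P l <= 1 by apply: prod_le1 => i _.
have Pa l (a : 'I_k) : P l <= 1 - r a l.
  have /andP[qa _] := q01 a l.
  by rewrite /P (bigD1 a)//= ler_piMr// prod_le1.
pose W l := c l * P l.
have W0 l : 0 <= W l by rewrite mulr_ge0 ?dotpp_ge0.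
have sumW : 1 <= \sum_l W l.
  apply: (@le_trans _ _ (\sum_l c l * (1 - \sum_(a < k) r a l))); last first.
    apply: ler_sum => l _; rewrite ler_wpM2l ?dotpp_ge0//.
    by apply: (prod1B_ge (F := r^~ l)) => a ak; exact: r01.
  under eq_bigr do rewrite mulrBr mulr1 mulr_sumr.
  rewrite sumrB (isotropic_trace iso) exchange_big /=.
  rewrite (eq_bigr (fun=> 1)); last by move=> a _; exact: iso_sqr (e1 _ (ltn_ord a)).
  by rewrite sumr_const card_ord lerBrDr -mulrS ler_nat.
pose f l := misfit (u l) + \sum_(a < k) r a l.
have f0 l : 0 <= f l.
  by rewrite addr_ge0 ?misfit_ge0// sumr_ge0// => a _; rewrite sqr_ge0.
set K := total_misfit + _.
have WfK : \sum_l W l * f l <= K.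
  under eq_bigr do rewrite mulrDr.
  rewrite big_split /= lerD//.
    rewrite total_misfitE; apply: ler_sum => l _; rewrite ler_wpM2r ?misfit_ge0//.
    by rewrite ler_piMr ?dotpp_ge0.
  under eq_bigr do rewrite mulr_sumr.
  rewrite exchange_big /=; apply: ler_sum => a _; apply: ler_sum => l _.
  rewrite dotp_dir_sqr /W -mulrA -[leRHS]mulrA ler_wpM2l ?dotpp_ge0// -/(r a l) mulrC.
  have /andP[r0 _] := r01 a l (ltn_ord a); rewrite ler_wpM2l//.
  apply: le_trans (Pa l a) _.
  have [v0|v0] := eqVneq (v l) 0.
    by rewrite /r v0 /direction scaler0 dotp0r expr0n subr0 subr0 e1.
  rewrite !(dotpBl, dotpBr) (direction_unit v0) e1// (dotpC (u l)).
  have : r a l = dotp (e a) (u l) ^+ 2 by [].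
  by have := sqr_ge0 (1 - dotp (e a) (u l)); rewrite sqrrB /r; lra.
have [l0 vl0] : exists l, v l != 0.
  apply/existsP; rewrite -[X in is_true X]negbK negb_exists; apply/negP => /forallP H.
  move: sumW; rewrite big1 ?ler10// => l _.
  by have := H l; rewrite negbK /W => /eqP ->; rewrite dotp0l mul0r.
case: (@arg_minP _ _ _ l0 (fun l => v l != 0) f vl0) => l vl fmin.
exists l => //; apply: le_trans WfK.
apply: (@le_trans _ _ ((\sum_l W l) * f l)); first exact: (ler_peMl (f0 l) sumW).
rewrite mulr_suml; apply: ler_sum => i _.
have [vi|vi] := eqVneq (v i) 0; first by rewrite /W vi dotp0l !mul0r.
by rewrite ler_wpM2l// fmin.
Qed.

(** Adding one vector multiplies the bounds by at most n + 1. *)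
Lemma greedy_frame k : (k <= n)%N -> exists e : nat -> 'rV[R]_n,
  forall a, (a < k)%N -> [/\ sq (e a) = 1, misfit (e a) <= n.+1%:R ^+ k * total_misfit &
    forall b, (b < k)%N -> b != a -> dotp (e b) (e a) ^+ 2 <= n.+1%:R ^+ k * total_misfit].
Proof.
elim: k => [_|k IH kn]; first by exists (fun=> 0).
have [e eP] := IH (ltnW kn).
have [l vl fl] := greedy_step kn (fun a ak => let: And3 h _ _ := eP a ak in h).
exists (fun a => if a == k then u l else e a).
set B := n.+1%:R ^+ k * total_misfit in eP *.
have B0 : 0 <= B by rewrite mulr_ge0 ?exprn_ge0 ?total_misfit_ge0.
have sB : total_misfit <= B by rewrite ler_peMl ?total_misfit_ge0// exprn_ege1// ler1n.
have BB : n.+1%:R ^+ k.+1 * total_misfit = n.+1%:R * B by rewrite exprS mulrA.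
have BS : B <= n.+1%:R * B by rewrite ler_peMl// ler1n.
have fB : misfit (u l) + \sum_(a < k) dotp (e a) (u l) ^+ 2 <= n.+1%:R * B.
  apply: le_trans fl _; apply: (@le_trans _ _ (B + \sum_(a < k) B)).
    by apply: lerD => //; apply: ler_sum => a _; have [] := eP a (ltn_ord a).
  rewrite sumr_const card_ord -mulrS -(mulr_natl B) ler_wpM2r// ler_nat ltnS ltnW//.
have S0 : 0 <= \sum_(a < k) dotp (e a) (u l) ^+ 2 by apply: sumr_ge0 => a _; exact: sqr_ge0.
have Sa a : (a < k)%N -> dotp (e a) (u l) ^+ 2 <= n.+1%:R * B.
  move=> ak; apply: le_trans fB; rewrite (bigD1 (Ordinal ak))//= addrCA lerDl.
  by rewrite addr_ge0 ?misfit_ge0// sumr_ge0// => b _; exact: sqr_ge0.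
move=> a; rewrite ltnS leq_eqVlt BB; have [->{a} _|ak /= altk] := eqVneq a k.
  split; first exact: direction_unit.
    by apply: le_trans fB; rewrite lerDl.
  move=> b; rewrite ltnS leq_eqVlt => /orP[/eqP->|bk _]; first by rewrite eqxx.
  by rewrite ltn_eqF//; exact: Sa.
have [ea ga oa] := eP a altk.
split => //; first exact: le_trans BS.
move=> b; rewrite ltnS leq_eqVlt; have [->{b} _ _|bk /= bltk ba] := eqVneq b k.
  by rewrite dotpC; exact: Sa.
by apply: le_trans BS; exact: oa.
Qed.

Definition frame_sqr x := \sum_l pos (dotp x (v l)) ^+ 2.

Lemma frame_sqrE x : frame_sqr x = \sum_l c l * pos (dotp x (u l)) ^+ 2.
Proof.
apply: eq_bigr => l _; rewrite dotp_directionr posM ?enorm_ge0// exprMn enorm_sqr//.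
Qed.

Lemma pos_dotp_le x y : pos (dotp x y) ^+ 2 <= sq x * sq y.
Proof.
apply: le_trans (dotp_cauchy x y); rewrite -[leRHS]real_normK ?num_real//.
by rewrite ler_pXn2r ?nnegrE ?pos_ge0// pos_le.
Qed.

(** Bessel's inequality for almost orthonormal vectors: q is the scalar product
    of the direction with w, while |w|^2 <= (1 + n t) q. *)
Lemma bessel_almost (e : nat -> 'rV[R]_n) (t : R) l : 0 <= t ->
  (forall a, (a < n)%N -> sq (e a) = 1) ->
  (forall a b, (a < n)%N -> (b < n)%N -> b != a -> `|dotp (e b) (e a)| <= t) ->
  \sum_(a < n) dotp (e a) (u l) ^+ 2 <= 1 + n%:R * t.
Proof.
move=> t0 e1 eo; set q := \sum_(a < n) _.
have q0 : 0 <= q by apply: sumr_ge0 => a _; exact: sqr_ge0.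
pose w := \sum_(a < n) dotp (e a) (u l) *: e a.
have qw : q = dotp w (u l).
  by rewrite dotp_suml; apply: eq_bigr => a _; rewrite dotpZl expr2.
have ww : sq w <= (1 + n%:R * t) * q.
  rewrite {1}/w dotp_suml.
  under eq_bigr do rewrite dotpZl dotp_sumr mulr_sumr.
  under eq_bigr do under eq_bigr do rewrite dotpZr.
  pose F (a b : 'I_n) := (a == b)%:R * dotp (e a) (u l) ^+ 2 +
     t * ((dotp (e a) (u l) ^+ 2 + dotp (e b) (u l) ^+ 2) / 2).
  apply: (@le_trans _ _ (\sum_a \sum_b F a b)).
    apply: ler_sum => a _; apply: ler_sum => b _; rewrite /F.
    have S0 := addr_ge0 (sqr_ge0 (dotp (e a) (u l))) (sqr_ge0 (dotp (e b) (u l))).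
    have [->|ab] := eqVneq a b.
      rewrite e1// mulr1 mul1r -expr2 lerDl mulr_ge0// divr_ge0//.
      by rewrite addr_ge0 ?sqr_ge0.
    rewrite mul0r add0r mulrA mulrC.
    apply: le_trans (ler_norm _) _; rewrite normrM ler_pM ?normr_ge0//.
      by rewrite eo.
    rewrite ler_norml; apply/andP; split.
      have := sqr_ge0 (dotp (e a) (u l) + dotp (e b) (u l)); rewrite sqrrD; lra.
    have := sqr_ge0 (dotp (e a) (u l) - dotp (e b) (u l)); rewrite sqrrB; lra.
  rewrite /F; under eq_bigr do rewrite big_split /= -mulr_sumr -mulr_suml big_split /= sumr_const card_ord -/q.
  rewrite big_split /= -mulr_sumr -mulr_suml big_split /= sumrMnl -/q sumr_const card_ord.
  have -> : \sum_(i < n) \sum_(i0 < n) (i == i0)%:R * dotp (e i) (u l) ^+ 2 = q.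
    apply: eq_bigr => a _; rewrite (bigD1 a)//= eqxx mul1r big1 ?addr0// => b ba.
    by rewrite eq_sym (negbTE ba) mul0r.
  by rewrite -(mulr_natl q) [leLHS](_ : _ = (1 + n%:R * t) * q)//; field.
have : q ^+ 2 <= (1 + n%:R * t) * q.
  rewrite {1}qw; apply: le_trans (dotp_cauchy _ _) _.
  by apply: le_trans ww; rewrite ler_piMr ?dotpp_ge0 ?direction_le1.
have [q0'|] := ltP 0 q; first by rewrite expr2 ler_pM2r.
by move=> qn _; apply: (le_trans qn); rewrite addr_ge0// mulr_ge0.
Qed.

(** Split the weight 1 of the direction of v l as q l + (1 - q l), where q l is
    its squared projection on the e a. The weights 1 - q l are almost
    nonnegative by [bessel_almost] and their c-average is 0, both traces being
    n, so they are small in mean. In the part of weight q l, replacing the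
    direction by e a costs at most the misfit of e a, by the inequality 2 d <= t
    + d^2 / t. *)
Lemma frame_approx (e : nat -> 'rV[R]_n) (t : R) x : 0 < t ->
  (forall a, (a < n)%N -> sq (e a) = 1) ->
  (forall a b, (a < n)%N -> (b < n)%N -> b != a -> `|dotp (e b) (e a)| <= t) ->
  (forall a, (a < n)%N -> misfit (e a) <= t ^+ 2) ->
  `|frame_sqr x - \sum_(a < n) pos (dotp x (e a)) ^+ 2| <=
    (2 * n%:R ^+ 2 + 2 * n%:R) * t * sq x.
Proof.
move=> t0 e1 eo eg.
pose X l := pos (dotp x (u l)) ^+ 2.
pose Y a := pos (dotp x (e a)) ^+ 2.
pose q l := \sum_(a < n) dotp (e a) (u l) ^+ 2.
have cq : \sum_l c l * q l = n%:R.
  rewrite /q; under eq_bigr do rewrite mulr_sumr.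
  rewrite exchange_big /= (eq_bigr (fun=> 1)); first by rewrite sumr_const card_ord.
  by move=> a _; exact: iso_sqr (e1 _ (ltn_ord a)).
have -> : frame_sqr x - \sum_(a < n) pos (dotp x (e a)) ^+ 2 =
   \sum_l c l * X l * (1 - q l) +
   \sum_(a < n) \sum_l c l * dotp (e a) (u l) ^+ 2 * (X l - Y a).
  rewrite frame_sqrE.
  have -> : \sum_(a < n) \sum_l c l * dotp (e a) (u l) ^+ 2 * (X l - Y a) =
     \sum_l c l * X l * q l - \sum_(a < n) Y a.
    under eq_bigr do under eq_bigr do rewrite mulrBr.
    under eq_bigr do rewrite sumrB -mulr_suml iso_sqr ?e1// mul1r.
    rewrite sumrB; congr (_ - _); rewrite exchange_big; apply: eq_bigr => l _.
    by rewrite /q mulr_sumr; apply: eq_bigr => a _; ring.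
  rewrite addrA -big_split; congr (_ - _); apply: eq_bigr => l _.
  by rewrite /= -/(X l); ring.
have nt : 0 <= n%:R * t by rewrite mulr_ge0// ltW.
have T1 : `|\sum_l c l * X l * (1 - q l)| <= 2 * n%:R ^+ 2 * t * sq x.
  apply: le_trans (ler_norm_sum _ _ _) _.
  apply: (@le_trans _ _ (\sum_l sq x * (c l * (2 * (n%:R * t) + 1 - q l)))).
    apply: ler_sum => l _; rewrite normrM (normrM (c l)).
    rewrite ger0_norm ?dotpp_ge0// (ger0_norm (sqr_ge0 _)) [leRHS]mulrCA -[leLHS]mulrA ler_wpM2l ?dotpp_ge0//.
    rewrite ler_pM ?normr_ge0 ?sqr_ge0//.
      by apply: le_trans (pos_dotp_le _ _) _; rewrite ler_piMr ?dotpp_ge0 ?direction_le1.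
    have := bessel_almost l (ltW t0) e1 eo; rewrite -/(q l) => ql.
    by rewrite ler_norml; apply/andP; split; lra.
  rewrite -mulr_sumr; under eq_bigr do rewrite mulrBr.
  rewrite sumrB cq -mulr_suml (isotropic_trace iso).
  by rewrite mulrC; apply: eq_ler; ring.
have T2 : `|\sum_(a < n) \sum_l c l * dotp (e a) (u l) ^+ 2 * (X l - Y a)| <=
    2 * n%:R * t * sq x.
  apply: le_trans (ler_norm_sum _ _ _) _.
  apply: (@le_trans _ _ (\sum_(a < n) (2 * t * sq x))); last first.
    by rewrite sumr_const card_ord -mulr_natl; apply: eq_ler; ring.
  apply: ler_sum => a _; apply: le_trans (ler_norm_sum _ _ _) _.
  have ea := e1 a (ltn_ord a).
  apply: (@le_trans _ _ (\sum_l (sq x * (t * (c l * dotp (e a) (u l) ^+ 2) +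
       t^-1 * (dotp (e a) (v l) ^+ 2 * sq (e a - u l)))))).
    apply: ler_sum => l _; rewrite dotp_dir_sqr normrM (ger0_norm (mulr_ge0 (dotpp_ge0 _) (sqr_ge0 _))).
    set D := c l * _; have D0 : 0 <= D := mulr_ge0 (dotpp_ge0 _) (sqr_ge0 _).
    rewrite [leRHS](_ : _ = D * (sq x * (t + t^-1 * sq (e a - u l)))); last by ring.
    rewrite ler_wpM2l//.
    apply: le_trans (pos_sqrB _ _) _.
    set d := enorm (e a - u l).
    have b1 : `|dotp x (u l) - dotp x (e a)| <= enorm x * d.
      by rewrite -dotpBr -normrN -dotpNr opprB dotp_le_enorm.
    have en1 (y : 'rV[R]_n) : sq y <= 1 -> `|dotp x y| <= enorm x.
      move=> y1; apply: le_trans (dotp_le_enorm _ _) _; rewrite ler_piMr ?enorm_ge0//.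
      by rewrite -(@ler_pXn2r _ 2) ?nnegrE ?enorm_ge0// enorm_sqr expr1n.
    have b2 := lerD (en1 _ (direction_le1 (v l))) (en1 (e a) _).
    have {}b2 : `|dotp x (u l)| + `|dotp x (e a)| <= enorm x + enorm x by apply: b2; rewrite ea.
    apply: (@le_trans _ _ (enorm x * d * (enorm x + enorm x))).
      by rewrite ler_pM ?addr_ge0.
    rewrite -!enorm_sqr -/d (_ : _ * _ * _ = enorm x ^+ 2 * (2 * d)); last by ring.
    rewrite ler_wpM2l ?sqr_ge0//.
    have := sqr_ge0 (t - d); rewrite sqrrB => td.
    rewrite -(ler_pM2l t0) [leRHS](_ : _ = t ^+ 2 + d ^+ 2); last by field; rewrite gt_eqF.
    lra.
  rewrite -mulr_sumr big_split /= -!mulr_sumr iso_sqr// mulr1.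
  rewrite mulrC ler_wpM2r ?dotpp_ge0//.
  have : t^-1 * misfit (e a) <= t.
    by rewrite mulrC ler_pdivrMr// -expr2 eg.
  rewrite /misfit; lra.
apply: le_trans (ler_normD _ _) _; apply: le_trans (lerD T1 T2) _.
by apply: eq_ler; ring.
Qed.
End Frames.

(** * Gaussian transport of the line onto the half-line *)

Section Transport.
Variable R : realType.
Let mu := @lebesgue_measure R.
Local Notation T := (Num.sqrt pi : R).

Let gauss_int (A : set R) : measurable A -> mu.-integrable A (EFin \o gauss_fun).
Proof. by move=> mA; apply: integrableS (@integrableT_gauss R). Qed.

Definition gauss_cdf (x : R) : R := \int[mu]_(t in `]-oo, x]) gauss_fun t.

Local Notation G := gauss_cdf.

Lemma gauss_cdf_is_derive (x : R) : is_derive x 1 G (gauss_fun x).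
Proof.
have xu : x < x + 1 by rewrite ltrDl.
have [d1 d2] := continuous_FTC1 xu (gauss_int (@measurable_itv R `]-oo, (x + 1)]))
  (ltNyr x) (@continuous_gauss_fun R x).
by split; [exact: d1|rewrite -derive1E; exact: d2].
Qed.

Lemma gauss_cdf_continuous : continuous G.
Proof.
by move=> x; apply: differentiable_continuous; apply/derivable1_diffP; case: (gauss_cdf_is_derive x).
Qed.

Lemma gauss_cdf_incr x y : x < y -> G x < G y.
Proof.
move=> xy; have [|c _ e] := @MVT R G (@gauss_fun R) x y xy (fun z _ => gauss_cdf_is_derive z).
  by apply: continuous_subspaceT; exact: gauss_cdf_continuous.
by rewrite -subr_gt0 e mulr_gt0 ?subr_gt0// expR_gt0.
Qed.

Lemma gauss_cdf_inj : injective G.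
Proof.
move=> x y Gxy; apply/eqP; rewrite -[x == y]negbK neq_lt; apply/negP.
by move=> /orP[] /gauss_cdf_incr; rewrite Gxy ltxx.
Qed.

Lemma gauss_total : \int[mu]_(t in `]-oo, +oo[) gauss_fun t = T.
Proof. by rewrite set_itvNyy /Rintegral integralT_gauss. Qed.

Lemma gauss_cdf_compl x : T - G x = \int[mu]_(t in `]x, +oo[) gauss_fun t.
Proof. by rewrite -gauss_total Rintegral_itvB//; exact: gauss_int. Qed.

Lemma gauss_cdf_gt0 x : 0 < G x.
Proof.
apply: le_lt_trans (_ : G (x - 1) < _); last by apply: gauss_cdf_incr; rewrite gtrBl.
by apply: Rintegral_ge0 => t _; exact: gauss_fun_ge0.
Qed.

Lemma gauss_cdf_ltT x : G x < T.
Proof.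
apply: (@lt_le_trans _ _ (G (x + 1))); first by apply: gauss_cdf_incr; rewrite ltrDl.
rewrite -subr_ge0 gauss_cdf_compl.
by apply: Rintegral_ge0 => t _; exact: gauss_fun_ge0.
Qed.

Lemma gauss_cdf0 : G 0 = T / 2.
Proof.
have := gauss_cdf_compl 0.
rewrite Rintegral_itv_obnd_cbnd; last by exact: gauss_int.
rewrite /Rintegral integral0y_gauss /=; lra.
Qed.

Lemma gauss_cdf_nat n : G n%:R = T / 2 + \int[mu]_(t in `[0, n%:R]) gauss_fun t.
Proof.
rewrite -gauss_cdf0 -Rintegral_itv_obnd_cbnd; last exact: gauss_int.
rewrite -(@Rintegral_itvB R gauss_fun -oo%O (BRight n%:R) 0)//.
- by rewrite addrC subrK.
- exact: gauss_int.
- by rewrite bnd_simp.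
Qed.

Lemma gauss_cdf_surj y : 0 < y < T -> T / 2 <= y -> exists s, G s = y.
Proof.
move=> /andP[y0 yT] yT2.
have [n yn] : exists n : nat, y < G n%:R.
  have := @ge0_cvgn_integral R mu gauss_fun (@gauss_fun_ge0 R) (@measurable_gauss_fun R).
  rewrite integral0y_gauss => /fine_cvgP[_].
  move=> /cvgrPdist_lt/(_ (T - y)); rewrite subr_gt0 => /(_ yT)[n _ /(_ n (leqnn n))] /=.
  rewrite ltr_norml => /andP[_ h]; exists n; rewrite gauss_cdf_nat /Rintegral; lra.
have [||c _ Gc] := @IVT R G 0 n%:R y (ler0n _ _) _ _.
- by apply: continuous_subspaceT; exact: gauss_cdf_continuous.
- rewrite gauss_cdf0 ge_min yT2 /= le_max (ltW yn) orbT//.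
by exists c.
Qed.

Definition gauss_quantile (y : R) : R := xget 0 [set s | G s = y].

Lemma gauss_quantileK : cancel G gauss_quantile.
Proof.
move=> x; apply: gauss_cdf_inj; rewrite /gauss_quantile.
by apply: (@xgetPex _ 0 [set s | G s = G x]); exists x.
Qed.

(** The increasing map that sends the Gaussian measure of the line to twice its
    restriction to the half-line. *)
Definition half_transport (t : R) : R := gauss_quantile ((G t + T) / 2).
Local Notation S := half_transport.

Lemma half_transportP t : G (S t) = (G t + T) / 2.
Proof.
have G0 := gauss_cdf_gt0 t; have GT := gauss_cdf_ltT t.
have [||s Gs] := @gauss_cdf_surj ((G t + T) / 2).
- by apply/andP; split; lra.
- lra.
by rewrite /half_transport -Gs gauss_quantileK.
Qed.

Lemma half_transport_gt0 t : 0 < S t.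
Proof.
rewrite ltNge; apply/negP; rewrite le_eqVlt => /orP[/eqP s0|/gauss_cdf_incr];
have := half_transportP t; have G0 := gauss_cdf_gt0 t.
  rewrite s0 gauss_cdf0; lra.
rewrite gauss_cdf0; lra.
Qed.

(** The logarithm of the derivative of S, by the equation exp (- S^2) S' = exp
    (- t^2) / 2 between the densities. *)
Definition log_slope (t : R) : R := S t ^+ 2 - t ^+ 2 - ln 2.

Lemma half_transport_slope t : expR (log_slope t) = (gauss_fun (S t))^-1 * (gauss_fun t / 2).
Proof.
by rewrite /log_slope /gauss_fun -expRN opprK expRB lnK ?posrE// expRD mulrA.
Qed.

Lemma half_transport_is_derive (t : R) : is_derive t 1 S (expR (log_slope t)).
Proof.
pose f := fun t => (G t + T) / 2.
have df : is_derive t 1 f (gauss_fun t / 2).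
  have := gauss_cdf_is_derive t => h.
  rewrite /f; apply: is_derive_eq; rewrite addr0 /GRing.scale/=; ring.
have dg : is_derive (f t) 1 gauss_quantile (gauss_fun (S t))^-1.
  rewrite (_ : f t = G (S t)); last by rewrite half_transportP.
  apply: is_derive_inverse.
  - by near=> z; exact: gauss_quantileK.
  - by near=> z; exact: gauss_cdf_continuous.
  - exact: gauss_cdf_is_derive.
  - by rewrite gt_eqF// expR_gt0.
rewrite (_ : S = gauss_quantile \o f)// half_transport_slope.
exact: (@is_derive1_comp _ _ _ _ _ _ dg df).
Unshelve. all: by end_near. Qed.

Lemma half_transport_continuous : continuous S.
Proof.
by move=> x; apply: differentiable_continuous; apply/derivable1_diffP; case: (half_transport_is_derive x).
Qed.

Lemma log_slope_continuous : continuous log_slope.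
Proof.
move=> x; apply: cvgB; last exact: cvg_cst.
apply: cvgB; last exact: exprn_continuous.
exact: (@continuous_comp _ _ _ S (fun z : R => z ^+ 2) x (@half_transport_continuous x) (@exprn_continuous _ 2 _)).
Qed.

Lemma half_transport_MVT a b : a < b -> exists2 c, a < c < b & S b - S a = expR (log_slope c) * (b - a).
Proof.
move=> ab; have [|c cab e] := @MVT R S (fun z => expR (log_slope z)) a b ab (fun z _ => half_transport_is_derive z).
  by apply: continuous_subspaceT; exact: half_transport_continuous.
by exists c => //; move: cab; rewrite in_itv.
Qed.

Lemma log_slope_is_derive (t : R) :
  is_derive t 1 log_slope (2 * S t * expR (log_slope t) - 2 * t).
Proof.
have := half_transport_is_derive t => h; rewrite /log_slope.
by apply: is_derive_eq; rewrite /GRing.scale/=; ring.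
Qed.

(** The derivative of [log_slope] is positive at 0, hence bounded below near 0.
    This is where distinct values of the argument cause a loss in Jensen's
    inequality. *)
Lemma log_slope_local : exists (r m : R), [/\ 0 < r, 0 < m &
  forall a b, `|a| <= r -> `|b| <= r ->
   `|log_slope a - log_slope b| <= 2 /\ m * `|a - b| <= `|log_slope a - log_slope b| ].
Proof.
pose d t := 2 * S t * expR (log_slope t) - 2 * t.
have d0 : 0 < d 0 by rewrite /d mulr0 subr0 !mulr_gt0 ?half_transport_gt0 ?expR_gt0.
have cd : {for 0, continuous d}.
  apply: cvgB; last by apply: cvgM; [exact: cvg_cst|exact: cvg_id].
  apply: cvgM; first by apply: cvgM; [exact: cvg_cst|exact: half_transport_continuous].
  exact: (@continuous_comp _ _ _ log_slope expR 0 (@log_slope_continuous 0) (@continuous_expR R _)).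
have [e1 /= e10 he1] : \forall t \near (0 : R), d 0 / 2 < d t.
  by apply: (cvgr_gt _ cd); rewrite ltr_pdivrMr// ltr_pMr// ltr1n.
have [e2 /= e20 he2] : \forall t \near (0 : R), `|log_slope 0 - log_slope t| < 1.
  by have /cvgrPdist_lt := @log_slope_continuous 0; apply.
pose r := Num.min e1 e2 / 2.
have me : 0 < Num.min e1 e2 by rewrite lt_min e10.
have r0 : 0 < r by rewrite divr_gt0.
have re : r < Num.min e1 e2 by rewrite /r ltr_pdivrMr// ltr_pMr// ltr1n.
have [r1 r2] : r < e1 /\ r < e2 by move: re; rewrite lt_min => /andP.
exists r, (d 0 / 2); split => //; first by rewrite divr_gt0.
move=> a b ar br; split.
  have := he2 a; have := he2 b; rewrite /= !sub0r !normrN.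
  move=> /(_ (le_lt_trans br r2)) hb /(_ (le_lt_trans ar r2)) ha.
  rewrite (_ : _ - _ = (log_slope 0 - log_slope b) - (log_slope 0 - log_slope a)); last by ring.
  by apply: le_trans (ler_normB _ _) _; lra.
have key x y : x < y -> `|x| <= r -> `|y| <= r -> d 0 / 2 * (y - x) <= log_slope y - log_slope x.
  move=> xy xr yr; have [|c cxy ->] := @MVT R log_slope d x y xy (fun z _ => log_slope_is_derive z).
    by apply: continuous_subspaceT; exact: log_slope_continuous.
  rewrite ler_pM2r ?subr_gt0// ltW//; apply: he1; rewrite /= sub0r normrN.
  apply: le_lt_trans r1; move: cxy xr yr; rewrite in_itv/= !ler_norml.
  by move=> /andP[? ?] /andP[? ?] /andP[? ?]; apply/andP; split; lra.
have [ab|ba|->] := ltgtP a b; last by rewrite !subrr normr0 mulr0.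
  rewrite distrC (distrC (log_slope a)) gtr0_norm ?subr_gt0//.
  by apply: le_trans (ler_norm _); exact: key.
rewrite gtr0_norm ?subr_gt0//.
by apply: le_trans (ler_norm _); exact: key.
Qed.
End Transport.

(** * Change of variables for piecewise linear maps *)

Section PiecewiseLinear.
Variable R : realType.
Local Notation RT := (measurableTypeR R).
Local Notation S := (@half_transport R).

Lemma half_transport_incr (a b : R) : a < b -> S a < S b.
Proof.
move=> ab; have [c _ e] := half_transport_MVT ab.
by rewrite -subr_gt0 e mulr_gt0 ?subr_gt0// expR_gt0.
Qed.

(** Change of variables is used for affine maps only. So S is replaced by its
    chords over the cells of length 1/(m+1) of [-(m+1), m+1], and m tends to
    infinity. *)
Definition grid (m j : nat) : R := j%:R / m.+1%:R - m.+1%:R.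
Definition grid_slope m j := (S (grid m j.+1) - S (grid m j)) * m.+1%:R.
Definition chord m j (t : R) := S (grid m j) + grid_slope m j * (t - grid m j).
Definition in_cell m j (t : R) := grid m j <= t < grid m j.+1.

Lemma grid_step m j : grid m j.+1 - grid m j = m.+1%:R^-1.
Proof. by rewrite /grid -[j.+1]addn1 natrD mulrDl mul1r; ring. Qed.

Lemma grid_lt m j : grid m j < grid m j.+1.
Proof. by rewrite -subr_gt0 grid_step invr_gt0 ltr0n. Qed.

Lemma grid_le m j k : (j <= k)%N -> grid m j <= grid m k.
Proof. by move=> jk; rewrite lerD2r ler_pM2r ?invr_gt0 ?ltr0n// ler_nat. Qed.

Lemma grid_slope_gt0 m j : 0 < grid_slope m j.
Proof. by rewrite mulr_gt0 ?ltr0n// subr_gt0 half_transport_incr// grid_lt. Qed.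

Lemma chord_right m j : chord m j (grid m j.+1) = S (grid m j.+1).
Proof. by rewrite /chord /grid_slope grid_step -mulrA mulfV ?pnatr_eq0// mulr1 addrC subrK. Qed.

Lemma chord_incr m j t t' : t < t' -> chord m j t < chord m j t'.
Proof. by move=> tt; rewrite ltrD2l ltr_pM2l ?grid_slope_gt0// ltrD2r. Qed.

Lemma chord_gt0 m j t : in_cell m j t -> 0 < chord m j t.
Proof.
move=> /andP[jt _]; rewrite ltr_wpDr ?half_transport_gt0// mulr_ge0 ?subr_ge0//.
exact/ltW/grid_slope_gt0.
Qed.

Lemma half_transport_ltW (a b : R) : a <= b -> S a <= S b.
Proof. by rewrite le_eqVlt => /orP[/eqP->//|/half_transport_incr/ltW]. Qed.

Lemma chord_mono m j k t t' : in_cell m j t -> in_cell m k t' -> t < t' ->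
  chord m j t < chord m k t'.
Proof.
move=> /andP[jt tj] /andP[kt tk] tt'; have [jk|kj|<-] := ltngtP j k.
- apply: (@lt_le_trans _ _ (S (grid m j.+1))); first by rewrite -chord_right chord_incr.
  apply: (@le_trans _ _ (S (grid m k))); first exact/half_transport_ltW/grid_le.
  by rewrite lerDl mulr_ge0 ?subr_ge0// ltW// grid_slope_gt0.
- have := grid_le m kj => h.
  by have := lt_le_trans tk (le_trans h jt); rewrite ltNge (ltW tt').
- exact: chord_incr.
Qed.

Lemma in_cell_inj m j k t : in_cell m j t -> in_cell m k t -> j = k.
Proof.
move=> /andP[jt tj] /andP[kt tk]; have [jk|kj|//] := ltngtP j k.
  by have := le_lt_trans kt (lt_le_trans tj (grid_le m jk)); rewrite ltxx.
by have := le_lt_trans jt (lt_le_trans tk (grid_le m kj)); rewrite ltxx.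
Qed.

Definition cell_of m (t : R) := Num.trunc ((t + m.+1%:R) * m.+1%:R).
Definition ncells m := (2 * (m.+1 * m.+1))%N.

Lemma cell_ofP m t : `|t| < m.+1%:R -> in_cell m (cell_of m t) t /\ (cell_of m t < ncells m)%N.
Proof.
rewrite ltr_norml => /andP[t1 t2]; have m0 : 0 < m.+1%:R :> R by rewrite ltr0n.
have x0 : 0 <= (t + m.+1%:R) * m.+1%:R by rewrite mulr_ge0 ?(ltW m0)// -lerBlDr sub0r ltW.
split.
  rewrite /in_cell /grid lerBlDr ltrBrDr ler_pdivrMr// ltr_pdivlMr//.
  by rewrite truncn_le x0 /= truncnS_gt.
rewrite /cell_of truncn_lt_nat// /ncells natrM natrM mulrA ltr_pM2r//.
by rewrite (_ : 2 = 1 + 1)// mulrDl mul1r ltrD2r.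
Qed.

Section Limits.
Variable t : R.

Lemma in_cell_near m j : in_cell m j t ->
  `|grid m j - t| <= m.+1%:R^-1 /\ `|grid m j.+1 - t| <= m.+1%:R^-1.
Proof.
move=> /andP[h1 h2]; rewrite -(grid_step m j).
by split; rewrite ler_norml; apply/andP; split; lra.
Qed.

Lemma cell_eventually : \forall m \near \oo, in_cell m (cell_of m t) t.
Proof.
exists (Num.trunc `|t|).+1 => // m /= tm.
apply: (cell_ofP _).1; apply: lt_le_trans (truncnS_gt _) _.
by rewrite ler_nat ltnS ltnW.
Qed.

Lemma cvg_inv_nat : m.+1%:R^-1 @[m --> \oo] --> (0 : R).
Proof. exact: cvg_harmonic. Qed.

Lemma cvg_grid : grid m (cell_of m t) @[m --> \oo] --> t.
Proof.
apply/cvgrPdist_le => e e0; have /cvgrPdist_le/(_ e e0) := cvg_inv_nat => he.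
near=> m; have tc : in_cell m (cell_of m t) t by near: m; exact: cell_eventually.
rewrite distrC; apply: le_trans (in_cell_near tc).1 _.
have : `|0 - m.+1%:R^-1| <= e by near: m.
by rewrite sub0r normrN ger0_norm.
Unshelve. all: by end_near. Qed.

Lemma cvg_grid_slope : grid_slope m (cell_of m t) @[m --> \oo] --> expR (log_slope t).
Proof.
have : {for t, continuous (fun z => expR (@log_slope R z))}.
  exact: (@continuous_comp _ _ _ (@log_slope R) expR t (@log_slope_continuous R t) (@continuous_expR R _)).
move=> /cvgrPdist_le cS; apply/cvgrPdist_le => e e0.
have [d /= d0 hd] := cS e e0.
have /cvgrPdist_lt/(_ d d0) := cvg_inv_nat => he.
near=> m; have tc : in_cell m (cell_of m t) t by near: m; exact: cell_eventually.
have [c /andP[c1 c2] ec] := half_transport_MVT (grid_lt m (cell_of m t)).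
rewrite /grid_slope ec grid_step -mulrA mulVf ?pnatr_eq0// mulr1.
apply: hd => /=.
have : `|0 - m.+1%:R^-1| < d by near: m.
rewrite sub0r normrN ger0_norm// => md; apply: le_lt_trans md.
have [] := in_cell_near tc; rewrite !ler_norml; move: (m.+1%:R^-1) => q.
by move=> /andP[? ?] /andP[? ?]; apply/andP; split; lra.
Unshelve. all: by end_near. Qed.

Lemma cvg_chord : chord m (cell_of m t) t @[m --> \oo] --> S t.
Proof.
rewrite -[S t]addr0 -(mulr0 (expR (log_slope t))) -(subrr t).
apply: cvgD; last by apply: cvgM; [exact: cvg_grid_slope|apply: cvgB; [exact: cvg_cst|exact: cvg_grid]].
exact: (@cvg_comp _ _ _ (fun m => grid m (cell_of m t)) S _ _ _ cvg_grid (@half_transport_continuous R t)).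
Qed.
End Limits.

Section Bound.
Variables (n N : nat) (v : 'I_N -> 'rV[R]_n).
Hypothesis iso : isotropic v.
Variable F : 'rV[R]_n -> \bar R.
Hypotheses (mF : rmfun F) (F0 : forall y, (0 <= F y)%E).
(** In the application F is expR of minus the squared gauge of a body. *)
Hypothesis FE : forall f : 'I_N -> R, (forall i, 0 <= f i) ->
  ((expR (- \sum_i f i ^+ 2))%:E <= F (\sum_i f i *: v i))%E.

Local Notation u i := (direction (v i)).
Local Notation c i := (dotp (v i) (v i)).
Local Notation op s := (\sum_i s i *: ((v i)^T *m v i)).

Definition cells m := {ffun 'I_N -> 'I_(ncells m)}.
Definition cell m (k : cells m) : set 'rV[R]_n :=
  [set w | forall i, in_cell m (k i) (dotp w (u i))].
Definition cell_op m (k : cells m) : 'M[R]_n := op (fun i => grid_slope m (k i)).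
Definition cell_shift m (k : cells m) : 'rV[R]_n :=
  \sum_i (enorm (v i) * (S (grid m (k i)) - grid_slope m (k i) * grid m (k i))) *: v i.

Lemma cell_map m (k : cells m) w : w *m cell_op k + cell_shift k =
  \sum_i (enorm (v i) * chord m (k i) (dotp w (u i))) *: v i.
Proof.
rewrite /cell_op /cell_shift mulmx_sumr -big_split; apply: eq_bigr => i _ /=.
rewrite -scalemxAr mulmxA dotp_scalar mul_scalar_mx scalerA -scalerDl.
by congr (_ *: _); rewrite dotp_directionr /chord; ring.
Qed.

(** Ball's inequality serves here only through the positivity of its lower
    bound. *)
Lemma cell_op_det m (k : cells m) : 0 < \det (cell_op k).
Proof.
have := frame_det_ge iso (fun i => ln (grid_slope m (k i))).
rewrite [X in \det X](_ : _ = cell_op k); last first.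
  by apply: eq_bigr => i _; rewrite lnK// posrE grid_slope_gt0.
by apply: lt_le_trans; exact: expR_gt0.
Qed.

(** The piecewise affine transport is strictly monotone: the scalar product of
    the difference of two values with the difference of their arguments is a sum
    of nonnegative terms T i, which vanish only if the arguments have the same
    components along the v i. *)
Lemma cell_map_inj m (k k' : cells m) w w' : cell k w -> cell k' w' ->
  w *m cell_op k + cell_shift k = w' *m cell_op k' + cell_shift k' -> k = k'.
Proof.
move=> kw kw' ye; have e := etrans (esym (cell_map k w)) (etrans ye (cell_map k' w')).
pose T i := c i * (chord m (k i) (dotp w (u i)) - chord m (k' i) (dotp w' (u i))) * dotp (w - w') (u i).
have T0 i : 0 <= T i /\ (T i = 0 -> v i != 0 -> dotp (w - w') (u i) = 0).
  rewrite /T dotpBl -mulrA.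
  have [h|h|h] := ltgtP (dotp w (u i)) (dotp w' (u i)).
  - have hc := chord_mono (kw i) (kw' i) h.
    have p : 0 < (chord m (k i) (dotp w (u i)) - chord m (k' i) (dotp w' (u i))) *
       (dotp w (u i) - dotp w' (u i)) by rewrite nmulr_rgt0 subr_lt0.
    split; first by rewrite mulr_ge0 ?dotpp_ge0// ltW.
    move=> /eqP; rewrite mulf_eq0 (gt_eqF p) orbF dotpp_eq0 => /eqP ->.
    by rewrite eqxx.
  - have hc := chord_mono (kw' i) (kw i) h.
    have p : 0 < (chord m (k i) (dotp w (u i)) - chord m (k' i) (dotp w' (u i))) *
       (dotp w (u i) - dotp w' (u i)) by rewrite mulr_gt0 ?subr_gt0.
    split; first by rewrite mulr_ge0 ?dotpp_ge0// ltW.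
    move=> /eqP; rewrite mulf_eq0 (gt_eqF p) orbF dotpp_eq0 => /eqP ->.
    by rewrite eqxx.
  - by rewrite h subrr mulr0 mulr0; split.
have sT : \sum_i T i = 0.
  have := congr1 (dotp (w - w')) e; rewrite !dotp_sumr => /eqP.
  rewrite -subr_eq0 -sumrB => /eqP e0; rewrite -[RHS]e0; apply: eq_bigr => i _.
  rewrite (dotpZr _ (w - w') (v i)) (dotpZr _ (w - w') (v i)) /T (dotp_directionr (w - w') (v i)) -enorm_sqr; ring.
have Ti i : T i = 0.
  move/eqP: sT; rewrite psumr_eq0 => [/allP/(_ i (mem_index_enum _))/eqP//|j _].
  by have [] := T0 j.
have ww : w = w'.
  apply/eqP; rewrite -subr_eq0 -dotpp_eq0 -(isotropic_dotp iso) big1// => i _.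
  have [->|vi] := eqVneq (v i) 0; first by rewrite dotp0r mul0r.
  by rewrite dotp_directionr ((T0 i).2 (Ti i) vi) mulr0 mul0r.
apply/ffunP => i; apply/val_inj; apply: (@in_cell_inj m _ _ (dotp w (u i))); first exact: kw.
rewrite ww; exact: kw'.
Qed.

Lemma rmfun_dotp y : rmfun (fun w : 'rV[R]_n => dotp w y : RT).
Proof. exact: (rmfun_continuous (@continuous_dotpr R n y)). Qed.

Lemma rmset_cell m (k : cells m) : rmset (cell k).
Proof.
rewrite (_ : cell k = \bigcap_(i in [set: 'I_N]) [set w | in_cell m (k i) (dotp w (u i))]); last first.
  by apply/seteqP; split => [w h i _|w h i]; apply: h.
rewrite /rmset preimage_bigcap; apply: fin_bigcap_measurable; first exact: finite_finset.
move=> i _; apply: (@rmset_preimage _ _ _ _ (fun w => dotp w (u i) : RT) `[grid m (k i), grid m (k i).+1[%classic).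
  exact: rmfun_dotp.
exact: measurable_itv.
Qed.

(** The function F composed with the piecewise affine transport, times the
    Jacobian. *)
Let pl m (w : 'rV[R]_n) : \bar R := (\sum_(k : cells m) (\1_(cell k) w)%:E *
   ((\det (cell_op k))%:E * F (w *m cell_op k + cell_shift k)))%E.

(** The change of variables on each cell; the images of the cells are disjoint
    by [cell_map_inj]. *)
Lemma pl_le m : (Lint (pl m) <= Lint F)%E.
Proof.
have mI (k : cells m) : rmfun (fun w => (\1_(cell k) w)%:E : \bar R).
  by apply: rmfun_EFin; apply: rmfun_indic; exact: rmset_cell.
rewrite /pl Lint_sum; last 2 first.
- move=> k; apply: emeasurable_funM; first exact: mI.
  by apply: emeasurable_funM => //; exact: (rmfun_affine (cell_op k) (cell_shift k) mF).
- move=> k w; rewrite mule_ge0// ?lee_fin ?indicE ?ler0n// mule_ge0// lee_fin.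
  exact/ltW/cell_op_det.
pose back (k : cells m) y := (y - cell_shift k) *m invmx (cell_op k).
pose G (k : cells m) y : \bar R := ((\1_(cell k) (back k y))%:E * F y)%E.
have opu (k : cells m) : cell_op k \in unitmx.
  by rewrite unitmxE unitfE gt_eqF ?cell_op_det.
have backK (k : cells m) y : back k y *m cell_op k + cell_shift k = y.
  by rewrite /back mulmxKV// subrK.
have mG k : rmfun (G k).
  apply: emeasurable_funM => //.
  have := rmfun_affine (invmx (cell_op k)) (- cell_shift k *m invmx (cell_op k)) (mI k).
  rewrite /rmfun; congr measurable_fun; apply/funext => t /=.
  by rewrite /back mulmxBl mulNmx.
have G0 k y : (0 <= G k y)%E by rewrite mule_ge0// lee_fin indicE ler0n.
rewrite (eq_bigr (fun k => Lint (G k))); last first.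
  move=> k _; rewrite (affine_change_unit (cell_shift k) (opu k) (mG k) (G0 k)).
  rewrite gtr0_norm ?cell_op_det// -Lint_scale; last 3 first.
  - exact/ltW/cell_op_det.
  - exact: (rmfun_affine (cell_op k) (cell_shift k) (mG k)).
  - by move=> w; exact: G0.
  apply: Lint_eq => w; rewrite muleCA; congr (_ * _)%E.
  by rewrite /G /back addrK mulmxK.
rewrite -Lint_sum//; apply: Lint_le => //.
- by apply: emeasurable_sum => k; exact: mG.
- by move=> y; apply: sume_ge0 => k _; exact: G0.
move=> y.
have [[k ky]|nk] := pselect (exists k : cells m, cell k (back k y)); last first.
  rewrite big1 ?F0// => k _; rewrite /G indicE memNset ?mul0e// => ky.
  by apply: nk; exists k.
rewrite (bigD1 k)//= big1 ?adde0.
  by rewrite /G indicE mem_set// mul1e.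
move=> k' k'k; rewrite /G indicE memNset ?mul0e// => ky'.
move/eqP: k'k; apply; exact: (cell_map_inj ky' ky (etrans (backK k' y) (esym (backK k y)))).
Qed.

(** The Jacobian of w |-> \sum_i |v i| S (w . u i) v i times the lower bound for
    F at the image of w. *)
Definition jac (w : 'rV[R]_n) : R :=
  expR (- \sum_i c i * S (dotp w (u i)) ^+ 2) *
  \det (op (fun i => expR (log_slope (dotp w (u i))))).

(** The lower bound for [pl m] that FE provides; it converges to [jac] as m
    grows. *)
Let hm m (w : 'rV[R]_n) : R := \sum_(k : cells m) \1_(cell k) w *
   (\det (cell_op k) * expR (- \sum_i c i * chord m (k i) (dotp w (u i)) ^+ 2)).

Lemma hm_le_pl m w : ((hm m w)%:E <= pl m w)%E.
Proof.
rewrite /hm /pl -sumEFin; apply: lee_sum => k _; rewrite EFinM.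
rewrite indicE; have [kw|] := boolP (w \in cell k); last by rewrite !mul0e.
rewrite !mul1e EFinM lee_wpmul2l ?lee_fin ?(ltW (cell_op_det k))//.
move: kw; rewrite inE => kw.
rewrite cell_map; apply: le_trans (FE _); last first.
  by move=> i; rewrite mulr_ge0 ?enorm_ge0// ltW// chord_gt0.
rewrite lee_fin ler_expR lerN2 le_eqVlt; apply/orP; left; apply/eqP.
by apply: eq_bigr => i _; rewrite exprMn enorm_sqr.
Qed.

Lemma hm_ge0 m w : 0 <= hm m w.
Proof.
apply: sumr_ge0 => k _; rewrite mulr_ge0// ?indicE// mulr_ge0 ?expR_ge0// ltW//.
exact: cell_op_det.
Qed.

Lemma rmfun_hm m : rmfun (hm m : _ -> RT).
Proof.
apply: measurable_sum => k; apply: measurable_funM.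
  apply: rmfun_indic; exact: rmset_cell.
apply: measurable_funM; first exact: measurable_cst.
apply: measurableT_comp => //; apply: measurableT_comp => //.
apply: measurable_sum => i; apply: measurable_funM => //.
apply: measurable_funX; apply: measurable_funD => //; apply: measurable_funM => //.
by apply: measurable_funB => //; exact: rmfun_dotp.
Qed.

Lemma cvg_det (T : Type) (G : set_system T) (FG : Filter G) (s : 'I_N -> T -> R) (l : 'I_N -> R) :
  (forall i, s i x @[x --> G] --> l i) ->
  \det (op (s^~ x)) @[x --> G] --> \det (op l).
Proof.
move=> sl; rewrite /determinant; apply: cvg_sumf => p _.
apply: cvgM; first exact: cvg_cst.
apply: cvg_prodf => a _.
under eq_fun do rewrite summxE; rewrite summxE; apply: cvg_sumf => i _.
by under eq_fun do rewrite mxE; rewrite mxE; apply: cvgM; [exact: sl|exact: cvg_cst].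
Qed.

Lemma cvg_hm w : hm m w @[m --> \oo] --> jac w.
Proof.
pose h m := expR (- \sum_i c i * chord m (cell_of m (dotp w (u i))) (dotp w (u i)) ^+ 2) *
  \det (op (fun i => grid_slope m (cell_of m (dotp w (u i))))).
have : h m @[m --> \oo] --> jac w.
  apply: cvgM.
    apply: (@continuous_cvg _ _ _ _ _ _ expR); first exact: continuous_expR.
    apply: cvgN; apply: cvg_sumf => i _; apply: cvgM; first exact: cvg_cst.
    apply: (@continuous_cvg _ _ _ _ _ _ (fun z : R => z ^+ 2)); first exact: exprn_continuous.
    exact: cvg_chord.
  by apply: (@cvg_det _ _ _ (fun i m => grid_slope m (cell_of m (dotp w (u i))))) => i; exact: cvg_grid_slope.
apply: cvg_trans; apply: near_eq_cvg.
have : \forall m \near \oo, forall i : 'I_N, `|dotp w (u i)| < m.+1%:R.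
  apply: filter_forall => i; exists (Num.trunc `|dotp w (u i)|) => // m /= tm.
  by apply: lt_le_trans (truncnS_gt _) _; rewrite ler_nat ltnS.
apply: filterS => m wm.
pose k : cells m := [ffun i => Ordinal (cell_ofP (wm i)).2].
have kw : cell k w by move=> i; rewrite ffunE /=; exact: (cell_ofP (wm i)).1.
rewrite /hm (bigD1 k)//= [X in _ = _ + X]big1 ?addr0.
  rewrite indicE mem_set// mul1r [RHS]mulrC /h /cell_op /=; congr (_ * _).
    by congr (expR (- _)); apply: eq_bigr => i _; rewrite ffunE.
  by congr (\det _); apply: eq_bigr => i _; rewrite ffunE.
move=> k' k'k; rewrite indicE memNset ?mul0r// => kw'.
move/eqP: k'k; apply; apply/ffunP => i; apply/val_inj.
exact: (in_cell_inj (kw' i) (kw i)).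
Qed.

(** Fatou's lemma along m. *)
Lemma Lint_jac_le : (Lint (fun w => (jac w)%:E) <= Lint F)%E.
Proof.
have E w : limn_einf (fun m => (hm m w)%:E) = (jac w)%:E.
  have /cvg_limn_einf_sup[] // : (hm m w)%:E @[m --> \oo] --> (jac w)%:E.
  by apply: cvg_EFin; [exact: nearW|exact: cvg_hm].
under Lint_eq do rewrite -E.
apply: le_trans (@fatou _ _ _ (leb R n) setT measurableT (fun m t => (hm m (row_of t))%:E) _ _) _.
- by move=> m; exact: (rmfun_EFin (rmfun_hm m)).
- by move=> m t _; rewrite lee_fin hm_ge0.
rewrite limn_einf_lim; apply: lime_le; first exact: is_cvg_einfs.
apply: nearW => m; apply: (@le_trans _ _ (Lint (fun w => (hm m w)%:E))).
  by apply: ereal_inf_lbound; exists m => //=.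
apply: le_trans (pl_le m); apply: Lint_le.
- exact: rmfun_EFin (rmfun_hm m).
- apply: emeasurable_sum => k; apply: emeasurable_funM.
    by apply: (rmfun_EFin (rmfun_indic _)); exact: rmset_cell.
  by apply: emeasurable_funM => //; exact: (rmfun_affine (cell_op k) (cell_shift k) mF).
- by move=> w; rewrite lee_fin hm_ge0.
- exact: hm_le_pl.
Qed.
End Bound.
End PiecewiseLinear.

(** * The quantitative integral inequality for frames *)

Lemma indic_ge0 (T : Type) (R : realType) (A : set T) x : 0 <= \1_A x :> R.
Proof. by rewrite indicE ler0n. Qed.

Section SecondMoment.
Variables (R : realType) (n : nat).
Hypothesis n0 : (0 < n)%N.
Local Notation RT := (measurableTypeR R).
Implicit Types w z : 'rV[R]_n.

Definition cball (r : R) : set 'rV[R]_n := [set w | dotp w w <= r ^+ 2].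

Lemma rmset_cball r : rmset (cball r).
Proof.
apply: rmset_closed; rewrite (_ : cball r = (fun v => dotp v v) @^-1` [set x | x <= r ^+ 2])//.
by apply: closed_comp => [x _|]; [exact: continuous_dotpp|exact: closed_le].
Qed.

Lemma cballE r : 0 < r -> cball r = [set v *m (r%:M : 'M[R]_n) | v in @ball1 R n].
Proof.
move=> r0; apply/seteqP; split => [w|_ [v v1 <-]].
  rewrite /cball /= => wr; exists (r^-1 *: w); last first.
    by rewrite mul_mx_scalar scalerA divff ?scale1r ?gt_eqF.
  rewrite /ball1 /= dotpZl dotpZr mulrA -expr2 exprVn mulrC ler_pdivrMr ?exprn_gt0//.
  by rewrite mul1r.
rewrite /cball /= mul_mx_scalar dotpZl dotpZr mulrA -expr2 ler_piMr//.
exact: sqr_ge0.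
Qed.

Lemma volume_cball r : 0 < r -> volume (cball r) = ((r ^+ n)%:E * volume (@ball1 R n))%E.
Proof.
move=> r0; rewrite (cballE r0) volume_linear; last exact: rmset_ball1.
  by rewrite det_scalar ger0_norm// exprn_ge0// ltW.
by rewrite unitmxE det_scalar unitrX// unitfE gt_eqF.
Qed.

(** The volumes of the two balls are in the ratio 2^n > 1. *)
Lemma volume_annulus r : 0 < r -> (0 < volume (cball r `\` cball (r / 2)))%E.
Proof.
move=> r0; have r20 : 0 < r / 2 by rewrite divr_gt0.
have [b b0 bE] := @volume_ball1_fin R n.
have ma : rmset (cball r `\` cball (r / 2)) by apply: measurableD; exact: rmset_cball.
have := volume_cball r0; have := volume_cball r20; rewrite bE => h2 h1.
rewrite lt_neqAle volume_ge0 andbT; apply/eqP => v0.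
have : volume (cball r) = (volume (cball r `\` cball (r / 2)) + volume (cball (r / 2)))%E.
  rewrite !volumeE -measureU; last 3 first.
  - exact: ma.
  - exact: rmset_cball.
  - by rewrite -preimage_setI setDE -setIA setICl setI0 preimage_set0.
  congr (leb R n _); rewrite -preimage_setU setUC setDUK// => w; rewrite /cball /= => h.
  apply: le_trans h _; rewrite ler_pXn2r// ?nnegrE ?(ltW r0) ?(ltW r20)//.
  by rewrite ler_pdivrMr// ler_pMr// ler1n.
rewrite -v0 add0e h1 h2 -!EFinM => -[]; have bn0 : b != 0 by rewrite gt_eqF.
move=> /(mulIf bn0) /eqP; rewrite gt_eqF// ltrXn2r ?nnegrE ?(ltW r0) ?(ltW r20) -?lt0n//.
by rewrite ltr_pdivrMr// ltr_pMr// ltr1n.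
Qed.

Variable r : R.
Hypothesis r0 : 0 < r.

Let f z w : R := \1_(cball r) w * gaussian w * dotp w z ^+ 2.

Let f0 z w : 0 <= f z w.
Proof. exact: (mulr_ge0 (mulr_ge0 (indic_ge0 _ _ _) (gaussian_ge0 _)) (sqr_ge0 _)). Qed.

Let mf z : rmfun (f z : _ -> RT).
Proof.
apply: measurable_funM; last by apply: measurable_funX; exact: rmfun_dotp.
by apply: measurable_funM; [apply: rmfun_indic; exact: rmset_cball|exact: rmfun_gaussian].
Qed.

Let A z := Lint (fun w => (f z w)%:E).

Let A_rot z y : dotp z z = dotp y y -> A z = A y.
Proof.
move=> zy; have [Q QQ zQ] := householder zy.
have QtQ : Q^T *m Q^T^T = 1%:M by rewrite trmxK; apply: mulmx1C.
have Qu : Q^T \in unitmx by apply: (mulmx1_unit QtQ).1.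
rewrite /A (affine_change_unit 0 Qu (rmfun_EFin (mf z))); last by move=> w; rewrite lee_fin f0.
rewrite (orthogonal_det QtQ) mul1e; apply: Lint_eq => w.
rewrite addr0 /f /gaussian (orthogonal_dotp _ _ QtQ) dotp_mulmx trmxK zQ.
have cE : (w *m Q^T \in cball r) = (w \in cball r).
  by apply/idP/idP; rewrite !inE /cball /= (orthogonal_dotp _ _ QtQ).
by rewrite !indicE cE.
Qed.

Let e0 : 'rV[R]_n := delta_mx 0 (Ordinal n0).

Let A_scale z : A z = ((dotp z z)%:E * A e0)%E.
Proof.
rewrite (@A_rot z (enorm z *: e0)); last first.
  by rewrite dotpZl dotpZr dotp_delta mxE !eqxx mulr1 -expr2 enorm_sqr.
rewrite /A -Lint_scale ?dotpp_ge0//; last 2 first.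
- exact: rmfun_EFin (mf e0).
- by move=> w; rewrite lee_fin f0.
apply: Lint_eq => w; rewrite -EFinM; congr EFin.
by rewrite /f dotpZr exprMn enorm_sqr; ring.
Qed.

(** By rotation invariance the quadratic form on the right is a multiple of
    |z|^2, and its trace is positive because the annulus V has positive volume.
    *)
Lemma second_moment : exists2 a : R, 0 < a & forall z,
  ((a * dotp z z)%:E <= Lint (fun w => (\1_(cball r) w * gaussian w * dotp w z ^+ 2)%:E))%E.
Proof.
set V := cball r `\` cball (r / 2).
have mV : rmset V by apply: measurableD; exact: rmset_cball.
pose K := (r / 2) ^+ 2 * expR (- r ^+ 2).
have K0 : 0 < K by rewrite mulr_gt0 ?exprn_gt0 ?divr_gt0 ?expR_gt0.
have sumA : (K%:E * volume V <= n%:R%:E * A e0)%E.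
  have -> : (n%:R%:E * A e0 = \sum_(i < n) A (delta_mx 0 i)%R)%E.
    rewrite (eq_bigr (fun=> A e0)); last first.
      by move=> i _; apply: A_rot; rewrite !dotp_delta !mxE !eqxx.
    have -> : (n%:R%:E = \sum_(i < n) 1%:E :> \bar R)%E.
      by rewrite sumEFin sumr_const card_ord.
    by rewrite ge0_sume_distrl//; apply: eq_bigr => i _; rewrite mul1e.
  rewrite /A -Lint_sum; last 2 first.
  - by move=> i; exact: rmfun_EFin (mf _).
  - by move=> i w; rewrite lee_fin f0.
  rewrite (volume_Lint mV) -Lint_scale ?(ltW K0)//; last exact: rmfun_EFin (rmfun_indic mV).
  apply: Lint_le.
  - apply: emeasurable_funM; first exact: measurable_cst.
    exact: rmfun_EFin (rmfun_indic mV).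
  - by apply: emeasurable_sum => i; exact: rmfun_EFin (mf _).
  - by move=> w; rewrite mule_ge0// ?lee_fin ?(ltW K0)// indicE.
  move=> w; rewrite sumEFin -EFinM lee_fin /f -mulr_sumr.
  have -> : \sum_(i < n) dotp w (delta_mx 0 i) ^+ 2 = dotp w w.
    by apply: eq_bigr => i _; rewrite dotp_delta expr2.
  rewrite (indicE _ V); have [|_] := boolP (w \in V); last first.
    by rewrite mulr0 (mulr_ge0 (mulr_ge0 (indic_ge0 _ _ _) (gaussian_ge0 _)) (dotpp_ge0 _)).
  rewrite inE => -[wr wr2]; rewrite indicE mem_set// mulr1 mul1r /K mulrC.
  rewrite ler_pM ?expR_ge0 ?sqr_ge0//.
    by rewrite ler_expR lerN2.
  by rewrite ltW// ltNge; apply/negP.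
have Ve := volume_annulus r0; rewrite -/V in Ve.
have [k k0 kV] : exists2 k : R, 0 < k & (k%:E <= volume V)%E.
  move: Ve; case: (volume V) => [k| |]//=; first by rewrite lte_fin => k0; exists k.
  by exists 1; rewrite // leey.
have nn : 0 < n%:R :> R by rewrite ltr0n.
exists (K * k / n%:R); first exact: divr_gt0 (mulr_gt0 K0 k0) nn.
move=> z; rewrite -/(f z) -/(A z) A_scale mulrC EFinM lee_wpmul2l ?lee_fin ?dotpp_ge0//.
rewrite mulrC EFinM lee_pdivrMl//; apply: le_trans sumA.
by rewrite EFinM lee_wpmul2l ?lee_fin ?(ltW K0).
Qed.
End SecondMoment.

Section DiscreteBound.
Variables (R : realType) (n : nat).
Local Notation RT := (measurableTypeR R).

Section Jac.
Variables (N : nat) (v : 'I_N -> 'rV[R]_n).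
Hypothesis iso : isotropic v.
Local Notation u i := (direction (v i)).
Local Notation c i := (dotp (v i) (v i)).

Lemma sum_dir_sqr w : \sum_i c i * dotp w (u i) ^+ 2 = dotp w w.
Proof.
rewrite -(isotropic_dotp iso); apply: eq_bigr => i _.
by rewrite -expr2 dotp_dir_sqr.
Qed.

Lemma rmfun_jac : rmfun (jac v : _ -> RT).
Proof.
apply: measurable_funM.
  apply: measurableT_comp => //; apply: measurableT_comp => //.
  apply: measurable_sum => i; apply: measurable_funM => //; apply: measurable_funX.
  apply: (@rmfun_continuous R n (fun w => half_transport (dotp w (u i)))) => w.
  exact: (@continuous_comp _ _ _ _ _ w (@continuous_dotpr R n (u i) w) (@half_transport_continuous R _)).
apply: (@rmfun_continuous R n (fun w => \det (\sum_i expR (log_slope (dotp w (u i))) *: ((v i)^T *m v i)))) => w.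
apply: (@cvg_det _ _ _ v _ (nbhs w) _ (fun i w => expR (log_slope (dotp w (u i))))) => i.
apply: (@continuous_cvg _ _ _ _ _ _ expR); first exact: continuous_expR.
apply: (@continuous_cvg _ _ _ _ _ _ (@log_slope R)); first exact: log_slope_continuous.
exact: continuous_dotpr.
Qed.

(** The density equation of S, raised to the powers c i, which add up to n, and
    multiplied over i. *)
Lemma exponent_transport w :
  expR (- \sum_i c i * half_transport (dotp w (u i)) ^+ 2) *
  expR (\sum_i c i * log_slope (dotp w (u i))) = gaussian w / 2 ^+ n.
Proof.
rewrite -expRD /gaussian -(sum_dir_sqr w).
have -> : - \sum_i c i * half_transport (dotp w (u i)) ^+ 2 + \sum_i c i * log_slope (dotp w (u i)) =
   - \sum_i c i * dotp w (u i) ^+ 2 + - (ln 2 *+ n).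
  rewrite -(mulr_natl (ln 2)) -(isotropic_trace iso) mulr_suml -!sumrN -!big_split.
  by apply: eq_bigr => i _; rewrite /= /log_slope; ring.
by rewrite expRD; congr (_ * _); rewrite expRN -(mulr_natl (ln 2)) expRM_natl lnK// posrE.
Qed.

Lemma jac_ge w : gaussian w / 2 ^+ n <= jac v w.
Proof. by rewrite -exponent_transport ler_wpM2l ?expR_ge0// frame_det_ge. Qed.

Definition spread w := \sum_i \sum_l dotp (v i) (v l) ^+ 2 * dotp w (u i - u l) ^+ 2.

(** On a small ball the numbers w . u i lie where [log_slope_local] bounds the
    differences in [frame_det_ge_var] both above and below. *)
Lemma jac_ge_spread (r m : R) w : 0 <= r -> 0 <= m ->
  (forall a b : R, `|a| <= r -> `|b| <= r ->
   `|log_slope a - log_slope b| <= 2 /\ m * `|a - b| <= `|log_slope a - log_slope b| ) ->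
  cball r w ->
  gaussian w / 2 ^+ n * (1 + m ^+ 2 * spread w / (8 * n%:R)) <= jac v w.
Proof.
move=> r0 m0 hloc wr.
have tr i : `|dotp w (u i)| <= r.
  rewrite -(@ler_pXn2r _ 2) ?nnegrE// real_normK ?num_real//.
  apply: le_trans wr; apply: le_trans (dotp_cauchy _ _) _.
  by rewrite ler_piMr ?dotpp_ge0 ?direction_le1.
rewrite -exponent_transport -mulrA ler_wpM2l ?expR_ge0//.
apply: le_trans (frame_det_ge_var iso _); last first.
  by move=> i l; have [] := hloc _ _ (tr i) (tr l).
rewrite ler_wpM2l ?expR_ge0// lerD2l ler_wpM2r ?invr_ge0 ?mulr_ge0//.
rewrite /spread mulr_sumr; apply: ler_sum => i _; rewrite mulr_sumr; apply: ler_sum => l _.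
rewrite mulrCA ler_wpM2l ?sqr_ge0// dotpBr -exprMn -[leRHS]real_normK ?num_real//.
rewrite -[leLHS]real_normK ?num_real// ler_pXn2r ?nnegrE// normrM (ger0_norm m0).
by have [] := hloc _ _ (tr i) (tr l).
Qed.
End Jac.

(** Integration of [jac_ge], and of the stronger [jac_ge_spread] on a small
    ball, where [second_moment] turns the spread into the total misfit. The
    constant depends on n only. *)
Lemma frame_integral_ge : exists2 k : R, 0 < k &
  forall (N : nat) (v : 'I_N -> 'rV[R]_n) (F : 'rV[R]_n -> \bar R), isotropic v ->
  rmfun F -> (forall y, (0 <= F y)%E) ->
  (forall f : 'I_N -> R, (forall i, 0 <= f i) ->
    ((expR (- \sum_i f i ^+ 2))%:E <= F (\sum_i f i *: v i)%R)%E) ->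
  ((Num.sqrt pi ^+ n / 2 ^+ n + k * total_misfit v)%:E <= Lint F)%E.
Proof.
have t0 : 0 < 2 ^+ n :> R by rewrite exprn_gt0.
have [n0|n0] := posnP n.
  exists 1 => // N v F iso mF F0 FE.
  have noord (k : 'I_n) : False by have := leq_trans (ltn_ord k) (eq_leq n0).
  have -> : total_misfit v = 0.
    apply: big1 => i _; apply: big1 => l _.
    by rewrite {1}/dotp big1 ?expr0n ?mul0r// => k; case: (noord k).
  rewrite mulr0 addr0; apply: le_trans (Lint_jac_le iso mF F0 FE).
  rewrite mulrC EFinM -Lint_gaussian -Lint_scale ?invr_ge0 ?(ltW t0)//; last 2 first.
  - exact: rmfun_EFin (@rmfun_gaussian R n).
  - by move=> w; rewrite lee_fin gaussian_ge0.
  apply: Lint_le.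
  - by apply: emeasurable_funM; [exact: measurable_cst|exact: rmfun_EFin (@rmfun_gaussian R n)].
  - exact: rmfun_EFin (rmfun_jac v).
  - by move=> w; rewrite mule_ge0// lee_fin ?gaussian_ge0// invr_ge0 ltW.
  - by move=> w; rewrite -EFinM lee_fin mulrC jac_ge.
have [r [m [r0 m0 hloc]]] := @log_slope_local R.
have [a a0 aP] := second_moment n0 r0.
pose q : R := m ^+ 2 / (8 * n%:R).
have q0 : 0 < q by rewrite divr_gt0 ?exprn_gt0// mulr_gt0// ltr0n.
have t1 : 0 < (2 ^+ n)^-1 :> R by rewrite invr_gt0.
exists ((2 ^+ n)^-1 * q * a); first exact: mulr_gt0 (mulr_gt0 t1 q0) a0.
move=> N v F iso mF F0 FE; apply: le_trans (Lint_jac_le iso mF F0 FE).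
pose g (w : 'rV[R]_n) : R := \1_(cball r) w * gaussian w.
pose G i l w : R := \1_(cball r) w * gaussian w * dotp w (direction (v i) - direction (v l)) ^+ 2.
have mg : rmfun (fun w => (gaussian w)%:E) := rmfun_EFin (@rmfun_gaussian R n).
have mG i l : rmfun (fun w => (G i l w)%:E).
  apply: rmfun_EFin; apply: measurable_funM; last by apply: measurable_funX; exact: rmfun_dotp.
  by apply: measurable_funM; [apply: rmfun_indic; exact: rmset_cball|exact: rmfun_gaussian].
have G0 i l w : (0 <= (G i l w)%:E)%E.
  by rewrite lee_fin; exact: (mulr_ge0 (mulr_ge0 (indic_ge0 _ _ _) (gaussian_ge0 _)) (sqr_ge0 _)).
have g0 (w : 'rV[R]_n) : (0 <= (gaussian w)%:E)%E by rewrite lee_fin gaussian_ge0.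
pose H w : \bar R := (\sum_i \sum_l (dotp (v i) (v l) ^+ 2)%:E * (G i l w)%:E)%E.
have mH : rmfun H.
  apply: emeasurable_sum => i; apply: emeasurable_sum => l.
  by apply: emeasurable_funM; [exact: measurable_cst|exact: mG].
have H0 w : (0 <= H w)%E.
  by apply: sume_ge0 => i _; apply: sume_ge0 => l _; rewrite mule_ge0// lee_fin sqr_ge0.
have mqH : rmfun (fun w => q%:E * H w)%E.
  by apply: emeasurable_funM; [exact: measurable_cst|exact: mH].
have qH0 w : (0 <= q%:E * H w)%E by rewrite mule_ge0// lee_fin ltW.
have mS : rmfun (fun w => (gaussian w)%:E + q%:E * H w)%E by apply: emeasurable_funD.
have LH : ((a * total_misfit v)%:E <= Lint H)%E.
  rewrite Lint_sum; last 2 first.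
  - move=> i; apply: emeasurable_sum => l.
    by apply: emeasurable_funM; [exact: measurable_cst|exact: mG].
  - by move=> i w; apply: sume_ge0 => l _; rewrite mule_ge0// lee_fin sqr_ge0.
  rewrite /total_misfit mulr_sumr -sumEFin; apply: lee_sum => i _.
  rewrite Lint_sum; last 2 first.
  - by move=> l; apply: emeasurable_funM; [exact: measurable_cst|exact: mG].
  - by move=> l w; rewrite mule_ge0// lee_fin sqr_ge0.
  rewrite mulr_sumr -sumEFin; apply: lee_sum => l _.
  rewrite Lint_scale ?sqr_ge0//.
  by rewrite mulrCA EFinM lee_wpmul2l ?lee_fin ?sqr_ge0//; exact: aP.
apply: (@le_trans _ _ (Lint (fun w => ((2 ^+ n)^-1)%:E * ((gaussian w)%:E + q%:E * H w)))%E).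
  rewrite Lint_scale ?invr_ge0 ?(ltW t0)//; last by move=> w; rewrite adde_ge0.
  rewrite Lint_add// Lint_gaussian Lint_scale ?(ltW q0)//.
  rewrite (_ : _ + _ = (2 ^+ n)^-1 * (Num.sqrt pi ^+ n + q * (a * total_misfit v))); last by ring.
  rewrite EFinM lee_wpmul2l ?lee_fin ?invr_ge0 ?(ltW t0)//.
  by rewrite EFinD leeD2l// EFinM lee_wpmul2l// lee_fin (ltW q0).
apply: Lint_le.
- by apply: emeasurable_funM; [exact: measurable_cst|exact: mS].
- exact: rmfun_EFin (rmfun_jac v).
- by move=> w; rewrite mule_ge0 ?adde_ge0// lee_fin invr_ge0 ltW.
move=> w.
have HE : H w = (g w * spread v w)%:E.
  rewrite /H /spread mulr_sumr -sumEFin; apply: eq_bigr => i _.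
  rewrite mulr_sumr -sumEFin; apply: eq_bigr => l _; rewrite -EFinM; congr EFin.
  by rewrite /G /g; ring.
rewrite HE -(EFinM q) -EFinD -EFinM lee_fin /g indicE.
have [|_] := boolP (w \in cball r); last first.
  by rewrite !mul0r mulr0 addr0 mulrC jac_ge.
rewrite inE => wr; apply: le_trans (jac_ge_spread iso (ltW r0) (ltW m0) hloc wr).
by apply: eq_ler; rewrite /q (_ : true%:R = 1 :> R)//; field; rewrite pnatr_eq0 -lt0n n0 gt_eqF//.
Qed.
End DiscreteBound.

(** * Convex bodies and support functions *)

Section ConvexBodies.
Variables (R : realType) (n : nat).
Implicit Types (x y z k : 'rV[R]_n) (K L M Z : set 'rV[R]_n).

Lemma convex_setP K : convex_set K <->
  forall x y (t : R), K x -> K y -> 0 <= t <= 1 -> K (t *: x + (1 - t) *: y).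
Proof.
split=> [cK x y t Kx Ky /andP[t0 t1]|cK x y t].
  have := cK x y (Itv01 t0 t1); rewrite !inE => /(_ Kx Ky).
  by [].
rewrite !inE => Kx Ky; have := cK x y (t%:num) Kx Ky.
by rewrite ge0 le1 => /(_ isT).
Qed.

Lemma continuous_dotpl y : continuous (dotp y).
Proof.
rewrite (_ : dotp y = fun x => dotp x y); first exact: continuous_dotpr.
by apply/funext => x; exact: dotpC.
Qed.

Lemma dotp_subZ x y (t : R) :
  dotp (x - t *: y) (x - t *: y) = dotp x x - 2 * t * dotp x y + t ^+ 2 * dotp y y.
Proof. by rewrite !(dotpBl, dotpBr, dotpZl, dotpZr) (dotpC y x); ring. Qed.

Lemma support_fun_eq K x s : (forall k, K k -> dotp x k <= s) ->
  (exists2 k, K k & dotp x k = s) -> support_fun K x = s.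
Proof.
move=> ub [k Kk ks]; apply/eqP; rewrite eq_le; apply/andP; split.
  by apply: ge_sup; [exists s; exists k|move=> _ [l Kl <-]; exact: ub].
apply: ub_le_sup; last by exists k.
by exists s => _ [l Kl <-]; exact: ub.
Qed.

Lemma body_attained K x : convex_body K -> exists k, [/\ K k, dotp x k = support_fun K x &
  forall l, K l -> dotp x l <= dotp x k].
Proof.
move=> [K0 cK _].
have [|k kK kmax] := @compact_EVT_max _ R (dotp x) K K0 cK.
  by apply: continuous_subspaceT; exact: continuous_dotpl.
rewrite inE in kK; have h l : K l -> dotp x l <= dotp x k by move=> Kl; apply: kmax; rewrite inE.
by exists k; split => //; apply/esym/support_fun_eq => //; exists k.
Qed.

Lemma support_fun_ge K x k : convex_body K -> K k -> dotp x k <= support_fun K x.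
Proof. by move=> bK Kk; have [l [_ <- lmax]] := body_attained x bK; exact: lmax. Qed.

Lemma support_fun_le K x s : convex_body K -> (forall k, K k -> dotp x k <= s) -> support_fun K x <= s.
Proof. by move=> bK h; have [k [Kk <- _]] := body_attained x bK; exact: h. Qed.

Lemma support_fun_ge0 K x : convex_body K -> K 0 -> 0 <= support_fun K x.
Proof. by move=> bK K0; rewrite -(dotp0r x) support_fun_ge. Qed.

Lemma body_closed K : convex_body K -> closed K.
Proof. by move=> [_ cK _]; exact: (compact_closed (@norm_hausdorff _ _) cK). Qed.

(** The point p of K nearest to y satisfies (y - p) . (k - p) <= 0 on K, so the
    functional y - p bounds |y - p|^2 by 0. *)
Lemma separation K y : convex_body K -> (forall x, dotp x y <= support_fun K x) -> K y.
Proof.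
move=> bK hy; have [K0 cK vK] := bK.
have [|p pK pmin] := @compact_EVT_min _ R (fun k => dotp (y - k) (y - k)) K K0 cK.
  have cB i : continuous (fun k : 'rV[R]_n => (y - k) 0 i).
    rewrite (_ : (fun _ => _) = (fun k : 'rV[R]_n => y 0 i - k 0 i)); last by apply/funext => k; rewrite !mxE.
    by move=> x; apply: continuousB; [exact: cst_continuous|exact: coord_continuous].
  by apply: continuous_subspaceT; exact: continuous_dotp.
rewrite inE in pK.
have ob k : K k -> dotp (y - p) (k - p) <= 0.
  move=> Kk; rewrite leNgt; apply/negP => d0.
  set d := dotp _ _ in d0; set e := dotp (k - p) (k - p).
  have e0 : 0 <= e by exact: dotpp_ge0.
  (* Moving from p towards k by this proportion would decrease the distance to
     y. *)
  pose t := d / (d + e).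
  have de : 0 < d + e by rewrite ltr_pwDl.
  have t01 : 0 <= t <= 1 by rewrite divr_ge0 ?(ltW d0) ?(ltW de)//= ler_pdivrMr// mul1r lerDl.
  have := pmin (t *: k + (1 - t) *: p); rewrite inE => /(_ ((convex_setP K).1 vK _ _ _ Kk pK t01)).
  have -> : y - (t *: k + (1 - t) *: p) = (y - p) - t *: (k - p).
    by apply/rowP => i; rewrite !mxE; ring.
  rewrite dotp_subZ -/d -/e -subr_ge0.
  rewrite (_ : _ - _ = - (d ^+ 2 * (2 * d + e) / (d + e) ^+ 2)); last first.
    by rewrite /t; field; rewrite gt_eqF.
  rewrite oppr_ge0 leNgt divr_gt0 ?exprn_gt0// mulr_gt0 ?exprn_gt0//.
  by rewrite ltr_pwDl// mulr_gt0.
have hp : support_fun K (y - p) <= dotp (y - p) p.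
  apply: support_fun_le => // k Kk; have := ob k Kk; rewrite dotpBr; lra.
have : dotp (y - p) (y - p) <= 0.
  rewrite dotpBr subr_le0; exact: le_trans (hy _) hp.
move=> d0; have /eqP : dotp (y - p) (y - p) = 0 by apply/eqP; rewrite eq_le d0 dotpp_ge0.
by rewrite dotpp_eq0 subr_eq0 => /eqP ->.
Qed.

Lemma body_sub K L : convex_body L -> convex_body K ->
  (forall x, support_fun K x <= support_fun L x) -> K `<=` L.
Proof.
move=> bL bK KL k Kk; apply: separation => // x.
by apply: le_trans (KL x); exact: support_fun_ge.
Qed.

Lemma body_unique K L : convex_body K -> convex_body L ->
  (forall x, support_fun K x = support_fun L x) -> K = L.
Proof.
by move=> bK bL KL; apply/seteqP; split; apply: body_sub => // x; rewrite KL.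
Qed.

Lemma bounded_coords K (B : R) : (forall k i, K k -> `|k 0 i| <= B) -> bounded_set K.
Proof.
move=> KB; exists `|B|; split; first exact: num_real.
move=> M BM k Kk; rewrite /= [`|k|]mx_normrE; apply: bigmax_le.
  by apply: le_trans (ltW BM).
move=> [i j] _ /=; rewrite (ord1 i).
by apply: le_trans (KB _ _ Kk) _; apply: le_trans (ler_norm _) (ltW BM).
Qed.

(** The intersection of the half-spaces prescribed by h; its support function is
    h exactly when h is sublinear. *)
Definition wulff (h : 'rV[R]_n -> R) : set 'rV[R]_n := [set y | forall x, dotp x y <= h x].

Lemma wulff_closed h : closed (wulff h).
Proof.
rewrite (_ : wulff h = \bigcap_x [set y | dotp x y <= h x]); last first.
  by apply/seteqP; split => [y yh x _|y yh x]; apply: yh.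
apply: closed_bigI => x _.
rewrite (_ : [set y | _] = dotp x @^-1` [set r | r <= h x])//.
by apply: closed_comp => [y _|]; [exact: continuous_dotpl|exact: closed_le].
Qed.

Lemma wulff_coord h y (i : 'I_n) : wulff h y ->
  `|y 0 i| <= h (delta_mx 0 i) + `|h (- delta_mx 0 i)| + `|h (delta_mx 0 i)|.
Proof.
move=> yh; have := yh (delta_mx 0 i); have := yh (- delta_mx 0 i).
rewrite dotpNl dotpC dotp_delta => h1 h2.
have := ler_norm (h (- delta_mx 0 i)); have := ler_norm (h (delta_mx 0 i)).
have := normr_ge0 (h (- delta_mx 0 i)); have := normr_ge0 (h (delta_mx 0 i)).
have := ler_norm (- h (delta_mx 0 i)); rewrite normrN.
by move=> *; rewrite ler_norml; apply/andP; split; lra.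
Qed.

Lemma wulff_body h : wulff h 0 -> convex_body (wulff h).
Proof.
move=> h0; split; first by exists 0.
  apply: bounded_closed_compact; last exact: wulff_closed.
  apply: (@bounded_coords _ (\sum_i (h (delta_mx 0 i) + `|h (- delta_mx 0 i)| + `|h (delta_mx 0 i)|))).
  move=> y i yh; apply: le_trans (wulff_coord i yh) _.
  rewrite (bigD1 i)//= lerDl; apply: sumr_ge0 => j _.
  by apply: le_trans (normr_ge0 _) (wulff_coord j yh).
apply/convex_setP => x y t hx hy /andP[t0 t1] z.
rewrite dotpDr !dotpZr (_ : h z = t * h z + (1 - t) * h z); last by ring.
by apply: lerD; rewrite ler_wpM2l// ?hx ?hy// subr_ge0.
Qed.

Lemma wulff_support h : (forall x, exists2 y, wulff h y & dotp x y = h x) ->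
  forall x, support_fun (wulff h) x = h x.
Proof. by move=> hy x; apply: support_fun_eq => // k; apply. Qed.

(** If k and l attain the support functions p and q of K and L at x, then (p k +
    q l) / h x attains h x; it lies in the intersection of half-spaces by the
    Cauchy-Schwarz inequality in the plane. *)
Lemma is_l2sum_ex K L : convex_body K -> convex_body L -> K 0 -> L 0 ->
  exists M, is_l2sum K L M.
Proof.
move=> bK bL K0 L0.
pose h x := Num.sqrt (support_fun K x ^+ 2 + support_fun L x ^+ 2).
have hK x := support_fun_ge0 x bK K0; have hL x := support_fun_ge0 x bL L0.
exists (wulff h); split.
  by apply: wulff_body => x; rewrite dotp0r sqrtr_ge0.
apply: wulff_support => x.
have [k [Kk kx _]] := body_attained x bK; have [l [Ll lx _]] := body_attained x bL.
set p := support_fun K x in kx; set q := support_fun L x in lx.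
have hx2 : h x ^+ 2 = p ^+ 2 + q ^+ 2 by rewrite sqr_sqrtr// addr_ge0 ?sqr_ge0.
have [h0|hn0] := eqVneq (h x) 0.
  exists 0; last by rewrite h0 dotp0r.
  by move=> z; rewrite dotp0r sqrtr_ge0.
exists ((p / h x) *: k + (q / h x) *: l); last first.
  rewrite dotpDr !dotpZr kx lx; apply: (mulIf hn0); rewrite -expr2 hx2; field.
  exact: hn0.
move=> z; rewrite dotpDr !dotpZr.
have hp : 0 < h x by rewrite lt_neqAle eq_sym hn0 sqrtr_ge0.
apply: (@le_trans _ _ (p / h x * support_fun K z + q / h x * support_fun L z)).
  apply: lerD; apply: ler_wpM2l.
  - by rewrite divr_ge0 ?(ltW hp)//; exact: hK.
  - exact: support_fun_ge.
  - by rewrite divr_ge0 ?(ltW hp)//; exact: hL.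
  - exact: support_fun_ge.
rewrite mulrAC [X in _ + X]mulrAC -mulrDl ler_pdivrMr//.
have p0 : 0 <= p := hK x; have q0 : 0 <= q := hL x.
have hKz := hK z; have hLz := hL z.
rewrite -(@ler_pXn2r _ 2) ?nnegrE ?addr_ge0 ?mulr_ge0 ?sqrtr_ge0//.
rewrite exprMn hx2 sqr_sqrtr ?addr_ge0 ?sqr_ge0//.
have := sqr_ge0 (p * support_fun L z - q * support_fun K z); nra.
Qed.

Lemma l2sumP K L : convex_body K -> convex_body L -> K 0 -> L 0 -> is_l2sum K L (l2sum K L).
Proof. by move=> bK bL K0 L0; apply: xgetPex; exact: is_l2sum_ex. Qed.

Lemma body_0 K : convex_body K -> (forall x, 0 <= support_fun K x) -> K 0.
Proof. by move=> bK h; apply: separation => // x; rewrite dotp0r. Qed.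

Lemma l2sum_body K L : convex_body K -> convex_body L -> K 0 -> L 0 ->
  [/\ convex_body (l2sum K L), l2sum K L 0 & forall x,
    support_fun (l2sum K L) x ^+ 2 = support_fun K x ^+ 2 + support_fun L x ^+ 2].
Proof.
move=> bK bL K0 L0; have [bM hM] := l2sumP bK bL K0 L0.
split => //; first by apply: body_0 => // x; rewrite hM sqrtr_ge0.
by move=> x; rewrite hM sqr_sqrtr// addr_ge0 ?sqr_ge0.
Qed.

Lemma set0_body : convex_body [set (0 : 'rV[R]_n)].
Proof.
split; [by exists 0|exact: compact_set1|].
by apply/convex_setP => x y t -> -> _; rewrite /= !scaler0 addr0.
Qed.

Lemma support_fun0 x : support_fun [set 0] x = 0.
Proof. by apply: support_fun_eq => [k ->|]; [rewrite dotp0r|exists 0; rewrite ?dotp0r]. Qed.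

Lemma l2sum_seqP m (K : 'I_m -> set 'rV[R]_n) :
  (forall i, convex_body (K i)) -> (forall i, K i 0) ->
  [/\ convex_body (l2sum_seq K), l2sum_seq K 0 & forall x,
    support_fun (l2sum_seq K) x ^+ 2 = \sum_i support_fun (K i) x ^+ 2].
Proof.
move=> bK K0.
suff H x : [/\ convex_body (l2sum_seq K), l2sum_seq K 0 &
    support_fun (l2sum_seq K) x ^+ 2 = \sum_i support_fun (K i) x ^+ 2].
  by split; [by have [] := H 0|by have [] := H 0|move=> x; have [] := H x].
rewrite /l2sum_seq.
apply: (big_ind2 (fun M s => [/\ convex_body M, M 0 & support_fun M x ^+ 2 = s])).
- by split; [exact: set0_body|by []|rewrite support_fun0 expr0n].
- move=> M s L t [bM M0 <-] [bL L0 <-].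
  by have [b1 b2 h] := l2sum_body bM bL M0 L0; split => //; rewrite h.
- by move=> i _; split => //; exact: bK.
Qed.

Lemma segment_body (a b : 'rV[R]_n) : convex_body (segment a b).
Proof.
split.
- by exists ((1 - 0) *: a + 0 *: b); exists 0 => //=; rewrite in_itv/= lexx ler01.
- apply: continuous_compact; last exact: segment_compact.
  apply: continuous_subspaceT => t; apply: cvgD; apply: cvgZr_tmp; last exact: cvg_id.
  by apply: cvgB; [exact: cvg_cst|exact: cvg_id].
- apply/convex_setP => _ _ t [r rI <-] [s sI <-] /andP[t0 t1].
  move: rI sI; rewrite /= !in_itv/= => /andP[r0 r1] /andP[s0 s1].
  exists (t * r + (1 - t) * s); last by apply/rowP => i; rewrite !mxE; ring.
  by rewrite /= in_itv/=; apply/andP; split; nra.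
Qed.

(** As 0 is on the segment, the scalar products of x with the end points do not
    have the same strict sign, and at most one of the positive parts is nonzero.
    *)
Lemma segment_support (a b : 'rV[R]_n) x : segment a b 0 ->
  support_fun (segment a b) x ^+ 2 = pos (dotp x a) ^+ 2 + pos (dotp x b) ^+ 2.
Proof.
move=> [t tI t0]; move: tI; rewrite /= in_itv/= => /andP[t00 t01].
have ha : segment a b a by exists 0; rewrite /= ?in_itv/= ?lexx ?ler01// subr0 scale1r scale0r addr0.
have hb : segment a b b by exists 1; rewrite /= ?in_itv/= ?lexx ?ler01// subrr scale1r scale0r add0r.
have e : (1 - t) * dotp x a + t * dotp x b = 0.
  by rewrite -!dotpZr -dotpDr t0 dotp0r.
have bS := segment_body a b.
have -> : support_fun (segment a b) x = Num.max (dotp x a) (dotp x b).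
  apply: support_fun_eq.
    move=> _ [s sI <-]; move: sI; rewrite /= in_itv/= => /andP[s0 s1].
    rewrite dotpDr !dotpZr; set p := dotp x a; set q := dotp x b.
    have pm : p <= Num.max p q by rewrite le_max lexx.
    have qm : q <= Num.max p q by rewrite le_max lexx orbT.
    nra.
  case: (leP (dotp x a) (dotp x b)) => _; by [exists b|exists a].
move: e; set p := dotp x a; set q := dotp x b => e.
rewrite /pos; case: (leP p q) => pq; case: (leP p 0) => p0; case: (leP q 0) => q0;
  rewrite ?expr0n ?addr0 ?add0r//=; nra.
Qed.
End ConvexBodies.

(** * Support functions and volumes of particular bodies *)

Section Zonoids.
Variables (R : realType) (n : nat).
Implicit Types (x y z k : 'rV[R]_n) (K L M Z : set 'rV[R]_n).

Lemma zonotope_frame K : asymmetric_l2_zonotope K ->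
  [/\ convex_body K, K 0 & exists (N : nat) (u : 'I_N -> 'rV[R]_n),
    forall x, support_fun K x ^+ 2 = frame_sqr u x].
Proof.
move=> [m [a [b [ab ->]]]].
have [bK K0 hK] := l2sum_seqP (fun i => segment_body (a i) (b i)) ab.
split => //; exists (m + m)%N, (fun i => match fintype.split i with inl j => a j | inr j => b j end) => x.
rewrite hK /frame_sqr big_split_ord /= -[RHS]big_split /=; apply: eq_bigr => i _.
rewrite segment_support//; congr (pos (dotp x _) ^+ 2 + pos (dotp x _) ^+ 2).
  by rewrite (unsplitK (inl i)).
by rewrite (unsplitK (inr i)).
Qed.

Lemma enormC x y : enorm (x - y) = enorm (y - x).
Proof. by rewrite -opprB /enorm dotpNl dotpNr opprK. Qed.

Definition within_dist K L (e : R) := forall x, K x -> exists2 y, L y & enorm (x - y) <= e.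

Lemma within_dist_ex K L : convex_body K -> L !=set0 -> exists2 e, 0 <= e & within_dist K L e.
Proof.
move=> bK [y Ly]; have [K0 cK _] := bK.
have cB i : continuous (fun k : 'rV[R]_n => (k - y) 0 i).
  rewrite (_ : (fun _ => _) = (fun k : 'rV[R]_n => k 0 i - y 0 i)); last by apply/funext => k; rewrite !mxE.
  by move=> x; apply: continuousB; [exact: coord_continuous|exact: cst_continuous].
have [|p pK pmax] := @compact_EVT_max _ R (fun k => dotp (k - y) (k - y)) K K0 cK.
  by apply: continuous_subspaceT; exact: continuous_dotp.
exists (enorm (p - y)); first exact: enorm_ge0.
move=> x Kx; exists y => //; rewrite -(@ler_pXn2r _ 2) ?nnegrE ?enorm_ge0// !enorm_sqr.
by apply: pmax; rewrite inE.
Qed.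

Lemma within_dist_support K L e x : convex_body K -> convex_body L -> within_dist K L e ->
  support_fun K x <= support_fun L x + e * enorm x.
Proof.
move=> bK bL KL; apply: support_fun_le => // k Kk; have [y Ly ky] := KL k Kk.
rewrite -[k](subrK y) addrC dotpDr lerD ?support_fun_ge//.
apply: le_trans (ler_norm _) _; apply: le_trans (dotp_le_enorm _ _) _.
by rewrite mulrC ler_wpM2r ?enorm_ge0.
Qed.

Lemma hausdorff_support K L e : convex_body K -> convex_body L -> hausdorff_dist K L < e ->
  forall x, `|support_fun K x - support_fun L x| <= e * enorm x.
Proof.
move=> bK bL; rewrite /hausdorff_dist; set E := (X in inf X) => Ee x.
have hE : has_inf E.
  split; last by exists 0 => d [].
  have [e1 e10 h1] := within_dist_ex bK (let: And3 h _ _ := bL in h).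
  have [e2 e20 h2] := within_dist_ex bL (let: And3 h _ _ := bK in h).
  exists (e1 + e2); split; first exact: addr_ge0.
    move=> y Ky; have [z Lz yz] := h1 y Ky; exists z => //; apply: le_trans yz _.
    by rewrite lerDl.
  move=> y Ly; have [z Kz yz] := h2 y Ly; exists z => //.
  by rewrite enormC (le_trans yz)// lerDr.
have [|d [d0 d1 d2] de] := inf_adherent _ hE (eps := e - inf E).
  by rewrite subr_gt0.
rewrite addrC subrK in de.
have h1 := within_dist_support x bK bL d1.
have h2 : support_fun L x <= support_fun K x + d * enorm x.
  apply: within_dist_support => // y Ly; have [z Kz yz] := d2 y Ly.
  by exists z => //; rewrite enormC.
have dex : d * enorm x <= e * enorm x by rewrite ler_wpM2r ?enorm_ge0// ltW.
by rewrite ler_norml; apply/andP; split; lra.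
Qed.

(** Hausdorff convergence is uniform convergence of the support functions on the
    sphere; in this form the limit is seen to contain 0. *)
Lemma zonoid_limit Z : asymmetric_l2_zonoid Z ->
  [/\ convex_body Z, Z 0 & exists (K : nat -> set 'rV[R]_n) (N : nat -> nat)
    (u : forall j, 'I_(N j) -> 'rV[R]_n),
   [/\ forall j, convex_body (K j), forall j, K j 0,
       forall j x, support_fun (K j) x ^+ 2 = frame_sqr (u j) x &
       forall e, 0 < e -> \forall j \near \oo,
         forall x, `|support_fun (K j) x - support_fun Z x| <= e * enorm x]].
Proof.
move=> [bZ [K [zK KZ]]].
have /choice[p pP] : forall j, exists p : {N : nat & 'I_N -> 'rV[R]_n},
    forall x, support_fun (K j) x ^+ 2 = frame_sqr (projT2 p) x.
  by move=> j; have [_ _ [N [u uP]]] := zonotope_frame (zK j); exists (existT _ N u).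
have bK j : convex_body (K j) by have [] := zonotope_frame (zK j).
have K0 j : K j 0 by have [] := zonotope_frame (zK j).
have cvg e : 0 < e -> \forall j \near \oo,
    forall x, `|support_fun (K j) x - support_fun Z x| <= e * enorm x.
  move=> e0; have /cvgrPdist_lt/(_ e e0) := KZ.
  apply: filterS => j; rewrite sub0r normrN => je.
  by apply: hausdorff_support => //; exact: le_lt_trans (ler_norm _) je.
split=> //; last by exists K, (fun j => projT1 (p j)), (fun j => projT2 (p j)).
apply: body_0 => // x; rewrite leNgt; apply/negP => h.
pose e := - support_fun Z x / (1 + enorm x).
have ex : 0 < 1 + enorm x by rewrite ltr_pwDl ?enorm_ge0.
have e0 : 0 < e by rewrite divr_gt0// oppr_gt0.
have [j _ /(_ j (leqnn j) x)] := cvg e e0.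
have := support_fun_ge0 x (bK j) (K0 j).
have eE : e * (1 + enorm x) = - support_fun Z x by rewrite divfK ?gt_eqF.
rewrite ler_norml => h1 /andP[_ h2]; move: eE; rewrite mulrDr mulr1 => eE; lra.
Qed.

Lemma reflection_body K : convex_body K -> K 0 ->
  [/\ convex_body (reflection K), reflection K 0 &
    forall x, support_fun (reflection K) x = support_fun K (- x)].
Proof.
move=> bK K0; have [Ke cK vK] := bK.
have cN : {within K, continuous (fun x => - x : 'rV[R]_n)}.
  by apply: continuous_subspaceT; exact: opp_continuous.
split; last 1 first.
- move=> x; apply: support_fun_eq => [_ [k Kk <-]|].
    by rewrite dotpNr -dotpNl support_fun_ge.
  have [k [Kk kx _]] := body_attained (- x) bK.
  by exists (- k); [exists k|rewrite dotpNr -dotpNl].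
- split; [by exists 0; exists 0; rewrite ?oppr0|exact: continuous_compact|].
  apply/convex_setP => _ _ t [x Kx <-] [y Ky <-] t01.
  exists (t *: x + (1 - t) *: y); first exact: (convex_setP K).1.
  by rewrite opprD !scalerN.
- by exists 0; rewrite ?oppr0.
Qed.

Lemma continuous_rV p (f : 'rV[R]_n -> 'rV[R]_p) :
  (forall i, continuous (fun x => f x 0 i)) -> continuous f.
Proof.
move=> cf x; have FF : Filter (nbhs x) := nbhs_filter x.
apply/cvg_ballP => e e0.
have : \forall y \near x, forall i, ball (f x 0 i) e (f y 0 i).
  apply: (@filter_forall _ _ (fun i y => ball (f x 0 i) e (f y 0 i)) (nbhs x) FF) => i.
  by have /cvg_ballP/(_ e e0) := cf i x.
apply: filterS => y fy; split => // i j; rewrite (ord1 i); exact: fy.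
Qed.

Lemma image_body K (M : 'M[R]_n) : convex_body K ->
  convex_body [set k *m M | k in K] /\
  forall x, support_fun [set k *m M | k in K] x = support_fun K (x *m M^T).
Proof.
move=> bK; have [[k0 Kk0] cK vK] := bK; split; last first.
  move=> x; apply: support_fun_eq => [_ [k Kk <-]|].
    by rewrite dotpC dotp_mulmx dotpC support_fun_ge.
  have [k [Kk kx _]] := body_attained (x *m M^T) bK.
  by exists (k *m M); [exists k|rewrite dotpC dotp_mulmx dotpC].
split; [by exists (k0 *m M); exists k0| |].
  apply: continuous_compact => //; apply: continuous_subspaceT.
  by apply: continuous_rV => i; exact: continuous_mulmx_coord.
apply/convex_setP => _ _ t [x Kx <-] [y Ky <-] t01.
exists (t *: x + (1 - t) *: y); first exact: (convex_setP K).1.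
by rewrite mulmxDl -!scalemxAl.
Qed.

Lemma dotp_direction x : dotp x (direction x) = enorm x.
Proof.
have [->|x0] := eqVneq x 0; first by rewrite dotp0l /enorm dotp0l sqrtr0.
by rewrite -{1}(directionK x) dotpZl direction_unit// mulr1.
Qed.

Lemma ball1_enorm y : ball1 y <-> enorm y <= 1.
Proof.
by rewrite /ball1 /= -enorm_sqr expr_le1// enorm_ge0.
Qed.

Lemma ball1_direction x : ball1 (direction x).
Proof. exact: direction_le1. Qed.

Lemma ball1_body : convex_body (@ball1 R n) /\ forall x, support_fun (@ball1 R n) x = enorm x.
Proof.
have E : @ball1 R n = wulff (@enorm R n).
  apply/seteqP; split => y.
    move=> /ball1_enorm y1 x; apply: le_trans (ler_norm _) _.
    by apply: le_trans (dotp_le_enorm _ _) _; rewrite ler_piMr ?enorm_ge0.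
  move=> /(_ y) yy; apply/ball1_enorm; have [->|y0] := eqVneq y 0.
    by rewrite /enorm dotp0l sqrtr0 ler01.
  have ey : 0 < enorm y by rewrite lt_neqAle eq_sym enorm_eq0 y0 enorm_ge0.
  by rewrite -(ler_pM2l ey) mulr1 -expr2 enorm_sqr.
rewrite E; split; first by apply: wulff_body => x; rewrite dotp0r enorm_ge0.
apply: wulff_support => x; exists (direction x); last exact: dotp_direction.
by rewrite -E; exact: ball1_direction.
Qed.

Definition pos_part x : 'rV[R]_n := \row_i pos (x 0 i).

Lemma dotp_pos_part x : dotp x (pos_part x) = dotp (pos_part x) (pos_part x).
Proof.
apply: eq_bigr => i _; rewrite !mxE /pos; case: leP => // _; by rewrite !mulr0.
Qed.

(** The maximum of x . y over the part of the unit ball with nonnegative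
    coordinates is reached along the positive part of x. *)
Lemma orthant_body : convex_body (@ball1 R n `&` @orthant R n) /\
  forall x, support_fun (@ball1 R n `&` @orthant R n) x = enorm (pos_part x).
Proof.
have E : @ball1 R n `&` @orthant R n = wulff (fun x => enorm (pos_part x)).
  apply/seteqP; split => y.
    move=> [/ball1_enorm y1 yo] x.
    apply: (@le_trans _ _ (dotp (pos_part x) y)).
      by apply: ler_sum => i _; rewrite mxE ler_wpM2r ?yo// le_max lexx.
    apply: le_trans (ler_norm _) _.
    by apply: le_trans (dotp_le_enorm _ _) _; rewrite ler_piMr ?enorm_ge0.
  move=> yh; split.
    apply/ball1_enorm; have [->|y0] := eqVneq y 0.
      by rewrite /enorm dotp0l sqrtr0 ler01.
    have ey : 0 < enorm y by rewrite lt_neqAle eq_sym enorm_eq0 y0 enorm_ge0.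
    rewrite -(ler_pM2l ey) mulr1 -expr2 enorm_sqr; apply: le_trans (yh y) _.
    rewrite -(@ler_pXn2r _ 2) ?nnegrE ?enorm_ge0// !enorm_sqr.
    apply: ler_sum => i _; rewrite !mxE -!expr2 -[leRHS]real_normK ?num_real//.
    by rewrite ler_pXn2r ?nnegrE ?pos_ge0// pos_le.
  move=> i; have := yh (- delta_mx 0 i); rewrite dotpNl dotpC dotp_delta.
  have -> : pos_part (- delta_mx 0 i) = 0.
    by apply/rowP => j; rewrite !mxE /pos; apply/max_idPr; rewrite oppr_le0.
  by rewrite /enorm dotp0l sqrtr0 oppr_le0.
rewrite E; split; first by apply: wulff_body => x; rewrite dotp0r enorm_ge0.
apply: wulff_support => x; exists (direction (pos_part x)).
  rewrite -E; split; first exact: ball1_direction.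
  by move=> i; rewrite !mxE mulr_ge0 ?invr_ge0 ?enorm_ge0 ?pos_ge0.
rewrite -dotp_direction {1}/direction dotpZr dotp_pos_part -dotpZr//.
Qed.

Lemma body_measurable K : convex_body K -> rmset K.
Proof. by move=> bK; apply: rmset_closed; exact: body_closed. Qed.

Lemma volume_le K L : rmset K -> rmset L -> K `<=` L -> (volume K <= volume L)%E.
Proof.
move=> mK mL KL; rewrite !volumeE; apply: le_measure; rewrite ?inE//.
by move=> t; exact: KL.
Qed.

Lemma body_volume_fin K : convex_body K -> volume K \is a fin_num.
Proof.
move=> bK; have [K0 cK _] := bK.
have [p pK pmax] := @compact_EVT_max _ R (fun k => dotp k k) K K0 cK
  (continuous_subspaceT (@continuous_dotpp R n)).
pose r := enorm p + 1; have r0 : 0 < r by rewrite ltr_wpDl ?enorm_ge0.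
rewrite ge0_fin_numE ?volume_ge0//; apply: (@le_lt_trans _ _ (volume (cball r))).
  apply: volume_le; [exact: body_measurable|exact: rmset_cball|].
  move=> k Kk; rewrite /cball /=; apply: le_trans (pmax k _) _; first by rewrite inE.
  rewrite -enorm_sqr ler_pXn2r ?nnegrE ?enorm_ge0 ?(ltW r0)//.
  by rewrite lerDl.
have [b _ bE] := @volume_ball1_fin R n.
by rewrite (volume_cball _ r0) bE -EFinM ltry.
Qed.

(** The linear map that doubles v and fixes the orthogonal hyperplane fixes K,
    but doubles its volume, which is finite. *)
Lemma volume_hyperplane K v : convex_body K -> v != 0 ->
  (forall k, K k -> dotp k v = 0) -> volume K = 0%E.
Proof.
move=> bK v0 Kv.
have [i0] : exists i : 'I_n, v 0 i != 0.
  apply/existsP; rewrite -[X in is_true X]negbK negb_exists; apply/negP => /forallP H.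
  move/eqP: v0; apply; apply/rowP => i; rewrite mxE.
  by apply/eqP; have := H i; rewrite negbK.
move=> _; pose e : 'rV[R]_n := delta_mx 0 i0.
have [|Q QQ vQ] := @householder _ _ v (enorm v *: e).
  by rewrite dotpZl dotpZr dotp_delta mxE !eqxx mulr1 -expr2 enorm_sqr.
have QtQ : Q^T *m Q = 1%:M by apply: mulmx1C.
pose d : 'rV[R]_n := \row_i (if i == i0 then 2 else 1).
pose M := Q *m diag_mx d *m Q^T.
have detM : \det M = 2.
  rewrite !det_mulmx det_tr mulrAC -expr2.
  have -> : (\det Q) ^+ 2 = 1 by rewrite expr2 -{2}det_tr -det_mulmx QQ det1.
  rewrite mul1r det_diag (bigD1 i0)//= mxE eqxx big1 ?mulr1// => i ii.
  by rewrite mxE (negbTE ii).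
have Mu : M \in unitmx by rewrite unitmxE detM unitfE.
have fixK k : K k -> k *m M = k.
  move=> Kk; rewrite /M !mulmxA.
  have k0 : (k *m Q) 0 i0 = 0.
    have := Kv k Kk; rewrite -(orthogonal_dotp k v QQ) vQ dotpZr dotp_delta.
    by move=> /eqP; rewrite mulf_eq0 enorm_eq0 (negbTE v0) => /eqP.
  have -> : k *m Q *m diag_mx d = k *m Q.
    apply/rowP => i; rewrite mul_mx_diag !mxE; case: eqP => [->|_]; last by rewrite mulr1.
    by move: k0; rewrite mxE => ->; rewrite mul0r.
  by rewrite -mulmxA QQ mulmx1.
have imK : [set k *m M | k in K] = K.
  apply/seteqP; split => [_ [k Kk <-]|k Kk]; first by rewrite fixK.
  by exists k; rewrite ?fixK.
have := volume_linear Mu (body_measurable bK); rewrite imK detM.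
have := body_volume_fin bK; case: (volume K) => // a _.
rewrite ger0_norm// -EFinM => -[] a2; congr EFin; lra.
Qed.
End Zonoids.

(** * The volume inequality for zonotopes *)

Section Discrete.
Variables (R : realType) (n : nat).
Implicit Types (x y z k : 'rV[R]_n) (K L Z : set 'rV[R]_n).

Section Frame.
Variables (N : nat) (u : 'I_N -> 'rV[R]_n).

Lemma frame_sqr_image (M : 'M[R]_n) x :
  frame_sqr (fun i => u i *m M) x = frame_sqr u (x *m M^T).
Proof. by apply: eq_bigr => i _; rewrite [dotp x _]dotpC dotp_mulmx dotpC. Qed.

Lemma frame_sqrN x : frame_sqr u x + frame_sqr u (- x) = \sum_i dotp x (u i) ^+ 2.
Proof.
rewrite -big_split /=; apply: eq_bigr => i _; rewrite dotpNl /pos.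
case: (leP (dotp x (u i)) 0) => h; case: (leP (- dotp x (u i)) 0) => h'; try by rewrite ?expr0n/=; nra.
Qed.

(** The matrix of the quadratic form \sum_i (x . u i)^2, which is the squared
    support function of the symmetrized zonotope. *)
Definition moment_mx : 'M[R]_n := \sum_i (u i)^T *m u i.

Lemma moment_mxE x : dotp (x *m moment_mx) x = \sum_i dotp x (u i) ^+ 2.
Proof.
rewrite /moment_mx mulmx_sumr dotp_suml; apply: eq_bigr => i _.
by rewrite mulmxA dotp_scalar mul_scalar_mx dotpZl (dotpC (u i)).
Qed.

Lemma moment_mx_sym : moment_mx^T = moment_mx.
Proof. by rewrite /moment_mx raddf_sum /=; apply: eq_bigr => i _; rewrite trmx_mul trmxK. Qed.

Lemma moment_mx_image (M : 'M[R]_n) :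
  \sum_i (u i *m M)^T *m (u i *m M) = M^T *m moment_mx *m M.
Proof.
rewrite /moment_mx mulmx_sumr mulmx_suml; apply: eq_bigr => i _.
by rewrite trmx_mul !mulmxA.
Qed.

Lemma moment_isotropic (C : 'M[R]_n) : C \in unitmx -> C *m C^T = moment_mx ->
  isotropic (fun i => u i *m (invmx C)^T).
Proof.
move=> Cu CE; rewrite /isotropic moment_mx_image trmxK -CE mulmxA mulVmx// mul1mx.
by rewrite -trmx_mul mulVmx// trmx1.
Qed.

End Frame.

(** For y = \sum_i f i *: v i and any x, the Cauchy-Schwarz inequality bounds x
    . y by the Euclidean norm of the positive parts of the x . v i, that is by
    the support function of K. *)
Lemma frame_sqr_sub K N (v : 'I_N -> 'rV[R]_n) (f : 'I_N -> R) :
  convex_body K -> K 0 -> (forall x, support_fun K x ^+ 2 = frame_sqr v x) ->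
  (forall i, 0 <= f i) -> \sum_i f i ^+ 2 <= 1 -> K (\sum_i f i *: v i).
Proof.
move=> bK K0 hK f0 f1; apply: separation => // x.
pose p : 'rV[R]_N := \row_i f i; pose q : 'rV[R]_N := \row_i pos (dotp x (v i)).
apply: (@le_trans _ _ (dotp p q)).
  rewrite dotp_sumr; apply: ler_sum => i _; rewrite dotpZr !mxE ler_wpM2l//.
  by rewrite le_max lexx.
have pp : dotp p p <= 1.
  by apply: le_trans f1; apply: ler_sum => i _; rewrite !mxE expr2.
have qq : dotp q q = support_fun K x ^+ 2.
  by rewrite hK; apply: eq_bigr => i _; rewrite !mxE expr2.
apply: le_trans (ler_norm _) _.
rewrite -(@ler_pXn2r _ 2) ?nnegrE ?support_fun_ge0//.
rewrite real_normK ?num_real//; apply: le_trans (dotp_cauchy _ _) _.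
by rewrite qq ler_piMl// sqr_ge0.
Qed.

(** By [frame_sqr_sub] and homogeneity, the squared gauge of K at \sum_i f i *:
    v i is at most \sum_i f i ^+ 2. *)
Lemma radial_fun_frame K N (v : 'I_N -> 'rV[R]_n) (f : 'I_N -> R) :
  convex_body K -> K 0 -> (forall x, support_fun K x ^+ 2 = frame_sqr v x) ->
  (forall i, 0 <= f i) ->
  ((expR (- \sum_i f i ^+ 2))%:E <= radial_fun K (\sum_i f i *: v i))%E.
Proof.
move=> bK K0 hK f0; pose rho := Num.sqrt (\sum_i f i ^+ 2).
have s0 : 0 <= \sum_i f i ^+ 2 by apply: sumr_ge0 => i _; exact: sqr_ge0.
have rE : rho ^+ 2 = \sum_i f i ^+ 2 by rewrite sqr_sqrtr.
have yE : \sum_i f i *: v i = rho *: \sum_i (f i / rho) *: v i.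
  rewrite scaler_sumr; apply: eq_bigr => i _; rewrite scalerA mulrCA.
  have [r0|r0] := eqVneq rho 0; last by rewrite divff ?mulr1.
  have fi0 : f i = 0.
    apply/eqP; rewrite -sqrf_eq0 eq_le sqr_ge0 andbT.
    move: rE; rewrite r0 expr0n /= => rE; rewrite [leRHS]rE (bigD1 i)//= lerDl.
    by apply: sumr_ge0 => j _; exact: sqr_ge0.
  by rewrite fi0 !(mul0r, mulr0).
rewrite yE -rE; apply: radial_fun_ge; [exact: body_measurable| |exact: sqrtr_ge0].
move=> t t01; rewrite -[_ *: _]addr0 -[X in _ + X](scaler0 _ (1 - t)).
have [_ _ vK] := bK; apply: (convex_setP K).1 => //.
apply: (frame_sqr_sub bK K0 hK) => [i|]; first by rewrite divr_ge0 ?sqrtr_ge0.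
have [r0|r0] := eqVneq rho 0.
  by rewrite big1 ?ler01// => i _; rewrite r0 invr0 mulr0 expr0n.
under eq_bigr do rewrite exprMn.
by rewrite -mulr_suml -rE -exprMn divff ?expr1n.
Qed.

(** The map (invmx C)^T makes the frame isotropic. Both |K| and the Gaussian
    integral in [frame_integral_ge] become volumes after division by the radial
    moment. *)
Lemma zonotope_volume_ge : exists2 kappa : R, 0 < kappa &
  forall N (u : 'I_N -> 'rV[R]_n) K (C : 'M[R]_n),
    convex_body K -> K 0 -> (forall x, support_fun K x ^+ 2 = frame_sqr u x) ->
    C \in unitmx -> C *m C^T = moment_mx u ->
  ((`|\det C| * (fine (volume (@ball1 R n)) / 2 ^+ n +
     kappa * total_misfit (fun i => u i *m (invmx C)^T)))%:E <= volume K)%E.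
Proof.
have [k k0 kP] := frame_integral_ge R n; have [m m0 mE] := @radial_moment_fin R n.
have [b b0 bE] := @volume_ball1_fin R n.
have := @moment_ball1 R n; rewrite mE bE -EFinM => -[mb].
exists (k / m); first exact: divr_gt0.
move=> N u K C bK K0 hK Cu CE; set v := fun i => _.
have iso : isotropic v by exact: moment_isotropic.
have [bL hL] := image_body (invmx C)^T bK; set L := [set _ | _ in _] in bL hL.
have L0 : L 0 by exists 0; rewrite ?mul0mx.
have hLv x : support_fun L x ^+ 2 = frame_sqr v x by rewrite hL hK frame_sqr_image.
have mL := body_measurable bL.
have := kP N v (radial_fun L) iso (rmfun_radial mL) (radial_fun_ge0 L)
  (fun f f0 => radial_fun_frame bL L0 hLv f0).
rewrite Lint_radial// mE -mb volume_linear ?unitmx_tr ?unitmx_inv//; last exact: body_measurable.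
rewrite det_tr det_inv; have := body_volume_fin bK; case: (volume K) => // V _.
have dC : 0 < `|\det C| by rewrite normr_gt0 -unitfE.
rewrite -!EFinM !lee_fin normfV => H.
have -> : `|\det C| * (b / 2 ^+ n + k / m * total_misfit v) =
  `|\det C| / m * (m * b / 2 ^+ n + k * total_misfit v).
  by field; rewrite ?gt_eqF// ?exprn_gt0.
apply: (@le_trans _ _ (`|\det C| / m * (m * (`|\det C|^-1 * V)))).
  by rewrite ler_wpM2l// ltW// divr_gt0.
by apply: eq_ler; field; rewrite !gt_eqF.
Qed.

(** The rows of W are the images by C^T of the vectors chosen by [greedy_frame]
    in the isotropic position. *)
Lemma near_orthogonal N (u : 'I_N -> 'rV[R]_n) (C : 'M[R]_n) (t : R) :
  C \in unitmx -> C *m C^T = moment_mx u -> 0 < t ->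
  n.+1%:R ^+ n * total_misfit (fun i => u i *m (invmx C)^T) <= t ^+ 2 ->
  exists W : 'M[R]_n, forall x,
    `|frame_sqr u x - \sum_a pos (dotp x (row a W)) ^+ 2| <=
       (2 * n%:R ^+ 2 + 2 * n%:R) * t * dotp (x *m moment_mx u) x /\
    forall a, dotp x (row a W) ^+ 2 <= dotp (x *m moment_mx u) x.
Proof.
move=> Cu CE t0; set v := fun i => _ => tm.
have iso : isotropic v by exact: moment_isotropic.
have [e eP] := greedy_frame iso (leqnn n).
have qE x : dotp (x *m moment_mx u) x = dotp (x *m C) (x *m C).
  by rewrite -CE mulmxA dotp_mulmx trmxK.
have uE : frame_sqr u = fun x => frame_sqr v (x *m C).
  by apply/funext => x; rewrite frame_sqr_image trmxK -mulmxA mulmxV// mulmx1.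
have WE a x : dotp x (e a *m C^T) = dotp (x *m C) (e a) by rewrite dotp_mulmx.
exists (\matrix_(a < n) (e a *m C^T)) => x; split.
  rewrite uE qE; under eq_bigr do rewrite rowK WE.
  apply: frame_approx => // [a an|a b an bn ba|a an].
  - by have [] := eP a an.
  - have [_ _ /(_ b bn ba) h] := eP a an.
    rewrite -(@ler_pXn2r _ 2) ?nnegrE ?normr_ge0 ?(ltW t0)// real_normK ?num_real//.
    exact: le_trans h tm.
  - by have [_ h _] := eP a an; exact: le_trans h tm.
move=> a; rewrite rowK WE qE; apply: le_trans (dotp_cauchy _ _) _.
by have [-> _ _] := eP a (ltn_ord a); rewrite mulr1.
Qed.

End Discrete.

(** * Limits of zonotopes *)

Section Limit.
Variables (R : realType) (n : nat).
Implicit Types (x y : 'rV[R]_n).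

Lemma body_bounded (Z : set 'rV[R]_n) : convex_body Z ->
  exists2 r, 0 <= r & forall x, support_fun Z x <= r * enorm x.
Proof.
move=> bZ; have [|r r0 zr] := within_dist_ex bZ (L := [set 0]); first by exists 0.
exists r => // x; apply: le_trans (within_dist_support x bZ (set0_body _ _) zr) _.
by rewrite support_fun0 add0r.
Qed.

(** K j is eventually contained in any fixed neighbourhood F k of Z, and the F k
    decrease to Z. *)
Lemma volume_usc (Z : set 'rV[R]_n) (K : nat -> set 'rV[R]_n) (d : R) :
  convex_body Z -> Z 0 -> (forall j, convex_body (K j)) ->
  (forall e, 0 < e -> \forall j \near \oo,
     forall x, `|support_fun (K j) x - support_fun Z x| <= e * enorm x) ->
  0 < d -> \forall j \near \oo, (volume (K j) <= volume Z + d%:E)%E.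
Proof.
move=> bZ Z0 bK cK d0.
pose F k := wulff (fun x => support_fun Z x + k.+1%:R^-1 * enorm x).
have F0 k : F k 0.
  move=> x; rewrite dotp0r addr_ge0 ?support_fun_ge0// mulr_ge0 ?enorm_ge0//.
have bF k : convex_body (F k) by apply: wulff_body; exact: F0.
have mF k : measurable (@row_of R n @^-1` (F k)) by exact: body_measurable (bF k).
have capF : \bigcap_k F k = Z.
  apply/seteqP; split => [y yF|y Zy k _ x]; last first.
    by rewrite -[dotp x y]addr0 lerD ?support_fun_ge// mulr_ge0 ?invr_ge0 ?enorm_ge0.
  apply: separation => // x; apply/ler_addgt0Pr => e e0.
  have e1 : 0 < e / (1 + enorm x) by rewrite divr_gt0// ltr_pwDl ?enorm_ge0.
  have [k _ /(_ k (leqnn k)) /= ke] := near_infty_natSinv_lt (PosNum e1).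
  apply: le_trans (yF k I x) _; rewrite lerD2l.
  apply: (@le_trans _ _ (e / (1 + enorm x) * enorm x)).
    by rewrite ler_wpM2r ?enorm_ge0// ltW.
  rewrite -mulrA ler_piMr ?(ltW e0)// mulrC ler_pdivrMr ?mul1r ?lerDr//.
  by rewrite ltr_pwDl ?enorm_ge0.
have cvF : leb R n (@row_of R n @^-1` (F k)) @[k --> \oo] --> leb R n (@row_of R n @^-1` Z).
  rewrite -capF preimage_bigcap; apply: nonincreasing_cvg_mu => //.
  - by rewrite -ge0_fin_numE ?measure_ge0//; have := body_volume_fin (bF 0%N); rewrite volumeE.
  - exact: bigcap_measurable.
  - move=> k l kl; apply/subsetPset => t Ft x; apply: le_trans (Ft x) _.
    by rewrite lerD2l ler_wpM2r ?enorm_ge0// lef_pV2 ?posrE// ler_nat.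
rewrite -volumeE in cvF.
have [V VE] : exists V, volume Z = V%:E.
  by exists (fine (volume Z)); rewrite fineK ?body_volume_fin.
rewrite VE in cvF *; have cvf : fine (leb R n (@row_of R n @^-1` (F k))) @[k --> \oo] --> V by exact: fine_cvg.
have /cvgrPdist_lt/(_ d d0)[k _ /(_ k (leqnn k)) /=] := cvf.
have [W WE] : exists W, volume (F k) = W%:E.
  by exists (fine (volume (F k))); rewrite fineK ?body_volume_fin.
rewrite -volumeE WE /= => VW.
have k0 : 0 < k.+1%:R^-1 :> R by rewrite invr_gt0.
apply: filterS (cK _ k0) => j jk; apply: (@le_trans _ _ (volume (F k))).
  apply: volume_le; [exact: body_measurable|exact: body_measurable|].
  move=> y Ky x; apply: le_trans (support_fun_ge x (bK j) Ky) _.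
  by have := jk x; rewrite ler_norml => /andP[_]; rewrite lerBlDl.
rewrite WE -EFinD lee_fin; move: VW; rewrite ltr_norml => /andP[]; lra.
Qed.

Lemma enormN x : enorm (- x) = enorm x.
Proof. by rewrite /enorm dotpNl dotpNr opprK. Qed.

Section Sequence.
Variables (Z : set 'rV[R]_n) (K : nat -> set 'rV[R]_n).
Variables (N : nat -> nat) (u : forall j, 'I_(N j) -> 'rV[R]_n).
Hypotheses (bZ : convex_body Z) (Z0 : Z 0).
Hypotheses (bK : forall j, convex_body (K j)) (K0 : forall j, K j 0).
Hypothesis hK : forall j x, support_fun (K j) x ^+ 2 = frame_sqr (@u j) x.
Hypothesis cK : forall e, 0 < e -> \forall j \near \oo,
  forall x, `|support_fun (K j) x - support_fun Z x| <= e * enorm x.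

Lemma near_support_sqr (e : R) : 0 < e -> \forall j \near \oo, forall x,
  `|support_fun (K j) x ^+ 2 - support_fun Z x ^+ 2| <= e * dotp x x.
Proof.
move=> e0; have [r r0 rP] := body_bounded bZ.
pose d := Num.min 1 (e / (2 * r + 1)).
have r1 : 0 < 2 * r + 1 by lra.
have d0 : 0 < d by rewrite lt_min ltr01 divr_gt0.
have de : d * (2 * r + 1) <= e by rewrite -ler_pdivlMr// ge_min lexx orbT.
have d1 : d <= 1 by rewrite ge_min lexx.
apply: filterS (cK d0) => j jd x; have := jd x; have := rP x.
have := support_fun_ge0 x bZ Z0; have := support_fun_ge0 x (bK j) (K0 j).
have x0 := enorm_ge0 x; rewrite -enorm_sqr.
set a := support_fun (K j) x; set b := support_fun Z x; move: (enorm x) x0 => w w0 a0 b0 bw abw.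
rewrite subr_sqr normrM; have ab : a + b <= (2 * r + 1) * w.
  move: abw; rewrite ler_norml => /andP[_ h].
  have : d * w <= w by rewrite ler_piMl.
  lra.
rewrite [`|a + b|]ger0_norm ?addr_ge0//.
apply: (@le_trans _ _ (d * w * ((2 * r + 1) * w))).
  by apply: ler_pM => //; rewrite addr_ge0.
have -> : d * w * ((2 * r + 1) * w) = d * (2 * r + 1) * w ^+ 2 by ring.
by rewrite ler_wpM2r ?sqr_ge0.
Qed.

Let quad x := support_fun Z x ^+ 2 + support_fun Z (- x) ^+ 2.

Lemma near_moment (e : R) : 0 < e -> \forall j \near \oo, forall x,
  `|dotp (x *m moment_mx (@u j)) x - quad x| <= e * dotp x x.
Proof.
move=> e0; have e2 : 0 < e / 2 by rewrite divr_gt0.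
apply: filterS (near_support_sqr e2) => j je x.
rewrite moment_mxE -frame_sqrN -!hK /quad.
have := je x; have := je (- x); rewrite dotpNl dotpNr opprK !ler_norml.
by move=> /andP[h1 h2] /andP[h3 h4]; apply/andP; split; lra.
Qed.

Lemma cvg_moment x : dotp (x *m moment_mx (@u j)) x @[j --> \oo] --> quad x.
Proof.
apply/cvgrPdist_le => e e0.
have x1 : 0 < 1 + dotp x x by rewrite ltr_pwDl ?dotpp_ge0.
have e1 : 0 < e / (1 + dotp x x) by rewrite divr_gt0.
apply: filterS (near_moment e1) => j /(_ x) jx; rewrite distrC; apply: le_trans jx _.
by rewrite mulrAC ler_pdivrMr// ler_wpM2l ?(ltW e0)// lerDr.
Qed.

(** Polarization: a symmetric matrix is determined by its quadratic form, entry
    by entry, through finitely many values. *)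
Lemma moment_entry (A : 'M[R]_n) i k : A^T = A ->
  A i k = (dotp ((delta_mx 0 i + delta_mx 0 k) *m A) (delta_mx 0 i + delta_mx 0 k)
    - dotp (delta_mx 0 i *m A) (delta_mx 0 i) - dotp (delta_mx 0 k *m A) (delta_mx 0 k)) / 2.
Proof.
move=> At; rewrite mulmxDl !(dotpDl, dotpDr) !dotp_delta -!rowE !mxE.
by have -> : A k i = A i k; [rewrite -{1}At mxE|field].
Qed.

Lemma limit_moment : exists A : 'M[R]_n, [/\ A^T = A,
  forall x, dotp (x *m A) x = quad x &
  forall i k, moment_mx (@u j) i k @[j --> \oo] --> A i k].
Proof.
pose d (i : 'I_n) : 'rV[R]_n := delta_mx 0 i.
pose A : 'M[R]_n := \matrix_(i, k) ((quad (d i + d k) - quad (d i) - quad (d k)) / 2).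
have cA i k : moment_mx (@u j) i k @[j --> \oo] --> A i k.
  under eq_fun do rewrite (moment_entry i k (moment_mx_sym _)).
  rewrite mxE; apply: cvgM; last exact: cvg_cst.
  by apply: cvgB; [apply: cvgB|]; exact: cvg_moment.
exists A; split => //.
  by apply/matrixP => i k; rewrite !mxE (addrC (d k) (d i)); congr (_ / 2); rewrite addrAC.
move=> x; have c1 : dotp (x *m moment_mx (@u j)) x @[j --> \oo] --> dotp (x *m A) x.
  apply: cvg_sumf => i _; apply: cvgM; last exact: cvg_cst.
  rewrite mxE; under eq_fun do rewrite mxE.
  by apply: cvg_sumf => k _; apply: cvgM; [exact: cvg_cst|exact: cA].
have c2 := @cvg_moment x.
by rewrite -(cvg_lim (@Rhausdorff R) c1) (cvg_lim (@Rhausdorff R) c2).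
Qed.

Lemma cvg_sqrt_det (A : 'M[R]_n) : (forall i k, moment_mx (@u j) i k @[j --> \oo] --> A i k) ->
  Num.sqrt (\det (moment_mx (@u j))) @[j --> \oo] --> Num.sqrt (\det A).
Proof.
move=> cA; apply: (@continuous_cvg _ _ _ _ _ _ (@Num.sqrt R)); first exact: sqrt_continuous.
rewrite /determinant; apply: cvg_sumf => p _; apply: cvgM; first exact: cvg_cst.
by apply: cvg_prodf => i _; exact: cA.
Qed.

End Sequence.
End Limit.

Section Limit.
Variables (R : realType) (n : nat).
Implicit Types (x y : 'rV[R]_n).

Section Sequence.
Variables (Z : set 'rV[R]_n) (K : nat -> set 'rV[R]_n).
Variables (N : nat -> nat) (u : forall j, 'I_(N j) -> 'rV[R]_n).
Hypotheses (bZ : convex_body Z) (Z0 : Z 0).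
Hypotheses (bK : forall j, convex_body (K j)) (K0 : forall j, K j 0).
Hypothesis hK : forall j x, support_fun (K j) x ^+ 2 = frame_sqr (@u j) x.
Hypothesis cK : forall e, 0 < e -> \forall j \near \oo,
  forall x, `|support_fun (K j) x - support_fun Z x| <= e * enorm x.

Let g (W : 'M[R]_n) x := \sum_a pos (dotp x (row a W)) ^+ 2.

Let frame_const : R := 2 * n%:R ^+ 2 + 2 * n%:R.

(** The conclusion of [near_orthogonal], for t arbitrarily small. *)
Hypothesis near_frame : forall t, 0 < t -> \forall j \near \oo, exists W : 'M[R]_n, forall x,
  `|frame_sqr (@u j) x - g W x| <= frame_const * t * dotp (x *m moment_mx (@u j)) x /\
  forall a, dotp x (row a W) ^+ 2 <= dotp (x *m moment_mx (@u j)) x.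

(** The error in [near_frame] is measured by the moment matrices. These are
    eventually bounded, which gives one scale for the error and one bound for
    the entries of W. *)
Lemma approx_frame : exists B : R, forall e, 0 < e -> exists W : 'M[R]_n,
  (forall a l, `|W a l| <= B) /\ forall x, `|support_fun Z x ^+ 2 - g W x| <= e * dotp x x.
Proof.
have [r r0 rP] := body_bounded bZ; pose B := 2 * r ^+ 2 + 1.
have B1 : 1 <= B by rewrite lerDr mulr_ge0// sqr_ge0.
exists B => e e0.
have c0 : 0 <= frame_const by rewrite addr_ge0// mulr_ge0// exprn_ge0.
pose t := e / (2 * (frame_const + 1) * B).
have t0 : 0 < t by rewrite divr_gt0// mulr_gt0//; lra.
have e2 : 0 < e / 2 by rewrite divr_gt0.
have := near_support_sqr bZ Z0 bK K0 cK e2; have := near_moment bZ Z0 bK K0 hK cK ltr01.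
move=> h1 h2; have := filterI (filterI h1 h2) (near_frame t0).
move=> [j _ /(_ j (leqnn j))] [[/= jm js] [W WP]].
have qB x : dotp (x *m moment_mx (@u j)) x <= B * dotp x x.
  have := jm x; rewrite ler_norml => /andP[_].
  have h : support_fun Z x ^+ 2 + support_fun Z (- x) ^+ 2 <= 2 * r ^+ 2 * dotp x x.
    rewrite -enorm_sqr -mulrA -exprMn mulr_natl mulr2n lerD//.
      by rewrite ler_pXn2r ?nnegrE ?mulr_ge0 ?support_fun_ge0 ?enorm_ge0.
    by rewrite -[enorm x]enormN ler_pXn2r ?nnegrE ?mulr_ge0 ?support_fun_ge0 ?enorm_ge0.
  rewrite /B mulrDl; lra.
exists W; split.
  move=> a l; have [_ /(_ a)] := WP (delta_mx 0 l).
  rewrite dotpC dotp_delta mxE => h.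
  have := le_trans h (qB _); rewrite dotp_delta mxE !eqxx mulr1 => Wl.
  rewrite -(@ler_pXn2r _ 2) ?nnegrE ?normr_ge0 ?(le_trans ler01)//.
  by rewrite real_normK ?num_real// (le_trans Wl)// expr2 ler_peMr// (le_trans ler01).
move=> x; have [+ _] := WP x; have := js x; have := qB x; rewrite hK.
have : frame_const * t * (B * dotp x x) <= e / 2 * dotp x x.
  rewrite mulrA ler_wpM2r ?dotpp_ge0//.
  have -> : frame_const * t * B = e / 2 * (frame_const / (frame_const + 1)).
    by rewrite /t; field; rewrite !gt_eqF//; lra.
  by rewrite ler_piMr ?(ltW e2)// ler_pdivrMr ?mul1r ?lerDl//; lra.
move=> h3 h4 h5 h6.
have h7 : frame_const * t * dotp (x *m moment_mx (@u j)) x <= e / 2 * dotp x x.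
  by apply: le_trans h3; rewrite ler_wpM2l// mulr_ge0// ltW.
move: h5 h6; rewrite !ler_norml => /andP[h8 h9] /andP[h10 h11].
by apply/andP; split; lra.
Qed.

Lemma continuous_frame x : continuous (fun w : 'rV[R]_(n * n) => g (vec_mx w) x).
Proof.
have posE a : pos a = (a + `|a|) / 2.
  by rewrite /pos; case: (leP a 0) => h; [rewrite ler0_norm//|rewrite gtr0_norm//]; lra.
move=> w; have FF : Filter (nbhs w) := nbhs_filter w.
apply: (@cvg_sumf R _ (nbhs w) FF) => a _.
have c : dotp x (row a (vec_mx y)) @[y --> w] --> dotp x (row a (vec_mx w)).
  apply: (@cvg_sumf R _ (nbhs w) FF) => l _.
  apply: cvgM; first exact: cst_continuous.
  rewrite !mxE; under eq_fun do rewrite !mxE.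
  exact: coord_continuous.
apply: (@continuous_cvg _ _ _ _ _ _ (fun a : R => pos a ^+ 2)) => //.
rewrite (_ : (fun _ => _) = (fun a : R => ((a + `|a|) / 2) * ((a + `|a|) / 2))); last first.
  by apply/funext => b; rewrite posE expr2.
by apply: continuousM; (apply: continuousM; [|exact: cst_continuous]);
  apply: continuousD => //; exact: norm_continuous.
Qed.

(** The approximate frames W k stay in a compact set; a cluster point satisfies
    every closed condition that holds for all large k. *)
Lemma limit_frame : exists W : 'M[R]_n, forall x,
  support_fun Z x ^+ 2 = \sum_a pos (dotp x (row a W)) ^+ 2.
Proof.
have [B BP] := approx_frame.
have /choice[W WP] : forall k : nat, exists W : 'M[R]_n,
  (forall a l, `|W a l| <= B) /\ forall x, `|support_fun Z x ^+ 2 - g W x| <= k.+1%:R^-1 * dotp x x.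
  by move=> k; apply: BP; rewrite invr_gt0.
pose S := [set w : 'rV[R]_(n * n) | forall i, `|w 0 i| <= B].
have cS : compact S.
  apply: bounded_closed_compact; first by apply: (@bounded_coords _ _ S B) => w i; exact.
  rewrite (_ : S = \bigcap_i [set w : 'rV[R]_(n * n) | `|w 0 i| <= B]); last first.
    by apply/seteqP; split => [w h i _|w h i]; apply: h.
  apply: closed_bigI => i _.
  rewrite (_ : [set w | _] = (fun w : 'rV[R]_(n * n) => `|w 0 i|) @^-1` [set r | r <= B])//.
  apply: closed_comp => [w _|]; last exact: closed_le.
  by apply: continuous_comp; [exact: coord_continuous|exact: norm_continuous].
have [|w [_]] := cS (mxvec (W k) @[k --> \oo]) _.
  exists 0%N => // k _ i; case/mxvec_indexP: i => a l; rewrite mxvecE.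
  by have [] := WP k.
rewrite clusterE => wcl; exists (vec_mx w) => x; rewrite -/(g _ _).
apply/eqP; rewrite -subr_eq0 -normr_le0; apply/ler_addgt0Pr => e e0; rewrite add0r.
have x1 : 0 < 1 + dotp x x by rewrite ltr_pwDl ?dotpp_ge0.
have e1 : 0 < e / (1 + dotp x x) by rewrite divr_gt0.
pose E := [set w : 'rV[R]_(n * n) | `|support_fun Z x ^+ 2 - g (vec_mx w) x| <= e].
have cE : closed E.
  rewrite (_ : E = (fun w : 'rV[R]_(n * n) => `|support_fun Z x ^+ 2 - g (vec_mx w) x|) @^-1` [set r | r <= e])//.
  apply: closed_comp => [y _|]; last exact: closed_le.
  apply: (@continuous_cvg _ _ _ _ _ _ (fun r : R => `|support_fun Z x ^+ 2 - r|)); last first.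
    exact: continuous_frame.
  apply: continuous_comp; last exact: norm_continuous.
  by apply: continuousB => //; exact: cst_continuous.
  exact: (nbhs_filter y).
have : closure E w.
  apply: wcl; apply: filterS (near_infty_natSinv_lt (PosNum e1)) => k /= ke.
  rewrite /E /= mxvecK; have [_ /(_ x) h] := WP k; apply: le_trans h _.
  apply: (@le_trans _ _ (e / (1 + dotp x x) * dotp x x)).
    by rewrite ler_wpM2r ?dotpp_ge0// ltW.
  by rewrite mulrAC ler_pdivrMr// ler_wpM2l ?(ltW e0)// lerDr.
by move/cE.
Qed.

End Sequence.
End Limit.

(** * The inequality and its equality cases *)

Section Main.
Variables (R : realType) (n : nat).
Implicit Types (x y : 'rV[R]_n).

Section Body.
Variable Z : set 'rV[R]_n.
Hypotheses (bZ : convex_body Z) (Z0 : Z 0).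
Let E := l2sum Z (reflection Z).
Let quad x := support_fun Z x ^+ 2 + support_fun Z (- x) ^+ 2.

Lemma symmetrization_body : [/\ convex_body E, E 0 & forall x, support_fun E x ^+ 2 = quad x].
Proof.
have [bN N0 hN] := reflection_body bZ Z0; have [bE E0 hE] := l2sum_body bZ bN Z0 N0.
by split => // x; rewrite hE hN.
Qed.

(** The support function of Z vanishes at x and - x, and so does that of the
    symmetrization E: both bodies are orthogonal to x. *)
Lemma degenerate_volume x : x != 0 -> quad x = 0 ->
  [/\ volume Z = 0%E, volume E = 0%E & exists H : set 'rV[R]_n, hyperplane H /\ Z `<=` H].
Proof.
move=> x0 qx; have [bE E0 hE] := symmetrization_body.
have qNx : quad (- x) = 0 by rewrite /quad opprK addrC.
have zero (L : set 'rV[R]_n) : convex_body L -> support_fun L x = 0 -> support_fun L (- x) = 0 ->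
    forall k, L k -> dotp k x = 0.
  move=> bL h1 h2 k Lk; have := support_fun_ge x bL Lk; have := support_fun_ge (- x) bL Lk.
  by rewrite h1 h2 dotpNl oppr_le0 dotpC => a b; apply/eqP; rewrite eq_le a b.
have zeroE : forall k, E k -> dotp k x = 0.
  by apply: zero => //; apply/eqP; rewrite -sqrf_eq0 hE ?qx ?qNx.
have /andP[/eqP h1 /eqP h2] : (support_fun Z x == 0) && (support_fun Z (- x) == 0).
  by rewrite -(sqrf_eq0 (support_fun Z x)) -(sqrf_eq0 (support_fun Z (- x))) -paddr_eq0 ?sqr_ge0//; apply/eqP.
have zeroZ := zero Z bZ h1 h2.
split; [exact: volume_hyperplane zeroZ|exact: volume_hyperplane zeroE|].
by exists [set y | dotp y x = 0]; split => //; exists x, 0.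
Qed.

Lemma hyperplane_degenerate (H : set 'rV[R]_n) : hyperplane H -> Z `<=` H ->
  exists2 x, x != 0 & quad x = 0.
Proof.
move=> [v [c [v0 ->]]] ZH; exists v => //.
have c0 : c = 0 by rewrite -(ZH 0 Z0) dotp0l.
rewrite /quad !(@support_fun_eq _ _ _ _ 0) ?expr0n ?addr0//.
- by move=> k /ZH /=; rewrite c0 dotpNl dotpC => ->; rewrite oppr0.
- by exists 0; rewrite ?dotp0r.
- by move=> k /ZH /=; rewrite c0 dotpC => ->.
- by exists 0; rewrite ?dotp0r.
Qed.

Lemma support_sqr_inj (K L : set 'rV[R]_n) : convex_body K -> convex_body L -> K 0 -> L 0 ->
  (forall x, support_fun K x ^+ 2 = support_fun L x ^+ 2) -> K = L.
Proof.
move=> bK bL K0 L0 KL; apply: body_unique => // x.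
by apply/eqP; rewrite -(@eqrXn2 _ 2) ?support_fun_ge0//; apply/eqP.
Qed.

(** A body is determined by its squared support function, here that of the image
    of the unit ball by C^T. *)
Lemma ellipsoid_volume (C : 'M[R]_n) : C \in unitmx ->
  (forall x, dotp (x *m (C *m C^T)) x = quad x) ->
  volume E = (`|\det C|%:E * volume (@ball1 R n))%E.
Proof.
move=> Cu qC; have [bE E0 hE] := symmetrization_body; have [bB hB] := @ball1_body R n.
have [bI hI] := image_body C^T bB.
have -> : E = [set w *m C^T | w in @ball1 R n].
  apply: support_sqr_inj => //.
    by exists 0; rewrite ?mul0mx// /ball1 /= dotp0l ler01.
  by move=> x; rewrite hI hE -qC trmxK hB enorm_sqr mulmxA dotp_mulmx trmxK.
by rewrite volume_linear ?unitmx_tr ?det_tr//; exact: body_measurable.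
Qed.

End Body.

Lemma l2sum_segments (v : 'I_n -> 'rV[R]_n) :
  let Z := l2sum_seq (fun i => segment 0 (v i)) in
  [/\ convex_body Z, Z 0 &
     forall x, support_fun Z x ^+ 2 = \sum_i pos (dotp x (v i)) ^+ 2].
Proof.
have v0 i : segment 0 (v i) 0.
  by exists 0; rewrite /= ?in_itv /= ?lexx ?ler01// scaler0 scale0r addr0.
have [bZ Z0 hZ] := l2sum_seqP (fun i => segment_body 0 (v i)) v0.
split => // x; rewrite hZ; apply: eq_bigr => i _.
by rewrite segment_support// dotp0r /pos maxxx expr0n /= add0r.
Qed.

(** For linearly independent v i, Z is the image of the positive part of the
    unit ball and its symmetrization the image of the whole ball, both by the
    matrix V. *)
Lemma segments_equality (v : 'I_n -> 'rV[R]_n) (Z := l2sum_seq (fun i => segment 0 (v i))) :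
  volume (l2sum Z (reflection Z)) = ((2 ^+ n)%:E * volume Z)%E.
Proof.
have [bZ Z0 hZ] := l2sum_segments v; rewrite -/Z in bZ Z0 hZ.
pose V : 'M[R]_n := \matrix_i v i.
have VE x i : (x *m V^T) 0 i = dotp x (v i).
  by rewrite !mxE; apply: eq_bigr => l _; rewrite !mxE.
have qE x : dotp (x *m (V^T *m V^T^T)) x = support_fun Z x ^+ 2 + support_fun Z (- x) ^+ 2.
  rewrite mulmxA dotp_mulmx trmxK !hZ; have := frame_sqrN v x.
  by rewrite /frame_sqr => ->; apply: eq_bigr => i _; rewrite VE expr2.
have [Vu|] := boolP (V \in unitmx); last first.
  rewrite unitmxE unitfE negbK -det_tr => /det0P[x x0 xV].
  have [|-> -> _] := @degenerate_volume Z bZ Z0 x x0; last by rewrite mule0.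
  by rewrite -qE mulmxA xV mul0mx dotp0l.
rewrite (ellipsoid_volume bZ Z0 _ qE) ?unitmx_tr// volume_ball1_orthant.
have [bO hO] := @orthant_body R n; have [bI hI] := image_body V bO.
have -> : Z = [set w *m V | w in @ball1 R n `&` @orthant R n].
  apply: support_sqr_inj => //.
    exists 0; rewrite ?mul0mx//; split => [|i]; last by rewrite mxE.
    by rewrite /ball1 /= dotp0l ler01.
  move=> x; rewrite hI hO enorm_sqr hZ; apply: eq_bigr => i _.
  by rewrite [in RHS]mxE VE expr2.
by rewrite volume_linear ?det_tr//; [rewrite muleCA|exact: body_measurable].
Qed.

Section Nondegenerate.
Variables (Z : set 'rV[R]_n) (K : nat -> set 'rV[R]_n).
Variables (N : nat -> nat) (u : forall j, 'I_(N j) -> 'rV[R]_n).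
Hypotheses (bZ : convex_body Z) (Z0 : Z 0).
Hypotheses (bK : forall j, convex_body (K j)) (K0 : forall j, K j 0).
Hypothesis hK : forall j x, support_fun (K j) x ^+ 2 = frame_sqr (@u j) x.
Hypothesis cK : forall e, 0 < e -> \forall j \near \oo,
  forall x, `|support_fun (K j) x - support_fun Z x| <= e * enorm x.
Variable C : 'M[R]_n.
Hypothesis Cu : C \in unitmx.
Hypothesis cA : forall i k, moment_mx (@u j) i k @[j --> \oo] --> (C *m C^T) i k.

Let beta := fine (volume (@ball1 R n)) / 2 ^+ n.
Let V := fine (volume Z).

Lemma sqrt_det_gram (B : 'M[R]_n) : Num.sqrt (\det (B *m B^T)) = `|\det B|.
Proof. by rewrite det_mulmx det_tr -expr2 sqrtr_sqr. Qed.

(** For large j the factorization C' of the moment matrix of K j has almost the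
    determinant of C, and the volume of K j exceeds that of Z by at most d. *)
Lemma near_volume : exists2 c : R, 0 < c & forall d, 0 < d -> \forall j \near \oo,
  exists C' : 'M[R]_n, [/\ C' \in unitmx, C' *m C'^T = moment_mx (@u j) &
    c * total_misfit (fun i => @u j i *m (invmx C')^T) + `|\det C| * beta <= V + d * (1 + beta)].
Proof.
have [k k0 kP] := zonotope_volume_ge R n; pose D := `|\det C|.
have D0 : 0 < D by rewrite normr_gt0 -unitfE.
exists (D / 2 * k); first by rewrite mulr_gt0// divr_gt0.
move=> d d0; have b0 : 0 <= beta by rewrite divr_ge0 ?fine_ge0 ?volume_ge0.
have cD := cvg_sqrt_det cA; rewrite sqrt_det_gram -/D in cD.
have d1 : 0 < Num.min d (D / 2) by rewrite lt_min d0 divr_gt0.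
have /cvgrPdist_le/(_ _ d1) hD := cD; have hV := volume_usc bZ Z0 bK cK d0.
apply: filterS (filterI hV hD) => j [/= vj].
have [C' C'E] : exists C' : 'M[R]_n, C' *m C'^T = moment_mx (@u j).
  apply: gram_factor; first exact: moment_mx_sym.
  by move=> x; rewrite moment_mxE sumr_ge0// => i _; exact: sqr_ge0.
rewrite -C'E sqrt_det_gram le_min !ler_norml => /andP[/andP[h1 h2] /andP[h3 h4]].
have C'u : C' \in unitmx by rewrite unitmxE unitfE -normr_gt0; lra.
exists C'; split => //.
have := kP _ _ _ _ (bK j) (K0 j) (hK j) C'u C'E.
set tm := total_misfit _; have tm0 : 0 <= tm by exact: total_misfit_ge0.
move=> /le_trans/(_ vj); rewrite -(fineK (body_volume_fin bZ)) -/V -EFinD lee_fin -/beta => H.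
have h5 : D / 2 * (k * tm) <= `|\det C'| * (k * tm).
  by rewrite ler_wpM2r ?mulr_ge0 ?(ltW k0)//; lra.
have h6 : D * beta <= `|\det C'| * beta + d * beta.
  by rewrite -mulrDl ler_wpM2r//; lra.
move: H; rewrite mulrDr -/D; lra.
Qed.

Lemma nondegenerate_le : `|\det C| * beta <= V.
Proof.
have [c c0 cP] := near_volume; have b0 : 0 <= beta by rewrite divr_ge0 ?fine_ge0 ?volume_ge0.
apply/ler_addgt0Pr => e e0.
have b1 : 0 < 1 + beta by lra.
have e1 : 0 < e / (1 + beta) by rewrite divr_gt0.
have [j _ /(_ j (leqnn j)) [C' [_ _]]] := cP _ e1.
rewrite divfK ?gt_eqF//; apply: le_trans.
by rewrite lerDr mulr_ge0 ?(ltW c0)// total_misfit_ge0.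
Qed.

(** In case of equality [near_volume] leaves only a multiple of d for the total
    misfit of K j, so that [near_orthogonal] applies to it with arbitrarily
    small t. *)
Lemma nondegenerate_eq : `|\det C| * beta = V ->
  exists v : 'I_n -> 'rV[R]_n, Z = l2sum_seq (fun i => segment 0 (v i)).
Proof.
move=> CV; have [c c0 cP] := near_volume.
have b0 : 0 <= beta by rewrite divr_ge0 ?fine_ge0 ?volume_ge0.
have b1 : 0 < 1 + beta by lra.
have n0 : 0 < n.+1%:R ^+ n :> R by rewrite exprn_gt0.
have [|W WP] := limit_frame bZ Z0 bK K0 hK cK.
  move=> t t0; pose d := c * t ^+ 2 / n.+1%:R ^+ n / (1 + beta).
  have d0 : 0 < d by rewrite !divr_gt0// mulr_gt0// exprn_gt0.
  apply: filterS (cP d d0) => j [C' [C'u C'E]]; rewrite CV addrC lerD2l => H.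
  apply: (near_orthogonal C'u C'E t0); move: H.
  rewrite /d divfK ?gt_eqF// -mulrA ler_pM2l// ler_pdivlMr// mulrC //.
exists (fun a => row a W); have [bS S0 hS] := l2sum_segments (fun a => row a W).
by apply: support_sqr_inj => // x; rewrite hS WP.
Qed.

End Nondegenerate.
End Main.

Theorem theorem2 (R : realType) (n : nat) (Z : set 'rV[R]_n)
    (hZ : asymmetric_l2_zonoid Z) :
  (volume (l2sum Z (reflection Z)) <= (2 ^+ n)%:E * volume Z)%E /\
  (volume (l2sum Z (reflection Z)) = ((2 ^+ n)%:E * volume Z)%E <->
   (exists H : set 'rV[R]_n, hyperplane H /\ Z `<=` H) \/
   (exists v : 'I_n -> 'rV[R]_n, Z = l2sum_seq (fun i => segment 0 (v i)))).
Proof.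
have [bZ Z0 [K [N [u [bK K0 hK cK]]]]] := zonoid_limit hZ.
set E := l2sum Z (reflection Z).
have converse : (exists H, hyperplane H /\ Z `<=` H) \/
    (exists v : 'I_n -> 'rV[R]_n, Z = l2sum_seq (fun i => segment 0 (v i))) ->
    volume E = ((2 ^+ n)%:E * volume Z)%E.
  move=> [[H [hH ZH]]|[v vE]]; last by rewrite /E vE segments_equality.
  have [x x0 qx] := hyperplane_degenerate Z0 hH ZH.
  by have [-> -> _] := degenerate_volume bZ Z0 x0 qx; rewrite mule0.
have [A [At qA cA]] := limit_moment bZ Z0 bK K0 hK cK.
have [|C CA] := gram_factor At.
  by move=> x; rewrite qA addr_ge0 ?sqr_ge0.
have [Cu|] := boolP (C \in unitmx); last first.
  rewrite unitmxE unitfE negbK => /det0P[x x0 xC].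
  have [|ZV EV H] := degenerate_volume bZ Z0 x0.
    by rewrite -qA -CA mulmxA xC mul0mx dotp0l.
  by rewrite /E EV ZV mule0; split => //; split => // _; left.
rewrite -CA in qA cA.
have := ellipsoid_volume bZ Z0 Cu qA; rewrite -/E.
have := nondegenerate_le bZ Z0 bK K0 hK cK Cu cA.
have := nondegenerate_eq bZ Z0 bK K0 hK cK Cu cA.
have [b b0 ->] := @volume_ball1_fin R n; rewrite -(fineK (body_volume_fin bZ)) /=.
have p0 : 0 < 2 ^+ n :> R by rewrite exprn_gt0.
move=> eqV leV EV; split.
  by rewrite EV -!EFinM lee_fin -ler_pdivrMl// mulrCA [_^-1 * _]mulrC.
split=> [VE|]; last by rewrite fineK ?body_volume_fin.
right; apply: eqV; move: VE; rewrite EV -!EFinM => -[VE].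
by rewrite mulrA VE mulrC mulKf ?gt_eqF.
Qed.
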